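(* Let $1<p<2$, let $q=\frac{p}{p-1}$, let $\beta\ge 0$ be such that $\beta q<1$, and set $\alpha=\frac{2}{q}(1-\beta q)$. (1) If $u\in\ell^1_\beta(\mathbb{Z})$ and $\mathcal{Z}(\widehat{u})$ has strong $\alpha$-measure $0$, then $u$ is cyclic in $\ell^p_\beta(\mathbb{Z})$. (2) For every $\gamma>\frac{2}{q}$, there exists a closed subset $E\subset\mathbb{T}$ such that every $u\in\ell^1_\beta(\mathbb{Z})$ satisfying $\mathcal{Z}(\widehat{u})=E$ is not cyclic in $\ell^p_\beta(\mathbb{Z})$ and such that $H_h(E)=0$, where $h(t)=t^\alpha\ln(e/t)^{-\gamma}$.
   Context: For $p\ge 1$ and $\beta\in\mathbb{R}$, $\ell^p_\beta(\mathbb{Z})$ is the Banach space of all complex sequences $u=(u_n)_{n\in\mathbb{Z}}$ with $\|u\|_{\ell^p_\beta}^p=\sum_{n\in\mathbb{Z}}|u_n|^p(1+|n|)^{p\beta}<\infty$. For $\beta\ge 0$, a vector $u\in\ell^p_\beta(\mathbb{Z})$ is called cyclic in $\ell^p_\beta(\mathbb{Z})$ if the linear span of its translates $\{(u_{n+k})_{n\in\mathbb{Z}} : k\in\mathbb{Z}\}$ is dense in $\ell^p_\beta(\mathbb{Z})$. The circle is $\mathbb{T}=\mathbb{R}/2\pi\mathbb{Z}$. For $u\in\ell^1_\beta(\mathbb{Z})$ with $\beta\ge0$, $\widehat{u}(t)=\sum_{n\in\mathbb{Z}}u_ne^{int}$ is a continuous function on $\mathbb{T}$ and $\mathcal{Z}(\widehat{u})=\{t\in\mathbb{T}:\widehat{u}(t)=0\}$.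 Strong $\alpha$-measure $0$ ($\alpha\in(0,1)$): for a compact set $E\subset\mathbb{T}$, let $(a_k,b_k)$, $k\in\mathbb{N}=\{0,1,2,\dots\}$, be the complementary intervals of $E$ (the connected components of $\mathbb{T}\setminus E$) arranged in non-increasing order of lengths (if there are only finitely many, the missing terms $b_k-a_k$ are taken to be $0$), and set $r_n=2\pi-\sum_{k=0}^n(b_k-a_k)$. Then $E$ has strong $\alpha$-measure $0$ if $\lim_{n\to\infty}r_n\,n^{\frac1\alpha-1}=0$. $h$-measure: for $E\subset\mathbb{T}$ and $h$ continuous and non-decreasing with $h(0)=0$, $H_h(E)=\lim_{\delta\to0}\inf\{\sum_{i=0}^\infty h(|U_i|) : E\subset\bigcup_{i=0}^\infty U_i,\ |U_i|\le\delta\}$, where the $U_i$ are open intervals of $\mathbb{T}$ and $|U_i|$ is the length of $U_i$. Only the values of $h(t)$ for small $t$ matter; one sets $h(0)=0$. *)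

(* Defs.v *)
From HB Require Import structures.
From mathcomp Require Import all_boot all_order all_algebra.
From mathcomp Require Import complex.
From mathcomp Require Import all_classical all_reals all_analysis.

Set Implicit Arguments.
Unset Strict Implicit.
Unset Printing Implicit Defensive.

Import Order.TTheory GRing.Theory Num.Theory.
Import numFieldNormedType.Exports.
Import ComplexField.Normc.

Local Open Scope classical_set_scope.
Local Open Scope ring_scope.
Local Open Scope quotient_scope.

Section Circle.
Variable R : realType.

Definition congr_2pi (s t : R) : bool :=
  `[< exists k : int, t = s + k%:~R * (2 * pi) >].

Lemma congr_2pi_equiv : equiv_class_of congr_2pi.
Proof.
split.
- by move=> s; apply/asboolP; exists 0; rewrite mul0r addr0.
- have sym s t : congr_2pi s t -> congr_2pi t s.
    move=> /asboolP[k ->]; apply/asboolP; exists (- k).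
    by rewrite rmorphN /= mulNr addrK.
  by move=> s t; apply/idP/idP; exact: sym.
- move=> t s r /asboolP[k ->] /asboolP[l ->]; apply/asboolP; exists (k + l).
  by rewrite intrD (mulrDl k%:~R) addrA.
Qed.

Canonical congr_2pi_rel := EquivRelPack congr_2pi_equiv.

Definition circle := quotient_topology {eq_quot congr_2pi_rel}.

Definition circle_pi (t : R) : circle := \pi_circle t.

(* The image of ]a, b[ has length b - a when a <= b <= a + 2 * pi; the whole
   circle, which is the connected component of the complement of the empty set,
   has length 2 * pi. *)
Definition arc_length (A : set circle) : R :=
  fine (lebesgue_measure (circle_pi @^-1` A `&` `[0, 2 * pi[%classic)).

Definition open_arc (U : set circle) : Prop :=
  exists a b : R, U = circle_pi @` `]a, b[%classic.

(* I lists the connected components of the complement of E, each exactly once,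
   by non-increasing length; if they are finitely many, the remaining terms are
   empty (of length 0). *)
Definition complementary_intervals (E : set circle) (I : nat -> set circle) :=
  [/\ forall k, I k = set0 \/
        exists2 t, (~` E) t & I k = connected_component (~` E) t,
      forall t, (~` E) t -> exists k, I k = connected_component (~` E) t,
      forall j k, I j = I k -> I j !=set0 -> j = k
    & forall k, arc_length (I k.+1) <= arc_length (I k)].

Definition strong_measure0 (alpha : R) (E : set circle) : Prop :=
  exists2 I, complementary_intervals E I &
    (fun n : nat => (2 * pi - \sum_(k < n.+1) arc_length (I k)) *
                    n%:R `^ (alpha^-1 - 1)) @ \oo --> (0 : R).

(* Empty arcs are allowed in the covers; they have length 0 and contribute
   h 0 = 0. *)
Definition hmeasure_delta (h : R -> R) (E : set circle) (delta : R) : \bar R :=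
  ereal_inf [set s | exists U : nat -> set circle,
    [/\ forall i, open_arc (U i) /\ arc_length (U i) <= delta,
        E `<=` \bigcup_i U i &
        s = (\sum_(0 <= i <oo) (h (arc_length (U i)))%:E)%E]].

Definition hmeasure (h : R -> R) (E : set circle) : \bar R :=
  lim (hmeasure_delta h E delta @[delta --> 0^'+]).

Definition log_gauge (alpha gamma t : R) : R :=
  if t == 0 then 0 else t `^ alpha * ln (expR 1 / t) `^ (- gamma).

End Circle.

Section WeightedSequences.
Variable R : realType.
Implicit Types (p beta : R) (u v : int -> R[i]).

Definition lpw_sum p beta u : \bar R :=
  (\esum_(n in [set: int])
     (normc (u n) `^ p * (1 + `|n|%:~R) `^ (p * beta))%:E)%E.

Definition lpw p beta : set (int -> R[i]) :=
  [set u | (lpw_sum p beta u < +oo)%E].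

Definition lpw_norm p beta u : \bar R := (lpw_sum p beta u `^ p^-1)%E.

(* For 1 <= p the membership clause in [cyclic] below is thus automatic for the
   elements of l^1_beta. *)
Lemma lpw1_sub p beta : 1 <= p -> lpw 1 beta `<=` lpw p beta.
Proof.
move=> p1 u; rewrite /lpw /= /lpw_sum => u1.
set x : int -> R := fun n => normc (u n) * (1 + `|n|%:~R) `^ beta.
have n0 (z : R[i]) : 0 <= normc z by case: z => a b; exact: sqrtr_ge0.
have x0 n : 0 <= x n by rewrite mulr_ge0 // powR_ge0.
have x1 n : normc (u n) `^ 1 * (1 + `|n|%:~R) `^ (1 * beta) = x n.
  by rewrite mul1r powRr1.
have xp n : normc (u n) `^ p * (1 + `|n|%:~R) `^ (p * beta) =
    x n * x n `^ (p - 1).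
  have -> : x n * x n `^ (p - 1) = x n `^ p.
    have [->|xn0] := eqVneq (x n) 0.
      by rewrite mul0r powR0 // gt_eqF // (lt_le_trans _ p1).
    rewrite -[X in X * _](powRr1 (x0 n)) -powRD ?xn0 ?implybT //.
    by rewrite addrC subrK.
  by rewrite powRM ?powR_ge0 // -powRrM (mulrC p).
rewrite (eq_esum (fun n _ => congr1 EFin (x1 n))) in u1.
rewrite (eq_esum (fun n _ => congr1 EFin (xp n))).
set S := (\esum_(n in _) (x n)%:E)%E in u1.
have S0 : (0 <= S)%E by apply: esum_ge0 => n _; rewrite lee_fin.
have SE : S = (fine S)%:E by rewrite fineK // ge0_fin_numE.
have xS n : x n <= fine S.
  rewrite -lee_fin -SE; apply: esum_ge; exists [set n].
    by split; [exact: finite_set1|].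
  by rewrite fsbig_set1.
apply: (@le_lt_trans _ _
  (\esum_(n in [set: int]) ((fine S `^ (p - 1))%:E * (x n)%:E))%E).
  apply: le_esum => n _; rewrite -EFinM lee_fin mulrC ler_wpM2r //.
  by rewrite ge0_ler_powR ?nnegrE ?subr_ge0 // fine_ge0.
apply: (@le_lt_trans _ _ ((fine S `^ (p - 1))%:E * S)%E).
  apply: ge_ereal_sup => _ [X XT <-].
  rewrite -ge0_mule_fsumr; last by move=> n; rewrite lee_fin.
  by rewrite lee_wpmul2l ?lee_fin ?powR_ge0 //; apply: esum_ge; exists X.
by rewrite SE -EFinM ltry.
Qed.

Definition translate (k : int) u : int -> R[i] := fun n => u (n + k).

Definition translate_span u : set (int -> R[i]) :=
  [set v | exists s : seq (R[i] * int),
     v = (fun n => \sum_(c <- s) c.1 * translate c.2 u n)].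

Definition cyclic p beta u : Prop :=
  lpw p beta u /\
  forall v, lpw p beta v -> forall e : R, 0 < e ->
    exists2 w, translate_span u w &
      (lpw_norm p beta (fun n => v n - w n)%R < e%:E)%E.

Definition expi (t : R) : R[i] := (cos t +i* sin t)%C.

Lemma expi_2pi (t : R) (m : int) : expi (t + m%:~R * (2 * pi)) = expi t.
Proof.
have nat_case (n : nat) (s : R) : expi (s + n%:R * (2 * pi)) = expi s.
  rewrite mulr_natl [2 * pi]mulr_natl /expi.
  by rewrite (periodicn (@cosD2pi R)) (periodicn (@sinD2pi R)).
case: m => n; first exact: nat_case.
by rewrite NegzE mulrNz mulNr -[in RHS](subrK (n.+1%:R * (2 * pi)) t) nat_case.
Qed.

(* The series is absolutely convergent for u in l^1_beta with beta >= 0, so the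
   limit of its symmetric partial sums is its sum; [fourier_pi] shows that the
   value does not depend on the representative of t. *)
Definition fourier u (t : circle R) : R[i] :=
  limn (fun N : nat => \sum_(i < N.*2.+1)
    let n : int := i%:Z - N%:Z in u n * expi (n%:~R * repr t) : R[i]^o).

Lemma fourier_pi u (t : R) :
  fourier u (circle_pi t) =
  limn (fun N : nat => \sum_(i < N.*2.+1)
    let n : int := i%:Z - N%:Z in u n * expi (n%:~R * t) : R[i]^o).
Proof.
have /asboolP[k tE] : congr_2pi (repr (circle_pi t)) t.
  rewrite -[congr_2pi _ _]/(congr_2pi_rel R (repr (circle_pi t)) t).
  by apply/(eqmodP (congr_2pi_rel R)); rewrite -[LHS]/(\pi_(circle R) _) reprK.
rewrite /fourier; apply: (congr1 (fun f : nat -> R[i]^o => limn f)).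
apply: funext => N; apply: eq_bigr => i _ /=.
by rewrite [in RHS]tE mulrDr (mulrA (i%:Z - N%:Z)%:~R k%:~R) -intrM expi_2pi.
Qed.

Definition zero_set u : set (circle R) := [set t | fourier u t = 0].

End WeightedSequences.

(* Main.v *)
(* Translates of [u] span a dense subspace as soon as the delta sequence at 0 is
   in their closure. A function which vanishes near the zeros of the Fourier
   series of [u] has its coefficients in that closure: this is Wiener's lemma,
   proved by Newman's method, expanding [f / u^] in powers of [P - u^] for a
   partial sum [P] of [u^]. Under the strong measure hypothesis the constant 1
   is approximated by such functions [f], equal to 1 outside a small neighborhood
   of the zero set: the complement of [n + 1] intervals has measure [r_n], so
   [1 - f] has squared L^2 norm about [r_n] and squared energy about
   [n ^ 2 / r_n], and Hoelder's inequality gives an l^p_beta norm about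
   [(r_n n ^ (1 / alpha - 1)) ^ (alpha / 2)]. Fourier coefficients are ultralimits
   of averages over finer and finer grids, for which Bessel's inequality reduces
   to a finite orthogonality relation.

   For the second part, a set [E] carrying a probability measure with Fourier
   coefficients in the dual space l^q_(- beta) cannot be the zero set of a cyclic
   vector. The set is an intersection of finite unions of segments of length
   [l_j]. The segments of one stage are chosen at random among the subsegments
   of the previous one; if there are [N] of them, moment estimates bound the
   change of the coefficients in l^q_(- beta) by a multiple of
   [(N l_j ^ alpha) ^ (- 1 / 2)]. Taking for [N] a large multiple of
   [l_j ^ (- alpha)] keeps this change small, whereas the logarithm in the gauge
   makes the covering sums tend to 0 with [l_j]. *)

Require Import Defs.
From HB Require Import structures.
From mathcomp Require Import all_boot all_order all_algebra.
From mathcomp Require Import complex.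
From mathcomp Require Import all_classical all_reals all_analysis.
From mathcomp Require Import ring lra zify.

Set Implicit Arguments.
Unset Strict Implicit.
Unset Printing Implicit Defensive.

Import Order.TTheory GRing.Theory Num.Theory.
Import numFieldNormedType.Exports.
Import ComplexField.Normc.

Local Open Scope classical_set_scope.
Local Open Scope ring_scope.

(** The Fourier side rests on a linear functional on bounded functions that is bounded by the sup
    norm, exact on exponentials and subject to Bessel's inequality; an ultralimit of grid averages
    has these properties without any question of measurability. Energy is discrete too: a difference
    over one grid step multiplies the coefficient of index [n] by about [|n|] times the step, which
    replaces differentiation. Cutting the circle at a zero of the series turns the complementary
    intervals into intervals of the line.

    The limit measure on the thin set is never formed. If [w] in the span of the translates is close
    to the delta sequence, its series [W] vanishes on the set, so by compactness it is small on all
    segments of a late stage. There [1 - W] is close to 1, while its average over the stage is a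
    pairing bounded uniformly in the stage. Randomness is counting: if every selection failed, each
    of the finitely many selections would have a finite set of frequencies as witness, and the union
    of these sets would contradict the averaged moment bound. *)

Local Notation Re := complex.Re.
Local Notation Im := complex.Im.

(** * Modulus of complex numbers and elementary bounds for [expi] *)

Section ComplexModulus.
Variable R : realType.
Implicit Types (z w : R[i]) (x y t : R).

Lemma normc_ge0 z : 0 <= normc z.
Proof. by case: z => a b; exact: sqrtr_ge0. Qed.

Lemma normc_sqr z : normc z ^+ 2 = Re z ^+ 2 + Im z ^+ 2.
Proof. by case: z => a b /=; rewrite sqr_sqrtr// addr_ge0// sqr_ge0. Qed.

Lemma normc_sqrC z : (normc z ^+ 2)%:C%C = z * (z^*)%C.
Proof.
rewrite normc_sqr; case: z => a b /=; apply/eqP; rewrite eq_complex /=.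
by apply/andP; split; apply/eqP; ring.
Qed.

Lemma ReD z w : Re (z + w) = Re z + Re w. Proof. by case: z; case: w. Qed.
Lemma ImD z w : Im (z + w) = Im z + Im w. Proof. by case: z; case: w. Qed.
Lemma ReN z : Re (- z) = - Re z. Proof. by case: z. Qed.
Lemma ImN z : Im (- z) = - Im z. Proof. by case: z. Qed.

Lemma Re_sum (I : Type) (r : seq I) (P : pred I) (F : I -> R[i]) :
  Re (\sum_(i <- r | P i) F i) = \sum_(i <- r | P i) Re (F i).
Proof. by apply: (big_morph _ ReD). Qed.

Lemma Im_sum (I : Type) (r : seq I) (P : pred I) (F : I -> R[i]) :
  Im (\sum_(i <- r | P i) F i) = \sum_(i <- r | P i) Im (F i).
Proof. by apply: (big_morph _ ImD). Qed.

Lemma Re_le z : `|Re z| <= normc z.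
Proof.
rewrite -ler_sqr ?nnegrE ?normc_ge0// normc_sqr real_normK ?num_real//.
by rewrite lerDl sqr_ge0.
Qed.

Lemma Im_le z : `|Im z| <= normc z.
Proof.
rewrite -ler_sqr ?nnegrE ?normc_ge0// normc_sqr real_normK ?num_real//.
by rewrite lerDr sqr_ge0.
Qed.

Lemma normc_le z : normc z <= `|Re z| + `|Im z|.
Proof.
rewrite -ler_sqr ?nnegrE ?normc_ge0 ?addr_ge0// normc_sqr sqrrD.
rewrite !real_normK ?num_real// -addrA [X in _ <= _ + X]addrC addrA lerDl.
by rewrite mulrn_wge0// mulr_ge0.
Qed.

Lemma normc_real x : normc x%:C%C = `|x|.
Proof. by rewrite /= expr0n addr0 sqrtr_sqr. Qed.

Lemma normc_nat n : normc (n%:R : R[i]) = n%:R.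
Proof. by rewrite -(rmorph_nat (real_complex R)) normc_real normr_nat. Qed.

Lemma normcX z n : normc (z ^+ n) = normc z ^+ n.
Proof.
by elim: n => [|n ih]; rewrite ?expr0 ?normc1// !exprS normcM ih.
Qed.

Lemma normc_sum (I : Type) (r : seq I) (P : pred I) (F : I -> R[i]) :
  normc (\sum_(i <- r | P i) F i) <= \sum_(i <- r | P i) normc (F i).
Proof.
elim/big_ind2 : _ => [||//]; first by rewrite normc0.
by move=> a b c d ab cd; rewrite (le_trans (le_normcD _ _))// lerD.
Qed.

Lemma normcB z w : normc (z - w) = normc (w - z).
Proof. by rewrite -(opprB w z) normcN. Qed.

Lemma normcB_ge z w : normc z - normc w <= normc (z - w).
Proof. by rewrite lerBlDr (le_trans _ (le_normcD _ _))// subrK. Qed.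

Lemma normc_triangle z w v : normc (z - v) <= normc (z - w) + normc (w - v).
Proof. by rewrite (le_trans _ (le_normcD _ _))// addrA subrK. Qed.

Lemma normc_eq0 z : (normc z == 0) = (z == 0).
Proof. by apply/eqP/eqP => [/eq0_normc//|->]; rewrite normc0. Qed.

Lemma normc_gt0 z : (0 < normc z) = (z != 0).
Proof. by rewrite lt_def normc_ge0 andbT normc_eq0. Qed.

Lemma expi0 : expi 0 = 1 :> R[i].
Proof. by rewrite /expi cos0 sin0. Qed.

Lemma expiD x y : expi (x + y) = expi x * expi y.
Proof.
rewrite /expi cosD sinD; apply/eqP; rewrite eq_complex /=.
by apply/andP; split; apply/eqP; ring.
Qed.

Lemma expiN x : expi (- x) = ((expi x)^*)%C.
Proof. by rewrite /expi cosN sinN. Qed.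

Lemma normc_expi x : normc (expi x) = 1.
Proof. by rewrite /= cos2Dsin2 sqrtr1. Qed.

Lemma expiMn n x : expi (n%:R * x) = expi x ^+ n.
Proof.
elim: n => [|n ih]; first by rewrite mul0r expi0.
by rewrite -natr1 mulrDl mul1r expiD ih exprSr.
Qed.

Lemma expi_sub1_sqr y : normc (expi y - 1) ^+ 2 = 4 * sin (y / 2) ^+ 2.
Proof.
rewrite normc_sqr /= subr0.
have {1 2}-> : y = (y / 2) *+ 2 by rewrite mulr2n -splitr.
rewrite cos_mulr2n sin_mulr2n sin2cos2 exprMn_n exprMn sin2cos2.
ring.
Qed.

Lemma sin_norm_le x : `|sin x| <= `|x|.
Proof.
wlog x0 : x / 0 < x.
  move=> h; have [x0|/h//|->] := ltgtP x 0; last by rewrite sin0.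
  by rewrite -normrN -sinN -[leRHS]normrN h// oppr_gt0.
have [|c _] := @MVT R sin cos 0 x x0 (fun c _ => is_derive_sin c).
  by apply: continuous_subspaceT => ?; exact: continuous_sin.
rewrite sin0 !subr0 => ->; rewrite normrM ler_piMl// ; exact: cos_max.
Qed.

Lemma expi_sub1_le y : normc (expi y - 1) <= `|y|.
Proof.
rewrite -ler_sqr ?nnegrE ?normc_ge0// expi_sub1_sqr.
rewrite -(real_normK (num_real (sin _))).
have := sin_norm_le (y / 2); rewrite normrM [`|2^-1|]ger0_norm// => h.
have -> : `|y| ^+ 2 = 4 * (`|y| / 2) ^+ 2 by field.
by rewrite ler_wpM2l// lerXn2r ?nnegrE// divr_ge0.
Qed.

Lemma expi_sub_le x y : normc (expi x - expi y) <= `|x - y|.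
Proof.
rewrite -{1}[x](subrK y) expiD -{2}[expi y]mul1r -mulrBl normcM normc_expi mulr1.
exact: expi_sub1_le.
Qed.

Lemma cos_sub1_norm y : `|cos y - 1| = 2 * sin (y / 2) ^+ 2.
Proof.
have {1}-> : y = (y / 2) *+ 2 by rewrite mulr2n -splitr.
rewrite cos_mulr2n cos2sin2 -normrN ger0_norm; first by ring.
by rewrite [leRHS](_ : _ = 2 * sin (y / 2) ^+ 2)//; [rewrite mulr_ge0// sqr_ge0|ring].
Qed.

Lemma cos_sub1_le y : `|cos y - 1| <= `|y| ^+ 2.
Proof.
rewrite cos_sub1_norm -(real_normK (num_real (sin _))).
have := sin_norm_le (y / 2); rewrite normrM [`|2^-1|]ger0_norm// => h.
have : `|sin (y / 2)| ^+ 2 <= (`|y| / 2) ^+ 2.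
  by rewrite lerXn2r ?nnegrE// divr_ge0.
by move: (sqr_ge0 `|y|); nra.
Qed.

Lemma cos_sub1_le1 y : `|cos y - 1| <= `|y|.
Proof.
rewrite cos_sub1_norm -(real_normK (num_real (sin _))).
have := sin_norm_le (y / 2); rewrite normrM [`|2^-1|]ger0_norm// => h.
have h1 := sin_max (y / 2).
by move: (normr_ge0 (sin (y / 2))); nra.
Qed.

Lemma sin_sub_le y : `|sin y - y| <= `|y| ^+ 2.
Proof.
wlog y0 : y / 0 < y.
  move=> h; have [y0|/h//|->] := ltgtP y 0; last by rewrite sin0 subrr normr0 expr0n.
  have := h (- y); rewrite oppr_gt0 => /(_ y0).
  by rewrite sinN -opprD !normrN.
have [|c] := @MVT R sin cos 0 y y0 (fun c _ => is_derive_sin c).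
  by apply: continuous_subspaceT => ?; exact: continuous_sin.
rewrite in_itv/= => /andP[c0 cy]; rewrite sin0 !subr0 => ->.
rewrite -{2}[y]mul1r -mulrBl normrM expr2 ler_wpM2r//.
by rewrite (le_trans (cos_sub1_le1 _))// !gtr0_norm// ltW.
Qed.

Lemma expi_taylor y : normc (expi y - 1 - (0 +i* y)%C) <= 2 * `|y| ^+ 2.
Proof.
rewrite (le_trans (normc_le _))//= subr0.
rewrite [X in `|X|](_ : _ = cos y - 1); last by ring.
have := cos_sub1_le y; have := sin_sub_le y.
rewrite subr0; lra.
Qed.

(** In this range the Taylor error [2 |y|^2] is at most half of the linear term. With [y] a
    frequency times a grid step, [expi y - 1] can then stand for a derivative. *)
Lemma expi_sub1_ge y : `|y| <= 4^-1 -> `|y| / 2 <= normc (expi y - 1).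
Proof.
move=> y4; have := normc_triangle (0 +i* y)%C 0 (expi y - 1 - (0 +i* y)%C).
have := le_normcD (expi y - 1) (- (expi y - 1 - (0 +i* y)%C)).
rewrite normcN opprB addrCA subrr addr0 => h _.
have := expi_taylor y; move: h.
have -> : normc (0 +i* y)%C = `|y| by rewrite /= expr0n/= add0r sqrtr_sqr.
by move: (normr_ge0 y) y4; set n1 := normc (expi y - 1); set n2 := normc _; nra.
Qed.

End ComplexModulus.

(** * Families with bounded finite sums, and Hoelder's inequality *)

Section Sums.
Variable R : realType.
Implicit Types (a b : int -> R) (B : R).

(** For nonnegative terms this bounds the extended sum over [int] ([sum_leP]), in a form that leaves
    only finite sums in the estimates. *)
Definition sum_le a B := forall X : seq int, uniq X -> \sum_(n <- X) a n <= B.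

Lemma sum_le_ge0 a B : sum_le a B -> 0 <= B.
Proof. by move=> /(_ [::] isT); rewrite big_nil. Qed.

Lemma le_sum_le a b B : (forall n, a n <= b n) -> sum_le b B -> sum_le a B.
Proof. by move=> ab bB X uX; rewrite (le_trans _ (bB X uX))// ler_sum. Qed.

Lemma sum_le_trans a B B' : B <= B' -> sum_le a B -> sum_le a B'.
Proof. by move=> BB' aB X /aB aX; exact: le_trans BB'. Qed.

Lemma sum_leZ a B (c : R) : 0 <= c -> sum_le a B -> sum_le (fun n => c * a n) (c * B).
Proof. by move=> c0 aB X uX; rewrite -mulr_sumr ler_wpM2l// aB. Qed.

Lemma sum_leD a b B B' :
  sum_le a B -> sum_le b B' -> sum_le (fun n => a n + b n) (B + B').
Proof. by move=> aB bB X uX; rewrite big_split lerD// ?aB// bB. Qed.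

Lemma sum_le_shift a B k : sum_le a B -> sum_le (fun n => a (n + k)) B.
Proof.
move=> aB X uX; rewrite -(big_map (fun n => n + k) predT a) aB//.
by rewrite map_inj_uniq//; exact: addIr.
Qed.

Lemma sum_le1 a B n : sum_le a B -> a n <= B.
Proof. by move=> /(_ [:: n] isT); rewrite big_seq1. Qed.

Lemma ler_sum_sub (I : eqType) (F : I -> R) (X Y : seq I) :
  (forall i, 0 <= F i) -> uniq X -> uniq Y -> {subset X <= Y} ->
  \sum_(i <- X) F i <= \sum_(i <- Y) F i.
Proof.
move=> F0 uX uY XY; rewrite [leRHS](bigID (mem X)) /= -[leLHS]addr0.
rewrite lerD ?sumr_ge0// -[leRHS]big_filter le_eqVlt; apply/orP; left; apply/eqP.
apply: perm_big; rewrite uniq_perm// ?filter_uniq// => i.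
by rewrite mem_filter; case: (boolP (i \in X)) => // /XY ->.
Qed.

Lemma sum_leP a B : (forall n, 0 <= a n) ->
  sum_le a B <-> (\esum_(n in [set: int]) (a n)%:E <= B%:E)%E.
Proof.
move=> a0; split => [aB|aB X uX].
  apply: ge_ereal_sup => _ [A [/finite_seqP[X ->] _] <-].
  have -> : [set` X] = [set` undup X].
    by apply/seteqP; split => n /=; rewrite mem_undup.
  by rewrite -fsbig_seq ?undup_uniq// sumEFin lee_fin aB ?undup_uniq.
rewrite -lee_fin (le_trans _ aB)//; apply: esum_ge; exists [set` X].
  by split; [exact: finite_seq|].
by rewrite -fsbig_seq// sumEFin.
Qed.

Lemma esum_ltyP a : (forall n, 0 <= a n) ->
  (exists B, sum_le a B) <-> (\esum_(n in [set: int]) (a n)%:E < +oo)%E.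
Proof.
move=> a0; split => [[B /(sum_leP _ a0)/le_lt_trans]|aoo]; first by apply; rewrite ltry.
exists (fine (\esum_(n in [set: int]) (a n)%:E)); apply/(sum_leP _ a0).
by rewrite fineK// ge0_fin_numE// esum_ge0// => n _; rewrite lee_fin.
Qed.

(** A finite sum within [e] of the supremum of all finite sums leaves at most [e] to any family
    disjoint from it. *)
Lemma sum_le_tail a B (e : R) : (forall n, 0 <= a n) -> sum_le a B -> 0 < e ->
  exists2 X0 : seq int, uniq X0 & forall X, uniq X ->
    (forall n, n \in X -> n \notin X0) -> \sum_(n <- X) a n <= e.
Proof.
move=> a0 aB e0; set S := [set s | exists2 X, uniq X & s = \sum_(n <- X) a n].
have supS : has_sup S.
  split; first by exists 0, [::]; rewrite // big_nil.
  by exists B => _ [X uX ->]; exact: aB.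
have [_ [X0 uX0 ->] X0S] := sup_adherent e0 supS.
exists X0 => // X uX XX0.
have : \sum_(n <- X0 ++ X) a n <= sup S.
  apply: sup_upper_bound => //; exists (X0 ++ X) => //.
  rewrite cat_uniq uX0 uX andbT; apply/hasPn => n /= nX; exact: XX0.
by rewrite big_cat /=; move: X0S; set x := \sum_(n <- X) _; set y := \sum_(n <- X0) _; lra.
Qed.

(** Young's inequality for the terms normalised by the roots of [A] and [B]. These are upper bounds
    rather than the sums themselves, so they can be positive even when a sum vanishes. *)
Lemma hoelder_sum (I : Type) (X : seq I) (F G : I -> R) (A B p q : R) :
  0 < p -> 0 < q -> p^-1 + q^-1 = 1 -> 0 < A -> 0 < B ->
  (forall i, 0 <= F i) -> (forall i, 0 <= G i) ->
  \sum_(i <- X) F i `^ p <= A -> \sum_(i <- X) G i `^ q <= B ->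
  \sum_(i <- X) F i * G i <= A `^ p^-1 * B `^ q^-1.
Proof.
move=> p0 q0 pq A0 B0 F0 G0 FA GB.
have A'0 : 0 < A `^ p^-1 by rewrite powR_gt0.
have B'0 : 0 < B `^ q^-1 by rewrite powR_gt0.
rewrite -[leRHS]mul1r -ler_pdivrMr ?mulr_gt0// mulr_suml.
apply: (@le_trans _ _ (\sum_(i <- X) (F i `^ p / A / p + G i `^ q / B / q))).
  apply: ler_sum => i _.
  have := conjugate_powR (divr_ge0 (F0 i) (ltW A'0)) (divr_ge0 (G0 i) (ltW B'0)) p0 q0 pq.
  rewrite !powRM ?invr_ge0 ?(ltW A'0) ?(ltW B'0)//.
  rewrite -!powRN -!powRrM !mulNr !mulVf ?gt_eqF// !powR_inv1 ?(ltW A0) ?(ltW B0)// => h.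
  by rewrite invfM mulrACA -!powRN mulrC in h *.
rewrite big_split /= -!mulr_suml -pq; apply: lerD.
  by rewrite ler_piMl ?invr_ge0 ?(ltW p0)// ler_pdivrMr// mul1r.
by rewrite ler_piMl ?invr_ge0 ?(ltW q0)// ler_pdivrMr// mul1r.
Qed.

(** [absz] is injective on the nonnegative and on the negative integers, whence the factor 2. *)
Lemma sum_absz_le (c : nat -> R) (B : R) : (forall i, 0 <= c i) ->
  (forall M, \sum_(i < M) c i <= B) -> sum_le (fun n => c `|n|%N) (2 * B).
Proof.
move=> c0 cB X uX.
have half (Y : seq int) : uniq Y -> {in Y &, injective absz} ->
    \sum_(n <- Y) c `|n|%N <= B.
  move=> uY injY; rewrite -(big_map absz predT c).
  have [M MY] : exists M, forall n, n \in map absz Y -> (n < M)%N.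
    exists (\max_(n <- map absz Y) n).+1 => n nY.
    by rewrite ltnS (big_rem n)//= leq_maxl.
  rewrite (le_trans _ (cB M))// -(big_mkord predT c) ler_sum_sub//.
  - by rewrite map_inj_in_uniq.
  - by rewrite iota_uniq.
  - by move=> n /MY nM; rewrite mem_index_iota.
rewrite (bigID (fun n : int => 0 <= n)) /= (_ : 2 * B = B + B); last by ring.
apply: lerD; rewrite -big_filter.
  apply: half; first by rewrite filter_uniq.
  move=> m n; rewrite !mem_filter => /andP[m0 _] /andP[n0 _] mn.
  by rewrite -(gez0_abs m0) -(gez0_abs n0) mn.
apply: half; first by rewrite filter_uniq.
move=> m n; rewrite !mem_filter -!ltNge => /andP[m0 _] /andP[n0 _] mn.
by apply: oppr_inj; rewrite -(ltz0_abs m0) -(ltz0_abs n0) mn.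
Qed.

Lemma normz_absz (n : int) : `|n|%:~R = (`|n|%N)%:R :> R.
Proof. by rewrite pmulrn abszE. Qed.

End Sums.

(** * Power sums compared with telescoping sums *)

Section PowerSums.
Variable R : realType.
Implicit Types (x y s : R).

(* Both tangent inequalities follow from [1 + t <= expR t]. *)
Lemma powR_tangent_ge s x y : s < 0 -> 0 < x -> 0 < y ->
  y `^ s + s * y `^ (s - 1) * (x - y) <= x `^ s.
Proof.
move=> s0 x0 y0.
have r0 : 0 < x / y by rewrite divr_gt0.
have h : 1 + s * (x / y - 1) <= (x / y) `^ s.
  rewrite /powR gt_eqF// (le_trans _ (expR_ge1Dx _))// lerD2l ler_wnM2l ?(ltW s0)//.
  have := @le_ln1Dx R (x / y - 1); rewrite addrCA subrr addr0; apply.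
  by rewrite ltrBrDr addrC subrr.
have -> : x `^ s = (x / y) `^ s * y `^ s.
  by rewrite -powRM ?(ltW r0) ?(ltW y0)// divfK// gt_eqF.
have ys : y `^ s = y `^ (s - 1) * y.
  by rewrite mulrC -[X in X * _](powRr1 (ltW y0)) -powRD ?(gt_eqF y0) ?implybT// addrC subrK.
rewrite [X in X + _]ys (le_trans _ (ler_wpM2r (powR_ge0 _ _) h))// ys le_eqVlt.
by apply/orP; left; apply/eqP; field; rewrite gt_eqF.
Qed.

Lemma powR_tangent_le s x y : 0 < s <= 1 -> 0 <= x -> 0 < y ->
  x `^ s <= y `^ s + s * y `^ (s - 1) * (x - y).
Proof.
move=> /andP[s0 s1]; rewrite le_eqVlt => /predU1P[<-|x0] y0.
  have ys : y `^ s = y `^ (s - 1) * y.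
    by rewrite mulrC -[X in X * _](powRr1 (ltW y0)) -powRD ?(gt_eqF y0) ?implybT// addrC subrK.
  rewrite powR0 ?gt_eqF// ys sub0r (_ : _ + _ = (1 - s) * (y `^ (s - 1) * y)); last by ring.
  by rewrite mulr_ge0 ?subr_ge0// mulr_ge0 ?powR_ge0 ?ltW.
have r0 : 0 < x / y by rewrite divr_gt0.
have h : (x / y) `^ s <= 1 + s * (x / y - 1).
  rewrite /powR gt_eqF//; set L := ln _.
  have rE : x / y = expR L by rewrite lnK.
  have e1 : 1 + (1 - s) * L <= expR ((1 - s) * L) by exact: expR_ge1Dx.
  have e2 : 1 - s * L <= expR (- (s * L)).
    by have := expR_ge1Dx (- (s * L)).
  have : 1 <= s * expR ((1 - s) * L) + (1 - s) * expR (- (s * L)).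
    have : s * (1 + (1 - s) * L) + (1 - s) * (1 - s * L) <=
        s * expR ((1 - s) * L) + (1 - s) * expR (- (s * L)).
      by rewrite lerD// ler_wpM2l// ?subr_ge0// ltW.
    by rewrite (_ : s * _ + (1 - s) * (1 - s * L) = 1)//; ring.
  rewrite -(ler_pM2l (expR_gt0 (s * L))) mulr1 mulrDr !mulrA.
  rewrite ![expR _ * _]mulrC -!mulrA -!expRD subrr expR0 mulr1.
  rewrite (_ : s * L + (1 - s) * L = L); last by ring.
  by rewrite -rE; lra.
have -> : x `^ s = (x / y) `^ s * y `^ s.
  by rewrite -powRM ?(ltW r0) ?(ltW y0)// divfK// gt_eqF.
have ys : y `^ s = y `^ (s - 1) * y.
  by rewrite mulrC -[X in X * _](powRr1 (ltW y0)) -powRD ?(gt_eqF y0) ?implybT// addrC subrK.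
rewrite [X in _ <= X + _]ys (le_trans (ler_wpM2r (powR_ge0 _ _) h))// ys le_eqVlt.
by apply/orP; left; apply/eqP; field; rewrite gt_eqF.
Qed.

(** By the tangent inequality, each term after the first is at most the last decrease of
    [(1 + i d)^(1 - kap)] divided by [d (kap - 1)]: a telescoping form of the comparison with an
    integral. *)
Lemma sum_powR_le (kap d : R) (M : nat) : 1 < kap -> 0 < d ->
  \sum_(i < M) (1 + i%:R * d) `^ (- kap) <= 1 + (d * (kap - 1))^-1.
Proof.
move=> k1 d0.
have dk0 : 0 < d * (kap - 1) by rewrite mulr_gt0// subr_gt0.
suff h N : \sum_(i < N.+1) (1 + i%:R * d) `^ (- kap) <=
    1 + (d * (kap - 1))^-1 * (1 - (1 + N%:R * d) `^ (1 - kap)).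
  case: M => [|M]; first by rewrite big_ord0 addr_ge0// invr_ge0 ltW.
  rewrite (le_trans (h M))// lerD2l ler_piMr ?invr_ge0 ?(ltW dk0)//.
  by rewrite gerBl powR_ge0.
elim: N => [|N ih].
  by rewrite big_ord1 !mul0r addr0 !powR1 subrr mulr0 addr0.
rewrite big_ord_recr /= (le_trans (lerD ih (lexx _)))// -addrA lerD2l.
have t : (1 + N.+1%:R * d) `^ (1 - kap) +
    (1 - kap) * (1 + N.+1%:R * d) `^ (1 - kap - 1) * ((1 + N%:R * d) - (1 + N.+1%:R * d))
    <= (1 + N%:R * d) `^ (1 - kap).
  apply: powR_tangent_ge; first by rewrite subr_lt0.
    by rewrite ltr_pwDl// mulr_ge0// ltW.
  by rewrite ltr_pwDl// mulr_ge0// ltW.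
rewrite (_ : 1 - kap - 1 = - kap) in t; last by ring.
rewrite -(ler_pM2l dk0) mulrDr !mulrA divff ?gt_eqF// !mul1r.
by move: t; rewrite -natr1; lra.
Qed.

(** This is the change of variable [psi = i l / (1 + i l)], whose derivative in [i] is
    [l / (1 + i l)^2]. Each term after the first is at most [l^(s - 1) / (1 - s)] times an increment
    of [psi^(1 - s)], and [psi] never exceeds 1. *)
Lemma sum_powR_sqr_le (s l : R) (M : nat) : 0 <= s < 1 -> 0 < l ->
  \sum_(i < M) (1 + i%:R) `^ (- s) / (1 + i%:R * l) ^+ 2 <= 1 + l `^ (s - 1) / (1 - s).
Proof.
move=> /andP[s0 s1] l0.
have s1' : 0 < 1 - s by rewrite subr_gt0.
pose psi (i : nat) : R := i%:R * l / (1 + i%:R * l).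
have den0 i : 0 < 1 + i%:R * l by rewrite ltr_pwDl// mulr_ge0// ltW.
have psi0 i : 0 <= psi i by rewrite divr_ge0 ?(ltW (den0 i))// mulr_ge0// ltW.
have psi1 i : psi i <= 1 by rewrite ler_pdivrMr// mul1r lerDr.
have C0 : 0 <= l `^ (s - 1) / (1 - s) by rewrite divr_ge0 ?powR_ge0// ltW.
suff h N : \sum_(i < N.+1) (1 + i%:R) `^ (- s) / (1 + i%:R * l) ^+ 2 <=
    1 + l `^ (s - 1) / (1 - s) * psi N `^ (1 - s).
  case: M => [|M]; first by rewrite big_ord0 addr_ge0.
  rewrite (le_trans (h M))// lerD2l ler_piMr//.
  by apply: (le_trans (ge0_ler_powR (ltW s1') _ _ (psi1 M))); rewrite ?nnegrE ?psi0 ?powR1.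
elim: N => [|N ih].
  by rewrite big_ord1 mul0r !addr0 powR1 expr1n divr1 lerDl mulr_ge0// powR_ge0.
rewrite big_ord_recr /= (le_trans (lerD ih (lexx _)))// -addrA lerD2l.
have y0 : 0 < psi N.+1 by rewrite divr_gt0// mulr_gt0.
have /(_ (psi N) (psi N.+1)) := @powR_tangent_le (1 - s).
rewrite s1' gerBl s0 psi0 y0 => /(_ isT isT isT).
rewrite (_ : 1 - s - 1 = - s); last by ring.
move=> t.
have dpsi : l / (1 + N.+1%:R * l) ^+ 2 <= psi N.+1 - psi N.
  rewrite (_ : psi N.+1 - psi N = l / ((1 + N.+1%:R * l) * (1 + N%:R * l))).
    rewrite ler_wpM2l ?(ltW l0)// lef_pV2 ?posrE ?exprn_gt0 ?mulr_gt0//.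
    by rewrite expr2 ler_wpM2l ?(ltW (den0 _))// lerD2l ler_wpM2r ?(ltW l0)// ler_nat.
  by rewrite /psi -natr1; field; rewrite natr1 !gt_eqF.
have ypow : (N.+1%:R * l) `^ (- s) <= psi N.+1 `^ (- s).
  have Nl0 : 0 < N.+1%:R * l by rewrite mulr_gt0.
  rewrite !powRN lef_pV2 ?posrE ?powR_gt0//.
  rewrite ge0_ler_powR ?nnegrE ?psi0 ?mulr_ge0 ?(ltW l0)// /psi.
  by rewrite ler_pdivrMr// ler_peMr ?mulr_ge0 ?(ltW l0)// lerDl mulr_ge0// ltW.
have key : (1 - s) * l `^ (1 - s) * ((1 + N.+1%:R) `^ (- s) / (1 + N.+1%:R * l) ^+ 2)
    <= psi N.+1 `^ (1 - s) - psi N `^ (1 - s).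
  apply: (@le_trans _ _ ((1 - s) * psi N.+1 `^ (- s) * (psi N.+1 - psi N))); last first.
    by move: t; lra.
  rewrite -!mulrA ler_wpM2l ?(ltW s1')//.
  apply: (@le_trans _ _ ((N.+1%:R * l) `^ (- s) * (l / (1 + N.+1%:R * l) ^+ 2))).
    have -> : l `^ (1 - s) = l * l `^ (- s).
      by rewrite powRD ?(gt_eqF l0) ?implybT// powRr1 ?(ltW l0).
    rewrite powRM ?(ltW l0)//.
    set D := (_ ^+ 2)^-1.
    have D0 : 0 <= D by rewrite invr_ge0 exprn_ge0// ltW.
    rewrite [leLHS](_ : _ = l * l `^ (- s) * D * (1 + N.+1%:R) `^ (- s)); last by ring.
    rewrite [leRHS](_ : _ = l * l `^ (- s) * D * N.+1%:R `^ (- s)); last by ring.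
    rewrite ler_wpM2l ?mulr_ge0 ?powR_ge0 ?(ltW l0)//.
    rewrite !powRN lef_pV2 ?posrE ?powR_gt0// ge0_ler_powR ?nnegrE//.
    by rewrite lerDr.
  apply: ler_pM => //; first exact: powR_ge0.
  by rewrite mulr_ge0 ?invr_ge0 ?exprn_ge0 ?(ltW l0) ?(ltW (den0 _)).
have lE : l `^ (s - 1) = (l `^ (1 - s))^-1 by rewrite -powRN opprB.
have lp0 : 0 < l `^ (1 - s) by rewrite powR_gt0.
move: key; rewrite -ler_pdivlMl ?mulr_gt0// => key.
rewrite lE (le_trans (lerD (lexx _) key))// le_eqVlt; apply/orP; left; apply/eqP.
by field; rewrite !gt_eqF.
Qed.

End PowerSums.

(** * Weighted sequence spaces *)

Section WeightedLp.
Variable R : realType.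
Implicit Types (u v w x y : int -> R[i]) (p beta B e : R).

Definition weight beta (n : int) : R := (1 + `|n|%:~R) `^ beta.

Definition lp_le p beta u B :=
  sum_le (fun n => normc (u n) `^ p * weight (p * beta) n) B.

Definition l1_le beta u B := sum_le (fun n => normc (u n) * weight beta n) B.

Lemma base_ge1 (n : int) : 1 <= 1 + `|n|%:~R :> R.
Proof. by rewrite lerDl ler0z. Qed.

Lemma base_gt0 (n : int) : 0 < 1 + `|n|%:~R :> R.
Proof. by rewrite (lt_le_trans _ (base_ge1 n)). Qed.

Lemma weight_gt0 beta n : 0 < weight beta n.
Proof. by rewrite powR_gt0// base_gt0. Qed.

Lemma weight_ge0 beta n : 0 <= weight beta n.
Proof. by rewrite ltW// weight_gt0. Qed.

Lemma weight_ge1 beta n : 0 <= beta -> 1 <= weight beta n.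
Proof. by move=> b0; rewrite -(powRr0 (1 + `|n|%:~R)) ler_powR// base_ge1. Qed.

Lemma weight0 beta : weight beta 0 = 1.
Proof. by rewrite /weight normr0 addr0 powR1. Qed.

Lemma weightN beta n : weight beta (- n) = weight beta n.
Proof. by rewrite /weight normrN. Qed.

Lemma weightM p beta n : weight (p * beta) n = weight beta n `^ p.
Proof. by rewrite /weight mulrC powRrM. Qed.

Lemma weightD beta m n : 0 <= beta ->
  weight beta (m + n) <= weight beta m * weight beta n.
Proof.
move=> b0; rewrite /weight -powRM ?(ltW (base_gt0 _))//.
apply: ge0_ler_powR => //; rewrite ?nnegrE ?mulr_ge0 ?(ltW (base_gt0 _))//.
have : (`|m + n|%:~R : R) <= `|m|%:~R + `|n|%:~R by rewrite -intrD ler_int ler_normD.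
have : 0 <= `|m|%:~R * `|n|%:~R :> R by rewrite mulr_ge0 ?ler0z.
lra.
Qed.

Lemma lp_term_ge0 p beta u n : 0 <= normc (u n) `^ p * weight (p * beta) n.
Proof. by rewrite mulr_ge0 ?powR_ge0. Qed.

Lemma lp_termE p beta u n :
  normc (u n) `^ p * weight (p * beta) n = (normc (u n) * weight beta n) `^ p.
Proof. by rewrite powRM ?normc_ge0 ?weight_ge0// weightM. Qed.

Lemma lpwP p beta u : lpw p beta u <-> exists B, lp_le p beta u B.
Proof. by symmetry; apply: (esum_ltyP (lp_term_ge0 p beta u)). Qed.

Lemma lpw1P beta u : lpw 1 beta u <-> exists B, l1_le beta u B.
Proof.
rewrite lpwP; split => -[B uB]; exists B; apply: le_sum_le uB => n.
  by rewrite mul1r powRr1 ?normc_ge0.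
by rewrite mul1r powRr1 ?normc_ge0.
Qed.

(** Halving [e^p] turns the large inequalities of [sum_le] into a strict one. *)
Lemma lpw_norm_lt p beta u e : 0 < p -> 0 < e ->
  lp_le p beta u (e `^ p / 2) -> (lpw_norm p beta u < e%:E)%E.
Proof.
move=> p0 e0 /(sum_leP _ (lp_term_ge0 p beta u)); rewrite -/(lpw_sum p beta u) => h.
have ep : 0 < e `^ p by rewrite powR_gt0.
rewrite /lpw_norm.
have s0 : (0 <= lpw_sum p beta u)%E.
  by apply: esum_ge0 => n _; rewrite lee_fin lp_term_ge0.
have : lpw_sum p beta u = (fine (lpw_sum p beta u))%:E.
  by rewrite fineK// ge0_fin_numE// (le_lt_trans h)// ltry.
move: h s0; set s := lpw_sum _ _ _ => h s0 sE; rewrite sE in h s0 *.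
rewrite !lee_fin in h s0; rewrite poweR_EFin lte_fin.
rewrite -[ltRHS]powRr1 ?(ltW e0)// -(divff (lt0r_neq0 p0)) powRrM.
rewrite gt0_ltr_powR ?invr_gt0 ?nnegrE ?powR_ge0//.
by rewrite (le_lt_trans h)// ltr_pdivrMr// ltr_pMr// ltr1n.
Qed.

Lemma lpw_norm_lp_le p beta u e : 0 < p -> 0 <= e ->
  (lpw_norm p beta u < e%:E)%E -> lp_le p beta u (e `^ p).
Proof.
move=> p0 e0 h; apply/(sum_leP _ (lp_term_ge0 p beta u)).
rewrite -/(lpw_sum p beta u).
have s0 : (0 <= lpw_sum p beta u)%E.
  by apply: esum_ge0 => n _; rewrite lee_fin lp_term_ge0.
move: h s0; rewrite /lpw_norm; set s := lpw_sum _ _ _.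
case: s => [s|//|//]; last by rewrite poweRyr// invr_eq0 gt_eqF.
rewrite poweR_EFin lte_fin !lee_fin => h s0.
rewrite -[leLHS]powRr1// -(mulVf (lt0r_neq0 p0)) powRrM.
by rewrite ge0_ler_powR ?nnegrE ?powR_ge0// ltW.
Qed.

(** The crude bound [|x + y| <= 2 max(|x|, |y|)] takes the place of Minkowski's inequality; the
    constant [2^p] is harmless for density. *)
Lemma lp_leD p beta x y A B : 0 <= p -> lp_le p beta x A -> lp_le p beta y B ->
  lp_le p beta (fun n => x n + y n) (2 `^ p * (A + B)).
Proof.
move=> p0 xA yB; apply: (le_sum_le _ (sum_leZ (powR_ge0 2 p) (sum_leD xA yB))) => n /=.
rewrite -mulrDl mulrA ler_wpM2r ?weight_ge0//.
have [xy|yx] := leP (normc (x n)) (normc (y n)).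
  apply: (@le_trans _ _ ((2 * normc (y n)) `^ p)).
    rewrite ge0_ler_powR ?nnegrE ?mulr_ge0 ?normc_ge0//.
    by rewrite (le_trans (le_normcD _ _))// mulr_natl mulr2n lerD2r.
  by rewrite powRM ?normc_ge0// ler_wpM2l ?powR_ge0// lerDr powR_ge0.
apply: (@le_trans _ _ ((2 * normc (x n)) `^ p)).
  rewrite ge0_ler_powR ?nnegrE ?mulr_ge0 ?normc_ge0//.
  by rewrite (le_trans (le_normcD _ _))// mulr_natl mulr2n lerD2l ltW.
by rewrite powRM ?normc_ge0// ler_wpM2l ?powR_ge0// lerDl powR_ge0.
Qed.

Lemma lp_leZ p beta x (c : R[i]) B : lp_le p beta x B ->
  lp_le p beta (fun n => c * x n) (normc c `^ p * B).
Proof.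
move=> xB; apply: (le_sum_le _ (sum_leZ (powR_ge0 (normc c) p) xB)) => n /=.
by rewrite normcM powRM ?normc_ge0// mulrA.
Qed.

Lemma lp_le_translate p beta k x B : 0 <= p -> 0 <= beta -> lp_le p beta x B ->
  lp_le p beta (translate k x) (weight (p * beta) k * B).
Proof.
move=> p0 b0 xB.
apply: (le_sum_le _ (sum_leZ (weight_ge0 (p * beta) k) (sum_le_shift k xB))) => n /=.
rewrite mulrCA ler_wpM2l ?powR_ge0//.
have := @weightD (p * beta) (n + k) (- k) (mulr_ge0 p0 b0).
by rewrite addrK weightN [leRHS]mulrC.
Qed.

(** Each weighted term is at most the total bound [B], so its p-th power is at most [B^(p - 1)]
    times the term. *)
Lemma l1_lp p beta x B : 1 <= p -> l1_le beta x B -> lp_le p beta x (B `^ p).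
Proof.
move=> p1 xB; have B0 := sum_le_ge0 xB.
have -> : B `^ p = B `^ (p - 1) * B.
  by rewrite mulrC mulr_powRB1// (lt_le_trans _ p1).
apply: (le_sum_le _ (sum_leZ (powR_ge0 B (p - 1)) xB)) => n /=.
have x0 : 0 <= normc (x n) * weight beta n by rewrite mulr_ge0 ?normc_ge0 ?weight_ge0.
rewrite lp_termE -mulr_powRB1 ?(lt_le_trans _ p1)//.
rewrite mulrC ler_wpM2r// ge0_ler_powR ?nnegrE ?subr_ge0//; exact: (sum_le1 n xB).
Qed.

End WeightedLp.

(** * The closed span of the translates *)

Section TranslateClosure.
Variables (R : realType) (p beta : R) (u : int -> R[i]).
Hypotheses (p_ge1 : 1 <= p) (beta_ge0 : 0 <= beta).
Implicit Types (v w x y : int -> R[i]).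

Let p_gt0 : 0 < p. Proof. exact: lt_le_trans p_ge1. Qed.

Definition translate_closure v := forall e : R, 0 < e ->
  exists2 w, translate_span u w & lp_le p beta (fun n => v n - w n) e.

Lemma translate_span_closure w : translate_span u w -> translate_closure w.
Proof.
move=> uw e e0; exists w => // X _.
by rewrite big1 ?ltW// => n _; rewrite subrr normc0 powR0 ?gt_eqF ?mul0r.
Qed.

Lemma translate_closureD v w : translate_closure v -> translate_closure w ->
  translate_closure (fun n => v n + w n).
Proof.
move=> cv cw e e0; set d := e / (2 `^ p * 2).
have d0 : 0 < d by rewrite divr_gt0// mulr_gt0// powR_gt0.
have [v' [s v'E] vv'] := cv d d0; have [w' [s' w'E] ww'] := cw d d0.
exists (fun n => v' n + w' n).
  by exists (s ++ s'); apply/funext => n; rewrite big_cat v'E w'E.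
have -> : e = 2 `^ p * (d + d) by rewrite /d; field; rewrite gt_eqF// powR_gt0.
apply: (le_sum_le _ (lp_leD (ltW p_gt0) vv' ww')) => n /=.
by rewrite opprD addrACA.
Qed.

Lemma translate_closureZ c v : translate_closure v ->
  translate_closure (fun n => c * v n).
Proof.
move=> cv e e0; have [->|c0] := eqVneq c 0.
  exists (fun=> 0); first by exists [::]; apply/funext => n; rewrite big_nil.
  move=> X _; rewrite big1 ?ltW// => n _.
  by rewrite mul0r subrr normc0 powR0 ?gt_eqF// mul0r.
have c0' : 0 < normc c `^ p by rewrite powR_gt0// normc_gt0.
have [w [s wE] vw] := cv (e / normc c `^ p) (divr_gt0 e0 c0').
exists (fun n => c * w n).
  exists [seq (c * k.1, k.2) | k <- s]; apply/funext => n.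
  by rewrite wE big_map mulr_sumr; apply: eq_bigr => k _; rewrite mulrA.
rewrite -(divfK (lt0r_neq0 c0') e) mulrC.
apply: (le_sum_le _ (lp_leZ c vw)) => n /=.
by rewrite mulrBr.
Qed.

Lemma translate_closure_translate k v : translate_closure v ->
  translate_closure (translate k v).
Proof.
move=> cv e e0; have k0 := weight_gt0 (p * beta) k.
have [w [s wE] vw] := cv (e / weight (p * beta) k) (divr_gt0 e0 k0).
exists (translate k w).
  exists [seq (c.1, k + c.2) | c <- s]; apply/funext => n.
  rewrite /translate wE big_map; apply: eq_bigr => c _ /=.
  by rewrite /translate addrA.
rewrite -(divfK (lt0r_neq0 k0) e) mulrC.
exact: (lp_le_translate k (ltW p_gt0) beta_ge0 vw).
Qed.

Lemma translate_closure_lim v :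
  (forall e : R, 0 < e -> exists2 w, translate_closure w &
     lp_le p beta (fun n => v n - w n) e) -> translate_closure v.
Proof.
move=> cv e e0; set d := e / (2 `^ p * 2).
have d0 : 0 < d by rewrite divr_gt0// mulr_gt0// powR_gt0.
have [w cw vw] := cv d d0; have [w' uw' ww'] := cw d d0.
exists w' => //.
have -> : e = 2 `^ p * (d + d) by rewrite /d; field; rewrite gt_eqF// powR_gt0.
apply: (le_sum_le _ (lp_leD (ltW p_gt0) vw ww')) => n /=.
by rewrite addrA subrK.
Qed.

Lemma translate_closure_sum (I : Type) (s : seq I) (F : I -> int -> R[i]) :
  (forall i, translate_closure (F i)) ->
  translate_closure (fun n => \sum_(i <- s) F i n).
Proof.
move=> cF; elim: s => [|i s ih].
  apply: translate_span_closure; exists [::]; apply/funext => n.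
  by rewrite !big_nil.
suff -> : (fun n => \sum_(j <- i :: s) F j n) = (fun n => F i n + \sum_(j <- s) F j n).
  exact: translate_closureD.
by apply/funext => n; rewrite big_cons.
Qed.

Definition delta0 : int -> R[i] := fun n => (n == 0)%:R.

(** Truncations of [v] to finite sets approximate it, and they are finite combinations of the unit
    sequences [translate (- k) delta0], supported at [k]. *)
Lemma cyclic_of_delta0 : lpw p beta u -> translate_closure delta0 -> cyclic p beta u.
Proof.
move=> lu c0; split => // v /lpwP[B vB] e e0.
suff cv : translate_closure v.
  have [w uw vw] := cv _ (divr_gt0 (powR_gt0 p e0) (ltr0Sn R 1)).
  by exists w => //; exact: lpw_norm_lt.
apply: translate_closure_lim => d d0.
have [X0 uX0 X0P] := sum_le_tail (lp_term_ge0 p beta v) vB d0.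
exists (fun n => \sum_(k <- X0) v k * translate (- k) delta0 n).
  by apply: translate_closure_sum => k; exact/translate_closureZ/translate_closure_translate.
have trunc n : \sum_(k <- X0) v k * translate (- k) delta0 n =
    if n \in X0 then v n else 0.
  have dE k : translate (- k) delta0 n = (k == n)%:R.
    by rewrite /translate /delta0 subr_eq0 eq_sym.
  case: ifPn => [nX|nX].
    rewrite (bigD1_seq n)//= dE eqxx mulr1 big1 ?addr0// => k kn.
    by rewrite dE (negbTE kn) mulr0.
  rewrite big_seq big1// => k kX; rewrite dE (_ : k == n = false) ?mulr0//.
  by apply/negbTE; apply: contraNneq nX => <-.
move=> X uX; rewrite (bigID (mem X0)) /= [X in X + _]big1 ?add0r.
  rewrite -big_filter.
  rewrite (@le_trans _ _ (\sum_(n <- [seq n <- X | n \notin X0])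
     normc (v n) `^ p * weight (p * beta) n))//.
    rewrite big_seq [leRHS]big_seq ler_sum// => n.
    by rewrite mem_filter trunc => /andP[/negbTE -> _]; rewrite subr0.
  apply: X0P; first by rewrite filter_uniq.
  by move=> n; rewrite mem_filter => /andP[].
by move=> n nX0; rewrite trunc nX0 subrr normc0 powR0 ?gt_eqF// mul0r.
Qed.

End TranslateClosure.

(** * Limits along an ultrafilter *)

Lemma ultra_eventually : exists U : set_system nat, UltraFilter U /\ \oo `<=` U.
Proof. exact: ultraFilterLemma. Qed.

(** Fixing one ultrafilter makes the limits of all bounded sequences exist at once and respect sums
    and products. *)
Definition ultra : set_system nat := projT1 (cid ultra_eventually).

Global Instance ultra_ultra : UltraFilter ultra.
Proof. exact: (projT2 (cid ultra_eventually)).1. Qed.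

Global Instance ultra_proper : ProperFilter ultra.
Proof. exact: ultra_proper. Qed.

Lemma ultra_near (P : set nat) : (\forall M \near \oo, P M) -> ultra P.
Proof. exact: (projT2 (cid ultra_eventually)).2. Qed.

Section UltraLimit.
Variable R : realType.
Implicit Types a : nat -> R.

Definition ulim a : R := lim (a @ ultra).

(** The image filter clusters somewhere in the compact segment, and a cluster point of an
    ultrafilter is a limit. *)
Lemma ulim_cvg a (B : R) : (forall M, `|a M| <= B) -> a @ ultra --> ulim a.
Proof.
move=> aB; apply/cvg_ex.
have [|p [_ pP]] := @segment_compact R (- B) B (a @ ultra) _.
  by apply: (@filterE _ ultra) => M; rewrite /= in_itv /= -ler_norml.
exists p => A Ap; have [//|nA] := in_ultra_setVsetC (a @^-1` A) ultra_ultra.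
by have [x [nAx Ax]] := pP (~` A) A nA Ap.
Qed.

End UltraLimit.

(** * Averages over finite grids *)

Section GridAverages.
Variables (R : realType) (t0 : R).
Implicit Types (F G : R -> R[i]) (M : nat) (n : int) (X : seq int).

Definition step M : R := 2 * pi / M%:R.

(** The origin [t0] is a parameter because it will be a zero of the Fourier series, when there is
    one: the circle is cut there without cutting a complementary interval. *)
Definition grid M (x : nat) : R := t0 + x%:R * step M.

Definition avg M F : R[i] := M%:R^-1 * \sum_(x < M) F (grid M x).

Definition avgR M (g : R -> R) : R := M%:R^-1 * \sum_(x < M) g (grid M x).

Definition expn n (t : R) : R[i] := expi (n%:~R * t).

Lemma expnD m n t : expn (m + n) t = expn m t * expn n t.
Proof. by rewrite /expn intrD mulrDl expiD. Qed.

Lemma expn0 t : expn 0 t = 1.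
Proof. by rewrite /expn mul0r expi0. Qed.

Lemma expnN n t : expn (- n) t = ((expn n t)^*)%C.
Proof. by rewrite /expn mulrNz mulNr expiN. Qed.

Lemma normc_expn n t : normc (expn n t) = 1.
Proof. exact: normc_expi. Qed.

Lemma avgD M F G : avg M (fun t => F t + G t) = avg M F + avg M G.
Proof. by rewrite /avg big_split mulrDr. Qed.

Lemma avgZ M (c : R[i]) F : avg M (fun t => c * F t) = c * avg M F.
Proof. by rewrite /avg -mulr_sumr mulrCA. Qed.

Lemma avg_sum M (I : Type) (s : seq I) (F : I -> R -> R[i]) :
  avg M (fun t => \sum_(i <- s) F i t) = \sum_(i <- s) avg M (F i).
Proof. by rewrite /avg exchange_big /= mulr_sumr. Qed.

Lemma avg_conj M F : avg M (fun t => ((F t)^*)%C) = ((avg M F)^*)%C.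
Proof. by rewrite /avg rmorphM fmorphV rmorph_nat rmorph_sum. Qed.

Lemma avgR_avg M (g : R -> R) : (avgR M g)%:C%C = avg M (fun t => (g t)%:C%C).
Proof. by rewrite /avg /avgR rmorphM fmorphV rmorph_nat rmorph_sum. Qed.

Lemma normc_avg M F (B : R) : 0 <= B -> (forall t, normc (F t) <= B) ->
  normc (avg M F) <= B.
Proof.
move=> B0 FB; rewrite normcM normcV normc_nat.
have [->|M0] := posnP M; first by rewrite invr0 mul0r.
rewrite ler_pdivrMl ?ltr0n// (le_trans (normc_sum _ _ _))//.
rewrite (le_trans (ler_sum _ (fun i _ => FB _)))//.
by rewrite sumr_const card_ord mulr_natl.
Qed.

Lemma le_avgR M (g h : R -> R) : (forall t, g t <= h t) -> avgR M g <= avgR M h.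
Proof. by move=> gh; rewrite ler_wpM2l ?invr_ge0// ler_sum. Qed.

(** A geometric sum whose ratio is an M-th root of unity. For [0 < |n| < M] the ratio is not 1,
    because [|n| pi / M] lies in []0, pi[], where the sine is positive. *)
Lemma avg_expn M n : (0 < M)%N -> (`|n| < M)%N -> avg M (expn n) = (n == 0)%:R.
Proof.
move=> M0 nM; have MR : 0 < M%:R :> R by rewrite ltr0n.
have [->|n0] := eqVneq n 0.
  rewrite /avg (eq_bigr (fun=> 1)); last by move=> i _; rewrite expn0.
  by rewrite sumr_const card_ord mulVf// pnatr_eq0 -lt0n.
set z := expi (n%:~R * step M).
have zM : z ^+ M = 1.
  rewrite -expiMn mulrCA /step [M%:R * _]mulrC divfK ?gt_eqF//.
  by rewrite -[n%:~R * _]add0r expi_2pi expi0.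
have z1 : z != 1.
  suff s0 : sin (n%:~R * step M / 2) != 0.
    apply: contra_neq s0 => z1; have := expi_sub1_sqr (n%:~R * step M).
    rewrite -/z z1 subrr normc0 expr0n /= => /esym/eqP.
    by rewrite mulf_eq0 pnatr_eq0 /= expf_eq0 /= => /eqP.
  rewrite -normr_eq0.
  have -> : n%:~R * step M / 2 = n%:~R * pi / M%:R by rewrite /step; field; rewrite gt_eqF.
  have -> : `|sin (n%:~R * pi / M%:R)| = `|sin (`|n|%:~R * pi / M%:R)| :> R.
    case: (ger0P n) => // nlt; by rewrite mulrNz !mulNr sinN normrN.
  rewrite normr_eq0 gt_eqF// sin_gt0_pi// divr_gt0// ?mulr_gt0 ?pi_gt0 ?ltr0z ?normr_gt0//=.
  by rewrite ltr_pdivrMr// mulrC ltr_pM2l ?pi_gt0// normz_absz ltr_nat.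
rewrite /avg (eq_bigr (fun x : 'I_M => expn n t0 * z ^+ x)); last first.
  move=> x _; rewrite /expn /grid mulrDr expiD; congr (_ * _).
  by rewrite mulrCA expiMn.
rewrite -mulr_sumr (_ : \sum_(x < M) _ = 0) ?mulr0//.
by apply: (mulfI (_ : z - 1 != 0)); rewrite ?subr_eq0// -subrX1 zM subrr mulr0.
Qed.

(** The difference of the two sides is the average of [|F - S|^2], where [S] is the projection of
    [F] on the exponentials indexed by [X]; frequencies differing by less than [M] are orthogonal on
    the grid. *)
Lemma avg_bessel M F X : (0 < M)%N -> uniq X ->
  {in X &, forall m n, (`|m - n| < M)%N} ->
  \sum_(n <- X) normc (avg M (fun t => F t * expn (- n) t)) ^+ 2 <=
  avgR M (fun t => normc (F t) ^+ 2).
Proof.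
move=> M0 uX XM; set c := fun n => avg M (fun t => F t * expn (- n) t).
rewrite -/(c _); set T := \sum_(n <- X) _.
pose S t := \sum_(n <- X) c n * expn n t.
have TE : T%:C%C = \sum_(n <- X) c n * ((c n)^*)%C.
  by rewrite rmorph_sum /=; apply: eq_bigr => n _; rewrite normc_sqrC.
have FS : avg M (fun t => F t * ((S t)^*)%C) = T%:C%C.
  rewrite (_ : (fun t => _) = fun t => \sum_(n <- X) ((c n)^*)%C * (F t * expn (- n) t)).
    by rewrite avg_sum TE; apply: eq_bigr => n _; rewrite avgZ mulrC.
  apply/funext => t; rewrite rmorph_sum mulr_sumr; apply: eq_bigr => n _.
  by rewrite rmorphM mulrCA expnN.
have SF : avg M (fun t => S t * ((F t)^*)%C) = T%:C%C.
  rewrite (_ : (fun t => _) = fun t => ((F t * ((S t)^*)%C)^*)%C).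
    by rewrite avg_conj FS; apply/eqP; rewrite eq_complex /= oppr0 !eqxx.
  by apply/funext => t; rewrite rmorphM /= conjcK mulrC.
have SS : avg M (fun t => S t * ((S t)^*)%C) = T%:C%C.
  rewrite (_ : (fun t => _) = fun t => \sum_(m <- X) c m *
      (\sum_(n <- X) ((c n)^*)%C * expn (m - n) t)).
    rewrite avg_sum TE big_seq [RHS]big_seq; apply: eq_bigr => m mX.
    rewrite avgZ avg_sum (bigD1_seq m)//= avgZ subrr avg_expn// eqxx mulr1.
    rewrite big_seq_cond big1 ?addr0// => n /andP[nX nm].
    by rewrite avgZ avg_expn ?XM// subr_eq0 eq_sym (negbTE nm) mulr0.
  apply/funext => t; rewrite mulr_suml; apply: eq_bigr => m _.
  rewrite -mulrA; congr (_ * _); rewrite rmorph_sum mulr_sumr.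
  by apply: eq_bigr => n _; rewrite rmorphM mulrCA expnD expnN.
have : 0 <= avgR M (fun t => normc (F t - S t) ^+ 2).
  by rewrite mulr_ge0 ?invr_ge0// sumr_ge0// => x _; rewrite sqr_ge0.
suff -> : avgR M (fun t => normc (F t - S t) ^+ 2) =
    avgR M (fun t => normc (F t) ^+ 2) - T by rewrite subr_ge0.
apply: complexI; rewrite rmorphB /= !avgR_avg.
rewrite (_ : (fun t => _) = fun t => (F t * ((F t)^*)%C + (-1) * (F t * ((S t)^*)%C)) +
   ((-1) * (S t * ((F t)^*)%C) + S t * ((S t)^*)%C)).
  rewrite !avgD !avgZ FS SF SS !mulN1r addNr addr0; congr (avg _ _ - _).
  by apply/funext => t; rewrite normc_sqrC.
apply/funext => t; rewrite normc_sqrC rmorphB /=; ring.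
Qed.

Definition avg_diff M F : R -> R[i] := fun t => F (t + step M) - F t.

(** Summation by parts: the sum can be shifted by one grid point because [F] agrees at both ends of
    the grid. *)
Lemma avg_diff_coef M F n : (0 < M)%N -> F (t0 + 2 * pi) = F t0 ->
  avg M (fun t => avg_diff M F t * expn (- n) t) =
  (expn n (step M) - 1) * avg M (fun t => F t * expn (- n) t).
Proof.
move=> M0 Fper; rewrite /avg mulrCA; congr (_ * _).
pose G t := F t * expn (- n) t.
have M00 : M%:R != 0 :> R by rewrite pnatr_eq0 -lt0n.
have Gper : G (grid M M) = G (grid M 0).
  rewrite /G /grid /step mul0r addr0 [M%:R * _]mulrC divfK// Fper; congr (_ * _).
  by rewrite /expn mulrDr expi_2pi.
have shift : \sum_(x < M) G (grid M x.+1) = \sum_(x < M) G (grid M x).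
  apply: (addrI (G (grid M 0))); rewrite -(big_ord_recl M (fun x => G (grid M x))).
  by rewrite big_ord_recr /= Gper addrC.
rewrite mulrBl mul1r -{1}shift mulr_sumr -sumrB; apply: eq_bigr => x _.
have gS : grid M x.+1 = grid M x + step M by rewrite /grid -natr1 mulrDl mul1r addrA.
rewrite /avg_diff /G mulrBl -gS; congr (_ - _).
rewrite mulrCA; congr (_ * _); rewrite /expn -expiD; congr expi.
by rewrite gS mulrNz; ring.
Qed.

(** It stands in for the mean over the circle: linear and bounded by the sup norm on all bounded
    functions, and exact on exponentials. *)
Definition lam F : R[i] :=
  (ulim (fun M => Re (avg M F)) +i* ulim (fun M => Im (avg M F)))%C.

Definition bounded F := exists B, forall t, normc (F t) <= B.

Lemma bounded_ge0 F B : (forall t, normc (F t) <= B) -> 0 <= B.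
Proof. by move=> /(_ 0); apply: le_trans; rewrite normc_ge0. Qed.

Lemma cvg_Re_avg F : bounded F -> (fun M => Re (avg M F)) @ ultra --> Re (lam F).
Proof.
move=> [B FB]; apply: (@ulim_cvg _ _ B) => M.
by rewrite (le_trans (Re_le _))// normc_avg// (bounded_ge0 FB).
Qed.

Lemma cvg_Im_avg F : bounded F -> (fun M => Im (avg M F)) @ ultra --> Im (lam F).
Proof.
move=> [B FB]; apply: (@ulim_cvg _ _ B) => M.
by rewrite (le_trans (Im_le _))// normc_avg// (bounded_ge0 FB).
Qed.

Lemma cvg_normc_avg F : bounded F ->
  (fun M => normc (avg M F) ^+ 2) @ ultra --> normc (lam F) ^+ 2.
Proof.
move=> bF; rewrite normc_sqr; under eq_cvg do rewrite normc_sqr.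
have hR := cvg_Re_avg bF; have hI := cvg_Im_avg bF.
by apply: cvgD; rewrite expr2; under eq_cvg do rewrite expr2; apply: cvgM.
Qed.

End GridAverages.

Lemma cvg_sum_seq (R : realType) (T I : Type) (U : set_system T) {FU : Filter U} (s : seq I)
    (f : I -> T -> R) (l : I -> R) : (forall i, f i @ U --> l i) ->
  (fun M => \sum_(i <- s) f i M) @ U --> \sum_(i <- s) l i.
Proof.
move=> fl; elim: s => [|i s ih].
  by rewrite big_nil; under eq_cvg do rewrite big_nil; exact: cvg_cst.
by rewrite big_cons; under eq_cvg do rewrite big_cons; exact: cvgD.
Qed.

(** * Fourier coefficients of bounded functions, with mass and energy bounds *)

Section FourierCoefficients.
Variables (R : realType) (t0 : R).
Implicit Types (F G : R -> R[i]) (M : nat) (n : int) (X : seq int).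

Local Notation lam := (lam t0).
Local Notation avg := (avg t0).
Local Notation avgR := (avgR t0).

Lemma lam_unique F (z : R[i]) : bounded F ->
  (fun M => Re (avg M F)) @ ultra --> Re z ->
  (fun M => Im (avg M F)) @ ultra --> Im z -> lam F = z.
Proof.
move=> bF hR hI; apply/eqP; rewrite eq_complex; apply/andP; split; apply/eqP.
  exact: (cvg_unique _ (@cvg_Re_avg R t0 F bF) hR).
exact: (cvg_unique _ (@cvg_Im_avg R t0 F bF) hI).
Qed.

Lemma boundedD F G : bounded F -> bounded G -> bounded (fun t => F t + G t).
Proof.
move=> [B FB] [B' GB]; exists (B + B') => t.
by rewrite (le_trans (le_normcD _ _))// lerD.
Qed.

Lemma boundedM F G : bounded F -> bounded G -> bounded (fun t => F t * G t).
Proof.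
move=> [B FB] [B' GB]; exists (B * B') => t.
by rewrite normcM ler_pM ?normc_ge0.
Qed.

Lemma bounded_cst (c : R[i]) : bounded (fun _ : R => c).
Proof. by exists (normc c). Qed.

Lemma bounded_expn n : bounded (@expn R n).
Proof. by exists 1 => t; rewrite normc_expn. Qed.

Lemma bounded_sum (I : Type) (s : seq I) (F : I -> R -> R[i]) :
  (forall i, bounded (F i)) -> bounded (fun t => \sum_(i <- s) F i t).
Proof.
move=> bF; elim: s => [|i s ih].
  by exists 0 => t; rewrite big_nil normc0.
have [B hB] := boundedD (bF i) ih.
by exists B => t; rewrite big_cons.
Qed.

Lemma lamD F G : bounded F -> bounded G -> lam (fun t => F t + G t) = lam F + lam G.
Proof.
move=> bF bG; apply: lam_unique; first exact: boundedD.
  by under eq_cvg do rewrite avgD ReD; rewrite ReD; apply: cvgD; exact: cvg_Re_avg.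
by under eq_cvg do rewrite avgD ImD; rewrite ImD; apply: cvgD; exact: cvg_Im_avg.
Qed.

Lemma lamZ (c : R[i]) F : bounded F -> lam (fun t => c * F t) = c * lam F.
Proof.
move=> bF.
have ReM (z w : R[i]) : Re (z * w) = Re z * Re w - Im z * Im w by case: z; case: w.
have ImM (z w : R[i]) : Im (z * w) = Re z * Im w + Im z * Re w by case: z; case: w.
have hR := @cvg_Re_avg R t0 F bF; have hI := @cvg_Im_avg R t0 F bF.
apply: lam_unique; first exact: boundedM (bounded_cst c) bF.
  under eq_cvg do rewrite avgZ ReM; rewrite ReM.
  by apply: cvgB; apply: cvgM => //; exact: cvg_cst.
under eq_cvg do rewrite avgZ ImM; rewrite ImM.
by apply: cvgD; apply: cvgM => //; exact: cvg_cst.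
Qed.

Lemma lam0 : lam (fun=> 0) = 0.
Proof.
rewrite -[RHS](mul0r (lam (fun=> 0))) -lamZ; last exact: bounded_cst.
by congr lam; apply/funext => t; rewrite mulr0.
Qed.

Lemma lam_sum (I : Type) (s : seq I) (F : I -> R -> R[i]) :
  (forall i, bounded (F i)) ->
  lam (fun t => \sum_(i <- s) F i t) = \sum_(i <- s) lam (F i).
Proof.
move=> bF; elim: s => [|i s ih].
  rewrite big_nil -[RHS]lam0; congr lam; apply/funext => t.
  by rewrite big_nil.
rewrite big_cons -ih -lamD//; last exact: bounded_sum.
by congr lam; apply/funext => t; rewrite big_cons.
Qed.

Lemma normc_lam F (B : R) : (forall t, normc (F t) <= B) -> normc (lam F) <= B.
Proof.
move=> FB; have B0 := bounded_ge0 FB.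
rewrite -ler_sqr ?nnegrE ?normc_ge0//.
apply: (@cvgr_to_le _ ultra _ _ _ _ _ (@cvg_normc_avg R t0 F (ex_intro _ B FB))).
  apply: (@filterE _ ultra) => M.
by rewrite ler_sqr ?nnegrE ?normc_ge0// normc_avg.
Qed.

Lemma lam_expn n : lam (@expn R n) = (n == 0)%:R.
Proof.
have near_eq : \forall M \near ultra, avg M (@expn R n) = (n == 0)%:R.
  apply: ultra_near; exists `|n|.+1%N => // M /= nM.
  by rewrite avg_expn// (leq_ltn_trans _ nM).
apply: lam_unique; first exact: bounded_expn.
  by apply: cvg_near_cst; apply: filterS near_eq => M ->.
by apply: cvg_near_cst; apply: filterS near_eq => M ->.
Qed.

Definition coef F n : R[i] := lam (fun t => F t * expn (- n) t).

Lemma bounded_coef F n : bounded F -> bounded (fun t => F t * expn (- n) t).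
Proof. by move=> bF; apply: boundedM => //; exact: bounded_expn. Qed.

Lemma coefD F G n : bounded F -> bounded G ->
  coef (fun t => F t + G t) n = coef F n + coef G n.
Proof.
move=> bF bG; rewrite /coef -lamD; [|exact: bounded_coef..].
by congr lam; apply/funext => t; rewrite mulrDl.
Qed.

Lemma coefZ (c : R[i]) F n : bounded F -> coef (fun t => c * F t) n = c * coef F n.
Proof.
move=> bF; rewrite /coef -lamZ; last exact: bounded_coef.
by congr lam; apply/funext => t; rewrite mulrA.
Qed.

Lemma coef_sum (I : Type) (s : seq I) (F : I -> R -> R[i]) n :
  (forall i, bounded (F i)) ->
  coef (fun t => \sum_(i <- s) F i t) n = \sum_(i <- s) coef (F i) n.
Proof.
move=> bF; rewrite /coef -lam_sum; last by move=> i; exact: bounded_coef.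
by congr lam; apply/funext => t; rewrite mulr_suml.
Qed.

Lemma coef_expnM F k n : coef (fun t => expn k t * F t) n = coef F (n - k).
Proof.
rewrite /coef; congr lam; apply/funext => t.
by rewrite mulrAC [RHS]mulrC; congr (_ * _); rewrite -expnD; congr expn; rewrite opprB.
Qed.

Lemma normc_coef F n (B : R) : (forall t, normc (F t) <= B) -> normc (coef F n) <= B.
Proof. by move=> FB; apply: normc_lam => t; rewrite normcM normc_expn mulr1. Qed.

Lemma coef_expn k n : coef (@expn R k) n = (k == n)%:R.
Proof.
rewrite /coef -subr_eq0 -lam_expn; congr lam.
by apply/funext => t; rewrite expnD.
Qed.

Lemma coef_sum_sqr_lim F X (A : R) (N : nat -> R) (w : int -> R) : bounded F ->
  (forall e, 0 < e -> \forall M \near \oo,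
     \sum_(n <- X) w n * normc (avg M (fun t => F t * expn (- n) t)) ^+ 2 <= A + e) ->
  \sum_(n <- X) w n * normc (coef F n) ^+ 2 <= A.
Proof.
move=> bF h; apply/ler_addgt0Pr => e e0.
have lim : (fun M => \sum_(n <- X) w n * normc (avg M (fun t => F t * expn (- n) t)) ^+ 2)
    @ ultra --> \sum_(n <- X) w n * normc (coef F n) ^+ 2.
  apply: cvg_sum_seq => n; apply: cvgM; first exact: cvg_cst.
  by apply: cvg_normc_avg; exact: bounded_coef.
apply: (@cvgr_to_le _ ultra _ _ _ _ _ lim).
exact: ultra_near (h e e0).
Qed.

Lemma int_seq_bound X : exists2 K : nat, (0 < K)%N & {in X, forall n, (`|n| < K)%N}.
Proof.
exists (\max_(n <- X) `|n|%N).+1 => // n nX.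
by rewrite ltnS (big_rem n)//= leq_maxl.
Qed.

Lemma bessel F X (A : R) : bounded F -> uniq X ->
  (forall e, 0 < e -> \forall M \near \oo,
     avgR M (fun t => normc (F t) ^+ 2) <= A + e) ->
  \sum_(n <- X) normc (coef F n) ^+ 2 <= A.
Proof.
move=> bF uX h; have [K K0 KX] := int_seq_bound X.
have := @coef_sum_sqr_lim F X A (fun=> 0) (fun=> 1) bF.
under eq_bigr do rewrite mul1r; apply => e e0.
near=> M; under eq_bigr do rewrite mul1r.
apply: (le_trans (@avg_bessel R t0 M F X _ _ _)) => //.
- by near: M; exists 1%N.
- move=> m n mX nX; apply: (@leq_trans (K + K)); last by near: M; exists (K + K)%N.
  rewrite -ltz_nat abszE (le_lt_trans (ler_normB _ _))// PoszD -!abszE ltrD// ltz_nat.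
  + exact: KX.
  + exact: KX.
- by near: M; exact: h.
Unshelve. all: by end_near. Qed.

(** Bessel's inequality for the one-step difference. Once the grid is fine enough for the finitely
    many frequencies of [X], the factor [expn n (step R M) - 1] has modulus at least [|n|] times
    half a step, whence the 4. *)
Lemma diff_bessel F X (A : R) : bounded F -> uniq X -> F (t0 + 2 * pi) = F t0 ->
  (forall e, 0 < e -> \forall M \near \oo,
     avgR M (fun t => normc (avg_diff M F t) ^+ 2) <= step R M ^+ 2 * (A + e)) ->
  \sum_(n <- X) `|n|%:~R ^+ 2 * normc (coef F n) ^+ 2 <= 4 * A.
Proof.
move=> bF uX Fper h; have [K K0 KX] := int_seq_bound X.
apply: (@coef_sum_sqr_lim F X _ (fun=> 0) (fun n => `|n|%:~R ^+ 2) bF) => e e0.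
have e4 : 0 < e / 4 by rewrite divr_gt0.
near=> M.
have M0 : (0 < M)%N by near: M; exists 1%N.
have MR : 0 < M%:R :> R by rewrite ltr0n.
have s0 : 0 < step R M by rewrite divr_gt0// mulr_gt0 ?pi_gt0.
have hs : K%:R * step R M <= 4^-1.
  rewrite /step mulrA ler_pdivrMr// -ler_pdivrMl ?invr_gt0// invrK.
  near: M; exact: nbhs_infty_ger.
have XM : {in X &, forall m n, (`|m - n| < M)%N}.
  move=> m n mX nX; apply: (@leq_trans (K + K)); last by near: M; exists (K + K)%N.
  by rewrite -ltz_nat abszE (le_lt_trans (ler_normB _ _))// PoszD -!abszE ltrD// ltz_nat KX.
have hM : avgR M (fun t => normc (avg_diff M F t) ^+ 2) <= step R M ^+ 2 * (A + e / 4).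
  by near: M; exact: h.
have := le_trans (@avg_bessel R t0 M _ X M0 uX XM) hM.
rewrite -ler_pdivrMl ?exprn_gt0// mulr_sumr => hh.
rewrite (_ : 4 * A + e = 4 * (A + e / 4)); last by field.
rewrite -ler_pdivrMl// (le_trans _ hh)// mulr_sumr big_seq [leRHS]big_seq.
apply: ler_sum => n nX.
rewrite avg_diff_coef//; move: (avg M (fun t => F t * expn (- n) t)) => c.
rewrite normcM [(normc _ * _) ^+ 2]exprMn mulrA [leRHS]mulrA ler_wpM2r ?sqr_ge0//.
have nstep : `|n%:~R * step R M| <= 4^-1.
  rewrite normrM (gtr0_norm s0) (le_trans _ hs)// ler_wpM2r ?(ltW s0)//.
  by rewrite -intr_norm normz_absz ler_nat ltnW// KX.
have := expi_sub1_ge nstep; rewrite -/(expn n (step R M)) => hn.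
rewrite ler_pdivlMl ?exprn_gt0//.
have : (`|n%:~R * step R M| / 2) ^+ 2 <= normc (expn n (step R M) - 1) ^+ 2.
  by rewrite lerXn2r ?nnegrE ?normc_ge0// divr_ge0.
apply: le_trans; rewrite normrM (gtr0_norm s0) -intr_norm le_eqVlt.
by apply/orP; left; apply/eqP; field.
Unshelve. all: by end_near. Qed.

End FourierCoefficients.

(** * Lipschitz functions have coefficients in a weighted l^1 space *)

Section Lipschitz.
Variable R : realType.

Lemma sum_le_powR (kap d : R) : 1 < kap -> 0 < d ->
  sum_le (fun n : int => (1 + `|n|%:~R * d) `^ (- kap)) (2 * (1 + (d * (kap - 1))^-1)).
Proof.
move=> k1 d0.
have := @sum_absz_le R (fun i => (1 + i%:R * d) `^ (- kap)) _ (fun i => powR_ge0 _ _)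
  (fun M => sum_powR_le M k1 d0).
by apply: le_sum_le => n; rewrite normz_absz.
Qed.

(** Cauchy-Schwarz between [(1 + |n|) c_n], square summable by the mass and energy bounds, and
    [(1 + |n|)^(beta - 1)], square summable because [kap = 2 - 2 beta] exceeds 1. The linear
    dependence on [C] and [L] matters for the powers in Newman's expansion. *)
Lemma lipschitz_coef_l1 (beta : R) : 0 <= beta < 2^-1 ->
  exists2 K : R, 0 < K & forall (t0 : R) (F : R -> R[i]) (C L : R), 0 < C -> 0 <= L ->
    (forall t, normc (F t) <= C) ->
    (forall s t, normc (F s - F t) <= L * `|s - t|) ->
    F (t0 + 2 * pi) = F t0 ->
    l1_le beta (coef t0 F) (K * (C + 2 * L)).
Proof.
move=> /andP[b0 b12]; set kap := 2 - 2 * beta.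
have k1 : 1 < kap by rewrite /kap; lra.
set B : R := 2 * (1 + (1 * (kap - 1))^-1).
have B0 : 0 < B.
  by rewrite mulr_gt0// ltr_pwDl// invr_ge0 mul1r subr_ge0 ltW.
exists (2 * B `^ 2^-1); first by rewrite mulr_gt0 ?powR_gt0.
move=> t0 F C L C0 L0 FC FL Fper X uX.
have bF : bounded F by exists C.
pose A := (2 * (C + 2 * L)) ^+ 2.
have CL0 : 0 < 2 * (C + 2 * L) by rewrite mulr_gt0// ltr_pwDl// mulr_ge0.
have A0 : 0 < A by rewrite exprn_gt0.
have h0 : \sum_(n <- X) normc (coef t0 F n) ^+ 2 <= C ^+ 2.
  apply: bessel => // e e0; near=> M.
  have M0 : (0 < M)%N by near: M; exists 1%N.
  rewrite /avgR ler_pdivrMl ?ltr0n// (@le_trans _ _ (\sum_(x < M) C ^+ 2))//.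
    by apply: ler_sum => i _; rewrite lerXn2r ?nnegrE ?normc_ge0// ltW.
  by rewrite sumr_const card_ord -[leLHS]mulr_natl ler_wpM2l// lerDl ltW.
have h1 : \sum_(n <- X) `|n|%:~R ^+ 2 * normc (coef t0 F n) ^+ 2 <= 4 * L ^+ 2.
  apply: diff_bessel => // e e0; near=> M.
  have M0 : (0 < M)%N by near: M; exists 1%N.
  rewrite /avgR ler_pdivrMl ?ltr0n//.
  rewrite (@le_trans _ _ (\sum_(x < M) step R M ^+ 2 * (L ^+ 2)))//.
    have s0 : 0 <= step R M by rewrite divr_ge0// mulr_ge0 ?pi_ge0.
    have sL : 0 <= step R M * L by exact: mulr_ge0.
    apply: ler_sum => i _; rewrite -exprMn lerXn2r ?nnegrE ?normc_ge0//.
    by rewrite (le_trans (FL _ _))// addrAC subrr add0r mulrC ger0_norm.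
  rewrite sumr_const card_ord -[leLHS]mulr_natl ler_wpM2l// ler_wpM2l ?sqr_ge0// lerDl ltW//.
rewrite (_ : 2 * _ * _ = A `^ 2^-1 * B `^ 2^-1); last first.
  by rewrite [A `^ _]powR12_sqrt ?(ltW A0)// /A sqrtr_sqr gtr0_norm//; ring.
rewrite (eq_bigr (fun n => (normc (coef t0 F n) * (1 + `|n|%:~R)) *
    (weight beta n / (1 + `|n|%:~R)))); last first.
  by move=> n _; field; rewrite gt_eqF// base_gt0.
apply: (@hoelder_sum _ _ X _ _ A B 2 2) => //.
- by lra.
- by move=> n; rewrite mulr_ge0 ?normc_ge0// ltW// base_gt0.
- by move=> n; rewrite divr_ge0 ?weight_ge0// ltW// base_gt0.
- apply: (@le_trans _ _ (2 * (C ^+ 2 + 4 * L ^+ 2))); last first.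
    rewrite /A; move: C0 L0; clear; nra.
  rewrite (le_trans _ (ler_wpM2l _ (lerD h0 h1)))// -big_split mulr_sumr.
  apply: ler_sum => n _ /=.
  have n0 : 0 <= `|n|%:~R :> R by rewrite ler0z.
  rewrite powR_mulrn ?mulr_ge0 ?normc_ge0 ?addr_ge0// exprMn.
  have := sqr_ge0 (normc (coef t0 F n)); set a := normc _ ^+ 2; set b : R := `|n|%:~R.
  have : 0 <= (1 - b) ^+ 2 by rewrite sqr_ge0.
  by nra.
- apply: le_trans (sum_le_powR k1 ltr01 uX).
  apply: ler_sum => n _; rewrite mulr1.
  have n1 := base_gt0 R n.
  rewrite -[X in _ / X]powRr1 ?(ltW n1)// -powRN -powRD ?(gt_eqF n1) ?implybT//.
  by rewrite -powRrM le_eqVlt; apply/orP; left; apply/eqP; congr powR; rewrite /kap; ring.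
Unshelve. all: by end_near. Qed.

End Lipschitz.

(** * Uniformly and unconditionally convergent Fourier series *)

Section UniformSums.
Variable R : realType.
Implicit Types (u x y : int -> R[i]) (F G : R -> R[i]) (X Y : seq int) (n : int).

Definition tsum X x (t : R) : R[i] := \sum_(n <- X) x n * expn n t.

(* Unconditional convergence, uniform in [t]: unlike convergence of symmetric
   partial sums, it is visibly stable under a shift of the index. *)
Definition usum x F := forall e : R, 0 < e -> exists2 X0 : seq int, uniq X0 &
  forall X, uniq X -> {subset X0 <= X} -> forall t, normc (F t - tsum X x t) <= e.

Lemma l1_le_abs (beta : R) x B : 0 <= beta -> l1_le beta x B ->
  sum_le (fun n => normc (x n)) B.
Proof.
by move=> b0; apply: le_sum_le => n; rewrite ler_peMr ?normc_ge0// weight_ge1.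
Qed.

Lemma tsum_sub_le x X Y t : uniq X -> uniq Y -> {subset X <= Y} ->
  normc (tsum Y x t - tsum X x t) <= \sum_(n <- [seq n <- Y | n \notin X]) normc (x n).
Proof.
move=> uX uY XY; rewrite /tsum (bigID (mem X)) /= -[\sum_(i <- Y | i \in X) _]big_filter.
have pX : perm_eq [seq n <- Y | n \in X] X.
  by rewrite uniq_perm ?filter_uniq// => n; rewrite mem_filter; case: (boolP (n \in X)) => // /XY ->.
rewrite (perm_big _ pX) /=.
rewrite addrAC subrr add0r -big_filter (le_trans (normc_sum _ _ _))//.
by apply: ler_sum => n _; rewrite normcM normc_expn mulr1.
Qed.

Definition window (N : nat) : seq int := [seq i%:Z - N%:Z | i <- iota 0 N.*2.+1].

Lemma window_uniq N : uniq (window N).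
Proof.
rewrite map_inj_uniq ?iota_uniq// => i j /addIr; exact: (fun h => congr1 absz h).
Qed.

Lemma mem_window N n : (n \in window N) = (`|n| <= N)%N.
Proof.
apply/mapP/idP => [|nN].
  move=> -[i +]; rewrite mem_iota add0n leq0n /= => iN ->; lia.
exists (absz (n + N%:Z)); last by lia.
by rewrite mem_iota; lia.
Qed.

Lemma subset_window X : exists N, forall M, (N <= M)%N -> {subset X <= window M}.
Proof.
have [K K0 KX] := int_seq_bound X; exists K => M KM n nX.
by rewrite mem_window (leq_trans _ KM)// ltnW// KX.
Qed.

Lemma tsum_window N x t : tsum (window N) x t =
  \sum_(i < N.*2.+1) (let n : int := i%:Z - N%:Z in x n * expi (n%:~R * t)).
Proof. by rewrite /tsum /window big_map -[iota _ _]/(index_iota 0 _.+1) big_mkord. Qed.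

(** The limit of the symmetric sums along [ultra] provides a value at once; comparing windows and
    arbitrary large sets with one set [X0] of small tail then shows that the convergence is uniform
    and unconditional. *)
Lemma abs_usum x B : sum_le (fun n => normc (x n)) B -> exists F, usum x F.
Proof.
move=> xB.
have bnd X t : uniq X -> normc (tsum X x t) <= B.
  move=> uX; rewrite (le_trans (normc_sum _ _ _))//; apply: le_trans (xB X uX).
  by apply: ler_sum => n _; rewrite normcM normc_expn mulr1.
pose z (t : R) N := tsum (window N) x t.
have zB t N : normc (z t N) <= B by apply: bnd; exact: window_uniq.
have zR t : (fun N => Re (z t N)) @ ultra --> ulim (fun N => Re (z t N)).
  by apply: ulim_cvg => N; exact: le_trans (Re_le _) (zB t N).
have zI t : (fun N => Im (z t N)) @ ultra --> ulim (fun N => Im (z t N)).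
  by apply: ulim_cvg => N; exact: le_trans (Im_le _) (zB t N).
exists (fun t => (ulim (fun N => Re (z t N)) +i* ulim (fun N => Im (z t N)))%C) => e e0.
have e2 : 0 < e / 2 by rewrite divr_gt0.
have [X0 uX0 X0P] := sum_le_tail (fun n => normc_ge0 (x n)) xB e2.
exists X0 => // X uX X0X t.
have near_e : \forall N \near ultra, normc (z t N - tsum X x t) <= e.
  apply: ultra_near; have [N NX0] := subset_window X0; exists N => // M /= NM.
  rewrite (le_trans (normc_triangle _ (tsum X0 x t) _))// [e]splitr lerD//.
    rewrite (le_trans (tsum_sub_le _ _ uX0 (window_uniq M) (NX0 M NM)))// X0P//.
      by rewrite filter_uniq// window_uniq.
    by move=> n; rewrite mem_filter => /andP[].
  rewrite normcB (le_trans (tsum_sub_le _ _ uX0 uX X0X))// X0P// ?filter_uniq//.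
  by move=> n; rewrite mem_filter => /andP[].
rewrite -ler_sqr ?nnegrE ?normc_ge0 ?(ltW e0)// normc_sqr ReD ImD ReN ImN /=.
have lim : (fun N => normc (z t N - tsum X x t) ^+ 2) @ ultra -->
    (ulim (fun N => Re (z t N)) - Re (tsum X x t)) ^+ 2 +
    (ulim (fun N => Im (z t N)) - Im (tsum X x t)) ^+ 2.
  under eq_cvg do rewrite normc_sqr ReD ImD ReN ImN !expr2.
  by rewrite !expr2; apply: cvgD; apply: cvgM; apply: cvgB => //; exact: cvg_cst.
apply: (@cvgr_to_le _ ultra _ _ _ _ _ lim).
apply: filterS near_e => N h.
by rewrite ler_sqr ?nnegrE ?normc_ge0 ?(ltW e0).
Qed.

Lemma usum_window x F t : usum x F ->
  forall e : R, 0 < e -> \forall N \near \oo, normc (F t - tsum (window N) x t) <= e.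
Proof.
move=> xF e e0; have [X0 uX0 X0P] := xF e e0.
have [N NX0] := subset_window X0; exists N => // M /= NM.
by apply: X0P; [exact: window_uniq|exact: NX0].
Qed.

Lemma usum_fourier x F t : usum x F -> fourier x (circle_pi t) = F t.
Proof.
move=> xF; rewrite fourier_pi.
under [X in lim (X @ _)]eq_fun do rewrite -tsum_window.
apply: (@cvg_lim R[i]^o); first exact: norm_hausdorff.
apply/(@cvgrPdist_le _ R[i]^o) => /= e e0.
(* In the order of [R[i]], a positive element is a positive real. *)
have eE : e = (Re e)%:C%C by case: e e0 => a b; rewrite ltcE /= => /andP[/eqP -> _].
have e0' : 0 < Re e by move: e0; rewrite ltcE /= => /andP[].
apply: filterS (usum_window t xF e0') => N h.
by rewrite normc_def -/(normc _) eE lecR /=; move: h; case: (_ - _).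
Qed.

Lemma usum_periodic x F (k : int) t : usum x F -> F (t + k%:~R * (2 * pi)) = F t.
Proof.
move=> xF; rewrite -!(usum_fourier _ xF) !fourier_pi.
apply: (congr1 (fun f : nat -> R[i]^o => limn f)); apply: funext => N.
apply: eq_bigr => i _ /=.
by rewrite mulrDr mulrA -intrM expi_2pi.
Qed.

Lemma usum_normc_le x F B t : usum x F -> sum_le (fun n => normc (x n)) B ->
  normc (F t) <= B.
Proof.
move=> xF xB; apply/ler_addgt0Pr => e e0; have [X0 uX0 X0P] := xF e e0.
rewrite -[F t](subrK (tsum X0 x t)) addrC (le_trans (le_normcD _ _))// lerD ?X0P//.
rewrite (le_trans (normc_sum _ _ _))//; apply: le_trans (xB X0 uX0).
by apply: ler_sum => n _; rewrite normcM normc_expn mulr1.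
Qed.

Lemma usum_finite (X : seq int) x : uniq X ->
  usum (fun n => if n \in X then x n else 0) (tsum X x).
Proof.
move=> uX e e0; exists X => // Y uY XY t.
rewrite (_ : tsum Y _ t = tsum X x t) ?subrr ?normc0 ?ltW//.
rewrite /tsum (bigID (mem X)) /= [X in _ + X]big1 ?addr0; last first.
  by move=> n /negbTE ->; rewrite mul0r.
rewrite -big_filter [LHS]big_seq_cond.
under eq_bigr => n do (rewrite andbT mem_filter => /andP[nX _]; rewrite nX).
rewrite -big_seq_cond; apply: perm_big.
by rewrite uniq_perm ?filter_uniq// => n; rewrite mem_filter; case: (boolP (n \in X)) => // /XY ->.
Qed.

Lemma usumB x y F G : usum x F -> usum y G ->
  usum (fun n => x n - y n) (fun t => F t - G t).
Proof.
move=> xF yG e e0; have e2 : 0 < e / 2 by rewrite divr_gt0.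
have [X0 uX0 X0P] := xF _ e2; have [Y0 uY0 Y0P] := yG _ e2.
exists (undup (X0 ++ Y0)) => [|X uX sX t]; first exact: undup_uniq.
have X0X : {subset X0 <= X} by move=> n nX; apply: sX; rewrite mem_undup mem_cat nX.
have Y0X : {subset Y0 <= X} by move=> n nX; apply: sX; rewrite mem_undup mem_cat nX orbT.
have -> : F t - G t - tsum X (fun n => x n - y n) t =
    (F t - tsum X x t) - (G t - tsum X y t).
  rewrite /tsum (eq_bigr (fun n => x n * expn n t - y n * expn n t)).
    by rewrite sumrB; ring.
  by move=> n _; rewrite mulrBl.
by rewrite (le_trans (le_normcD _ _))// normcN [e]splitr lerD ?X0P ?Y0P.
Qed.

Lemma tsum_lipschitz X x s t :
  normc (tsum X x s - tsum X x t) <= (\sum_(n <- X) normc (x n) * `|n|%:~R) * `|s - t|.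
Proof.
rewrite /tsum -sumrB mulr_suml (le_trans (normc_sum _ _ _))//.
apply: ler_sum => n _; rewrite -mulrBr normcM -mulrA ler_wpM2l ?normc_ge0//.
by rewrite (le_trans (expi_sub_le _ _))// -mulrBr normrM -intr_norm.
Qed.

Lemma usum_unif_continuous x F : usum x F -> forall e : R, 0 < e ->
  exists2 d : R, 0 < d & forall s t, `|s - t| <= d -> normc (F s - F t) <= e.
Proof.
move=> xF e e0; have e3 : 0 < e / 3 by rewrite divr_gt0.
have [X0 uX0 X0P] := xF _ e3.
set L := \sum_(n <- X0) normc (x n) * `|n|%:~R.
have L0 : 0 <= L by rewrite sumr_ge0// => n _; rewrite mulr_ge0 ?normc_ge0// ler0z.
have L1 : 0 < L + 1 by rewrite ltr_wpDl.
exists (e / 3 / (L + 1)); first by rewrite divr_gt0.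
move=> s t st.
have h1 := X0P X0 uX0 (fun n h => h) s.
have h2 := X0P X0 uX0 (fun n h => h) t.
have h3 : normc (tsum X0 x s - tsum X0 x t) <= e / 3.
  rewrite (le_trans (tsum_lipschitz _ _ _ _))// -/L.
  rewrite (le_trans (ler_wpM2l L0 st))// mulrCA ler_piMr ?(ltW e3)//.
  by rewrite ler_pdivrMr// mul1r lerDl.
rewrite (le_trans (normc_triangle _ (tsum X0 x s) _))//.
have := normc_triangle (tsum X0 x s) (tsum X0 x t) (F t).
rewrite [normc (tsum X0 x t - F t)]normcB; lra.
Qed.

Lemma usum_bounded x F : usum x F -> bounded F.
Proof.
move=> xF; have [X0 uX0 X0P] := xF 1 ltr01.
exists (1 + \sum_(n <- X0) normc (x n)) => t.
rewrite -[F t](subrK (tsum X0 x t)) (le_trans (le_normcD _ _))// lerD ?X0P//.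
rewrite (le_trans (normc_sum _ _ _))//.
by apply: ler_sum => n _; rewrite normcM normc_expn mulr1.
Qed.

Lemma bounded_tsum X x : bounded (tsum X x).
Proof.
by apply: bounded_sum => n; apply: boundedM; [exact: bounded_cst|exact: bounded_expn].
Qed.

End UniformSums.

Local Arguments normc : simpl never.

(** * Products of Fourier series and the ideal generated by [U] *)

Section Wiener.
Variables (R : realType) (t0 beta : R).
Hypothesis beta_ge0 : 0 <= beta.
Implicit Types (u x y : int -> R[i]) (F G : R -> R[i]) (X Y : seq int) (n : int).

Local Notation coef := (coef t0).

Lemma coef_tsumM X x G n : bounded G ->
  coef (fun t => tsum X x t * G t) n = \sum_(k <- X) x k * coef G (n - k).
Proof.
move=> bG; rewrite (_ : (fun t => _) = fun t => \sum_(k <- X) x k * (expn k t * G t)).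
  rewrite coef_sum.
    apply: eq_bigr => k _; rewrite coefZ ?coef_expnM//.
    by apply: boundedM => //; exact: bounded_expn.
  by move=> k; apply: boundedM; [exact: bounded_cst|apply: boundedM => //; exact: bounded_expn].
by apply/funext => t; rewrite mulr_suml; apply: eq_bigr => k _; rewrite mulrA.
Qed.

Lemma coef_usumM_near x F G : usum x F -> bounded G -> forall e : R, 0 < e ->
  exists2 X0, uniq X0 & forall X, uniq X -> {subset X0 <= X} -> forall n,
    normc (coef (fun t => F t * G t) n - \sum_(k <- X) x k * coef G (n - k)) <= e.
Proof.
move=> xF bG e e0; have [B GB] := bG; have B0 := bounded_ge0 GB.
have B1 : 0 < B + 1 by rewrite ltr_wpDl.
have [X0 uX0 X0P] := xF _ (divr_gt0 e0 B1).
exists X0 => // X uX sX n; rewrite -coef_tsumM//.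
have bF := usum_bounded xF.
rewrite (_ : _ - _ = coef (fun t => (F t - tsum X x t) * G t) n).
  apply: normc_coef => t; rewrite normcM.
  apply: (@le_trans _ _ (e / (B + 1) * (B + 1))); last by rewrite divfK// gt_eqF.
  by rewrite ler_pM ?normc_ge0 ?X0P// (le_trans (GB t))// lerDl.
rewrite (_ : (fun t => (F t - _) * G t) = fun t => F t * G t + (-1) * (tsum X x t * G t)).
  have bTG : bounded (fun t => tsum X x t * G t) by exact: boundedM (bounded_tsum X x) bG.
  rewrite coefD; [|exact: boundedM|exact: boundedM (bounded_cst _) bTG].
  by rewrite coefZ// mulN1r.
by apply/funext => t; ring.
Qed.

Lemma coef_usum x F n : usum x F -> coef F n = x n.
Proof.
move=> xF; have := coef_usumM_near xF (bounded_cst 1).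
rewrite (_ : (fun t => F t * 1) = F); last by apply/funext => t; rewrite mulr1.
have c1 k : coef (fun=> 1) k = (k == 0)%:R.
  rewrite -(eq_sym 0) -(coef_expn t0 0 k); congr coef.
  by apply/funext => t; rewrite expn0.
move=> h; apply/eqP; rewrite -subr_eq0 -normc_eq0 eq_le normc_ge0 andbT.
apply/ler_addgt0Pr => e e0; rewrite add0r.
have [X0 uX0 X0P] := h e e0.
have /(X0P _ (undup_uniq _)) : {subset X0 <= undup (n :: X0)}.
  by move=> k kX; rewrite mem_undup inE kX orbT.
move=> /(_ n); rewrite (bigD1_seq n) ?undup_uniq ?mem_undup ?inE ?eqxx//=.
rewrite c1 subrr eqxx mulr1 big1 ?addr0// => k kn.
by rewrite c1 subr_eq0 eq_sym (negbTE kn) mulr0.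
Qed.

(** The weights are submultiplicative, so weighted l^1 norms are submultiplicative under
    convolution. On the tested set [Y], of total weight [W], [F] is replaced by a finite sum with an
    error at most [e / (W + 1)] in each coefficient. *)
Lemma l1_coefM x F G A B : l1_le beta x A -> usum x F -> bounded G ->
  l1_le beta (coef G) B -> l1_le beta (coef (fun t => F t * G t)) (A * B).
Proof.
move=> xA xF bG GB Y uY.
set W := \sum_(n <- Y) weight beta n.
have W0 : 0 <= W by rewrite sumr_ge0// => n _; rewrite weight_ge0.
have W1 : 0 < W + 1 by rewrite ltr_wpDl.
apply/ler_addgt0Pr => e e0.
have [X uX /(_ X uX (fun n h => h)) XP] := coef_usumM_near xF bG (divr_gt0 e0 W1).
apply: (@le_trans _ _ (\sum_(n <- Y) (\sum_(k <- X) normc (x k) * weight beta k *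
   (normc (coef G (n - k)) * weight beta (n - k)) + e / (W + 1) * weight beta n))).
  apply: ler_sum => n _.
  have := normcB_ge (coef (fun t => F t * G t) n) (\sum_(k <- X) x k * coef G (n - k)).
  move=> h; have {h} := le_trans h (XP n); rewrite lerBlDr => h.
  rewrite (le_trans (ler_wpM2r (weight_ge0 _ _) h))// mulrDl addrC lerD2r.
  rewrite (le_trans (ler_wpM2r (weight_ge0 _ _) (normc_sum _ _ _)))// mulr_suml.
  apply: ler_sum => k _; rewrite normcM mulrACA ler_wpM2l ?mulr_ge0 ?normc_ge0//.
  by have := @weightD R beta k (n - k) beta_ge0; rewrite addrC subrK.
rewrite big_split /= -mulr_sumr -/W lerD//; last first.
  by rewrite mulrAC -mulrA ler_piMr ?(ltW e0)// ler_pdivrMr// mul1r lerDl.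
rewrite exchange_big /= (@le_trans _ _ (\sum_(k <- X) normc (x k) * weight beta k * B))//.
  apply: ler_sum => k _; rewrite -mulr_sumr ler_wpM2l ?mulr_ge0 ?normc_ge0 ?weight_ge0//.
  exact: (sum_le_shift (- k) GB uY).
by rewrite -mulr_suml ler_wpM2r ?(sum_le_ge0 GB)// xA.
Qed.

Lemma l1_coefXM x F G A B (j : nat) : l1_le beta x A -> usum x F -> bounded G ->
  l1_le beta (coef G) B -> l1_le beta (coef (fun t => F t ^+ j * G t)) (A ^+ j * B).
Proof.
move=> xA xF bG GB; have bF := usum_bounded xF.
have bXG i : bounded (fun t => F t ^+ i * G t).
  elim: i => [|i ih]; first by rewrite (_ : (fun t => _) = G)//; apply/funext => t; rewrite mul1r.
  rewrite (_ : (fun t => _) = fun t => F t * (F t ^+ i * G t)); first exact: boundedM.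
  by apply/funext => t; rewrite exprS mulrA.
elim: j => [|j ih].
  by rewrite (_ : (fun t => _) = G) ?mul1r//; apply/funext => t; rewrite mul1r.
rewrite (_ : (fun t => _) = fun t => F t * (F t ^+ j * G t)).
  by rewrite exprS -mulrA; apply: (l1_coefM xA xF).
by apply/funext => t; rewrite exprS mulrA.
Qed.

Section Ideal.
Variables (p : R) (u : int -> R[i]) (U : R -> R[i]) (A : R).
Hypotheses (p_ge1 : 1 <= p) (uA : l1_le beta u A) (uU : usum u U).

Lemma powR_small e : 0 < e -> exists2 d : R, 0 < d & d `^ p <= e.
Proof.
move=> e0; have p0 : 0 < p by exact: lt_le_trans p_ge1.
exists (e `^ p^-1); first by rewrite powR_gt0.
by rewrite -powRrM mulVf ?gt_eqF// powRr1// ltW.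
Qed.

(** A trigonometric polynomial times [U] has its coefficients in the span. Truncating the
    coefficients of [G] with tail [d / (A + 1)] changes the product by at most [d] in l^1_beta,
    hence in l^p_beta. *)
Lemma translate_closure_coefM G B : bounded G -> l1_le beta (coef G) B ->
  translate_closure p beta u (coef (fun t => U t * G t)).
Proof.
move=> bG GB; apply: translate_closure_lim => // e e0.
have [d d0 de] := powR_small e0.
have A0 := sum_le_ge0 uA; have A1 : 0 < A + 1 by rewrite ltr_wpDl.
have [X uX XP] := sum_le_tail (fun n => mulr_ge0 (normc_ge0 (coef G n)) (weight_ge0 beta n))
  GB (divr_gt0 d0 A1).
have bU := usum_bounded uU; have bQ := bounded_tsum X (coef G).
exists (coef (fun t => tsum X (coef G) t * U t)).
  apply: translate_span_closure => //.
  (* Multiplication by [expn k] moves the coefficient of index [n - k] to [n], which is translation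
     by [- k]. *)
  exists [seq (coef G k, - k) | k <- X]; apply/funext => n.
  rewrite coef_tsumM// big_map; apply: eq_bigr => k _ /=.
  by rewrite (coef_usum _ uU).
apply: sum_le_trans de _; apply: l1_lp => //.
pose D t := G t - tsum X (coef G) t.
have bD : bounded D.
  apply: boundedD => //; have [C hC] := bQ; exists C => t.
  by rewrite normcN.
have cD n : coef D n = if n \in X then 0 else coef G n.
  rewrite (_ : D = fun t => G t + (-1) * (tsum X (coef G) t * 1)); last first.
    by apply/funext => t; rewrite /D mulr1 mulN1r.
  rewrite coefD//; last first.
    apply: boundedM; first exact: bounded_cst.
    by apply: boundedM => //; exact: bounded_cst.
  rewrite coefZ; last by apply: boundedM => //; exact: bounded_cst.
  rewrite coef_tsumM; last exact: bounded_cst.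
  have c1 k : coef (fun=> 1) k = (k == 0)%:R.
    rewrite -(eq_sym 0) -(coef_expn t0 0 k); congr coef.
    by apply/funext => t; rewrite expn0.
  case: ifPn => [nX|nX].
    rewrite (bigD1_seq n)//= c1 subrr eqxx mulr1 big1 ?addr0 ?mulN1r ?subrr// => k kn.
    by rewrite c1 subr_eq0 eq_sym (negbTE kn) mulr0.
  rewrite big_seq big1 ?mulr0 ?addr0// => k kX; rewrite c1 subr_eq0.
  rewrite (_ : n == k = false) ?mulr0//; apply/negbTE.
  by apply: contraNneq nX => ->.
have Dd : l1_le beta (coef D) (d / (A + 1)).
  move=> Y uY; rewrite (bigID (mem X)) /= big1 ?add0r; last first.
    by move=> n nX; rewrite cD nX normc0 mul0r.
  rewrite -big_filter; apply: (@le_trans _ _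
    (\sum_(n <- [seq n <- Y | n \notin X]) normc (coef G n) * weight beta n)).
    rewrite big_seq [leRHS]big_seq ler_sum// => n.
    by rewrite mem_filter cD => /andP[/negbTE -> _].
  apply: XP => [|n]; first by rewrite filter_uniq.
  by rewrite mem_filter => /andP[].
apply: (@sum_le_trans _ _ (A * (d / (A + 1)))).
  by rewrite mulrCA ler_piMr ?(ltW d0)// ler_pdivrMr// mul1r lerDl.
apply: le_sum_le (l1_coefM uA uU bD Dd) => n.
rewrite ler_wpM2r ?weight_ge0// le_eqVlt; apply/orP; left; apply/eqP; congr normc.
rewrite (_ : (fun t => U t * D t) = fun t => U t * G t + (-1) * (tsum X (coef G) t * U t)).
  have bQU : bounded (fun t => tsum X (coef G) t * U t) by exact: boundedM.
  rewrite coefD; [|exact: boundedM|exact: boundedM (bounded_cst _) bQU].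
  by rewrite coefZ// mulN1r.
by apply/funext => t; rewrite /D; ring.
Qed.

End Ideal.

End Wiener.

(** * Newman's expansion *)

Section WienerLocal.
Variables (R : realType) (t0 beta p : R) (u : int -> R[i]) (U : R -> R[i]) (A : R).
Hypotheses (beta_lt : 0 <= beta < 2^-1) (p_ge1 : 1 <= p).
Hypotheses (uA : l1_le beta u A) (uU : usum u U).

Let beta_ge0 : 0 <= beta. Proof. by case/andP: beta_lt. Qed.

Lemma normc_subX (a b : R[i]) (rho : R) K : normc a <= rho -> normc b <= rho ->
  normc (a ^+ K.+1 - b ^+ K.+1) <= K.+1%:R * rho ^+ K * normc (a - b).
Proof.
move=> ar br; have r0 : 0 <= rho by rewrite (le_trans _ ar)// normc_ge0.
rewrite subrXX normcM mulrC ler_wpM2r ?normc_ge0//.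
rewrite (le_trans (normc_sum _ _ _))//.
rewrite (@le_trans _ _ (\sum_(i < K.+1) rho ^+ K))//; last first.
  by rewrite sumr_const card_ord mulr_natl.
apply: ler_sum => i _; rewrite normcM !normcX.
have -> : rho ^+ K = rho ^+ (K - i) * rho ^+ i by rewrite -exprD subnK// -ltnS.
by rewrite ler_pM ?exprn_ge0 ?normc_ge0// lerXn2r ?nnegrE ?normc_ge0.
Qed.

Lemma small_geometric (C1 C2 e : R) : 0 <= C1 -> 0 <= C2 -> 0 < e ->
  exists K : nat, 4^-1 ^+ K * (C1 + C2 * K%:R) <= e.
Proof.
move=> C10 C20 e0; have C0 : 0 <= C1 + C2 by rewrite addr_ge0.
have [K eK] : exists K : nat, (C1 + C2) / e < K%:R.
  by exists (Num.bound ((C1 + C2) / e)); rewrite archi_boundP// divr_ge0// ltW.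
exists K.+1; have two : K.+1%:R <= 2 ^+ K.+1 :> R.
  by rewrite -natrX ler_nat ltnW// ltn_expl.
have K1 : (1 : R) <= K.+1%:R by rewrite ler1n.
rewrite exprVn ler_pdivrMl ?exprn_gt0//.
rewrite (_ : 4 = 2 * 2 :> R); last by ring.
rewrite exprMn -mulrA; apply: (@le_trans _ _ ((C1 + C2) * K.+1%:R)).
  by rewrite mulrDl lerD2r ler_peMr.
rewrite [_ * K.+1%:R]mulrC ler_pM//.
apply: (@le_trans _ _ (e * K.+1%:R)).
  by move: eK; rewrite ltr_pdivrMr// mulrC => /ltW /le_trans; apply; rewrite ler_wpM2l ?(ltW e0)// ler_nat.
by rewrite mulrC ler_wpM2r ?(ltW e0).
Qed.

Lemma translate_closure_wiener (f : R -> R[i]) (L c : R) : 0 <= L -> 0 < c ->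
  (forall t, normc (f t) <= 1) ->
  (forall s t, normc (f s - f t) <= L * `|s - t|) ->
  f (t0 + 2 * pi) = f t0 ->
  (forall t, f t != 0 -> c <= normc (U t)) ->
  translate_closure p beta u (coef t0 f).
Proof.
move=> L0 c0 f1 fL fper fU.
have [X uX XP] := sum_le_tail (fun n => mulr_ge0 (normc_ge0 (u n)) (weight_ge0 beta n))
  uA (divr_gt0 c0 (ltr0Sn R 5)).
pose P := tsum X u.
pose d n := (if n \in X then u n else 0) - u n.
pose D t := P t - U t.
have dD : usum d D by exact: usumB (usum_finite u uX) uU.
have dc : l1_le beta d (c / 6).
  move=> Y uY; rewrite (bigID (mem X)) /= big1 ?add0r; last first.
    by move=> n nX; rewrite /d nX subrr normc0 mul0r.
  rewrite -big_filter; apply: (@le_trans _ _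
    (\sum_(n <- [seq n <- Y | n \notin X]) normc (u n) * weight beta n)).
    rewrite big_seq [leRHS]big_seq ler_sum// => n.
    by rewrite mem_filter /d => /andP[/negbTE -> _]; rewrite sub0r normcN.
  apply: XP => [|n]; first by rewrite filter_uniq.
  by rewrite mem_filter => /andP[].
have Dc t : normc (D t) <= c / 6 := usum_normc_le t dD (l1_le_abs beta_ge0 dc).
(* Where [f] is nonzero, [|P|] is at least [c - c / 6], hence at least [2 c / 3]; so [rho] bounds
   its inverse and the ratio of the expansion is [c / 6 * rho = 1 / 4]. *)
pose rho := 3 / (2 * c).
have rho0 : 0 < rho by rewrite divr_gt0// mulr_gt0.
have rhoE : rho = (2 * c / 3)^-1 by rewrite /rho; field; rewrite gt_eqF.
have rhoc : 4^-1 = c / 6 * rho by rewrite /rho; field; rewrite gt_eqF.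
clearbody rho.
have Prho t : f t != 0 -> normc (P t)^-1 <= rho.
  move=> ft; rewrite normcV.
  have : 2 * c / 3 <= normc (P t).
    have := fU t ft; have := Dc t.
    have := normcB_ge (U t) (P t); rewrite normcB -/(D t).
    lra.
  move=> h; have h0 : 0 < 2 * c / 3 by rewrite divr_gt0// mulr_gt0.
  by rewrite rhoE lef_pV2 ?posrE// (lt_le_trans h0).
have P0 t : f t != 0 -> P t != 0.
  move=> ft; apply: contraTneq (fU t ft) => Pt; rewrite -ltNge.
  have := Dc t; rewrite /D Pt sub0r normcN.
  by move=> /le_lt_trans; apply; rewrite ltr_pdivrMr// ltr_pMr// ltr1n.
set LP := \sum_(n <- X) normc (u n) * `|n|%:~R : R.
have LP0 : 0 <= LP by rewrite sumr_ge0// => n _; rewrite mulr_ge0 ?normc_ge0// ler0z.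
(* Zeros of [P] are harmless: [f] vanishes there, so the default value of the inverse has no
   effect. *)
pose G K t := f t * (P t)^-1 ^+ K.
have Gb K t : normc (G K t) <= rho ^+ K.
  rewrite normcM; have [->|ft] := eqVneq (f t) 0.
    by rewrite normc0 mul0r exprn_ge0// ltW.
  rewrite -[leRHS]mul1r ler_pM ?normc_ge0// normcX lerXn2r ?nnegrE ?normc_ge0 ?(ltW rho0)//.
  exact: Prho.
have bG K : bounded (G K) by exists (rho ^+ K).
have GL K s t : normc (G K s - G K t) <=
    (rho ^+ K * L + K%:R * rho ^+ K * (rho * LP)) * `|s - t|.
  have rK0 : 0 <= rho ^+ K by rewrite exprn_ge0// ltW.
  have LK0 : 0 <= K%:R * rho ^+ K * (rho * LP).
    by apply: mulr_ge0; apply: mulr_ge0 => //; exact: ltW.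
  (* If [f] vanishes at one of the two points, the Lipschitz bound for [f] already controls its
     value at the other, and [P] is compared only at points where it is bounded below. *)
  have one x y : f y = 0 -> normc (G K x - G K y) <=
     (rho ^+ K * L + K%:R * rho ^+ K * (rho * LP)) * `|x - y|.
    move=> fy; have Gy : G K y = 0 by rewrite /G fy mul0r.
    rewrite Gy subr0; have [fx|fx] := eqVneq (f x) 0.
      by rewrite /G fx mul0r normc0 mulr_ge0// addr_ge0 ?LK0// mulr_ge0.
    apply: (@le_trans _ _ (rho ^+ K * L * `|x - y|)).
      rewrite /G normcM normcX mulrC -mulrA ler_pM ?exprn_ge0 ?normc_ge0//.
        by rewrite lerXn2r ?nnegrE ?normc_ge0 ?(ltW rho0)// Prho.
      by have := fL x y; rewrite fy subr0.
    by rewrite ler_wpM2r// lerDl LK0.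
  have [ft|ft] := eqVneq (f t) 0; first exact: one.
  have [fs|fs] := eqVneq (f s) 0; first by rewrite normcB distrC; exact: one.
  rewrite (_ : G K s - G K t = (f s - f t) * (P s)^-1 ^+ K +
      f t * ((P s)^-1 ^+ K - (P t)^-1 ^+ K)); last by rewrite /G; ring.
  rewrite (le_trans (le_normcD _ _))// [leRHS]mulrDl lerD//.
    rewrite normcM normcX mulrC -mulrA ler_pM ?exprn_ge0 ?normc_ge0//.
    by rewrite lerXn2r ?nnegrE ?normc_ge0 ?(ltW rho0)// Prho.
  rewrite normcM -[leRHS]mul1r ler_pM ?normc_ge0//.
  clear one; case: K rK0 LK0 => [|K] rK0 LK0; first by rewrite !expr0 subrr normc0 !mul0r.
  rewrite (le_trans (normc_subX _ (Prho _ fs) (Prho _ ft)))//.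
  rewrite exprSr -!mulrA ler_wpM2l// ler_wpM2l ?exprn_ge0 ?(ltW rho0)//.
  rewrite (_ : (P s)^-1 - (P t)^-1 = (P s)^-1 * ((P t)^-1 * (P t - P s))); last first.
    by field; rewrite !P0.
  rewrite normcM ler_pM ?normc_ge0 ?Prho// normcM ler_pM ?normc_ge0 ?Prho//.
  by rewrite normcB tsum_lipschitz.
have Gper K : G K (t0 + 2 * pi) = G K t0.
  rewrite /G fper; congr (_ * _^-1 ^+ _); apply: eq_bigr => n _.
  by rewrite /expn mulrDr expi_2pi.
have [K0 K00 K0P] := lipschitz_coef_l1 beta_lt.
pose B K := K0 * (rho ^+ K + 2 * (rho ^+ K * L + K%:R * rho ^+ K * (rho * LP))).
have GB K : l1_le beta (coef t0 (G K)) (B K).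
  apply: K0P; rewrite ?exprn_gt0//.
  by rewrite addr_ge0// !mulr_ge0 ?exprn_ge0 ?(ltW rho0).
pose E j K t := D t ^+ j * G K t.
have EB j K : l1_le beta (coef t0 (E j K)) ((c / 6) ^+ j * B K).
  exact: (l1_coefXM beta_ge0 j dc dD (bG K) (GB K)).
have bE j K : bounded (E j K).
  elim: j => [|j [C hC]]; first by exists (rho ^+ K) => t; rewrite /E mul1r.
  exists (c / 6 * C) => t; rewrite /E exprS -mulrA normcM.
  by rewrite ler_pM ?normc_ge0 ?Dc// hC.
have bU := usum_bounded uU.
(* This iterates [1 = D / P + U / P] where [f] is nonzero. Each term of the sum is a multiple of
   [U], and the inverse of [U] never occurs. *)
have tele K : f = fun t => E K K t + \sum_(k < K) U t * E k k.+1 t.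
  apply/funext => t; elim: K => [|K ih].
    by rewrite big_ord0 addr0 /E /G !expr0 mulr1 mul1r.
  rewrite big_ord_recr /= {1}ih [X in X + _ = _](_ : _ = E K.+1 K.+1 t + U t * E K K.+1 t).
    by ring.
  have [ft|ft] := eqVneq (f t) 0; first by rewrite /E /G ft !mul0r !mulr0 addr0.
  have PK : (P t)^-1 ^+ K = P t * (P t)^-1 ^+ K.+1.
    by rewrite exprS mulrA divff ?P0// mul1r.
  by rewrite /E /G PK [D t ^+ K.+1]exprS /D; ring.
apply: translate_closure_lim => // e e0.
have [d1 d10 d1e] := powR_small p_ge1 e0.
(* The two constants are the coefficients of 1 and [K] in [B K], once the powers of [c / 6] and
   [rho] have combined into a power of [1 / 4]. *)
have [K KP] := @small_geometric (K0 * (1 + 2 * L)) (K0 * (2 * (rho * LP))) d1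
  (ltac:(by rewrite !mulr_ge0 ?(ltW K00)// addr_ge0// mulr_ge0))
  (ltac:(by rewrite !mulr_ge0 ?(ltW K00) ?(ltW rho0))) d10.
pose H k := coef t0 (fun t => U t * E k k.+1 t).
exists (fun n => \sum_(k < K) H k n).
  apply: translate_closure_sum => // k.
  exact: (translate_closure_coefM beta_ge0 p_ge1 uA uU (bE _ _) (EB _ _)).
apply: sum_le_trans d1e _; apply: l1_lp => //.
have : l1_le beta (coef t0 (E K K)) d1.
  apply: sum_le_trans (EB K K); apply: le_trans KP.
  rewrite /B le_eqVlt; apply/orP; left; apply/eqP.
  by rewrite rhoc [(c / 6 * rho) ^+ K]exprMn; ring.
apply: le_sum_le => n.
rewrite ler_wpM2r ?weight_ge0// le_eqVlt; apply/orP; left; apply/eqP; congr normc.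
rewrite [in LHS](tele K) coefD//; last first.
  by apply: bounded_sum => k; exact: boundedM.
rewrite coef_sum; last by move=> k; exact: boundedM.
by rewrite addrK.
Qed.

End WienerLocal.

(** * The quotient circle and the components of a complement *)

Section CircleTopology.
Variable R : realType.
Implicit Types (s t : R) (U : set (circle R)).

Lemma twopi_gt0 : 0 < 2 * pi :> R.
Proof. by rewrite mulr_gt0 ?pi_gt0. Qed.

Lemma circle_piP s t : circle_pi s = circle_pi t <-> exists k : int, t = s + k%:~R * (2 * pi).
Proof.
split=> [st|st].
  have : congr_2pi_rel R s t by apply/(eqmodP (congr_2pi_rel R)).
  by move=> /asboolP.
by apply/(eqmodP (congr_2pi_rel R)); exact/asboolP.
Qed.

Lemma circle_pi_shift t (k : int) : circle_pi (t + k%:~R * (2 * pi)) = circle_pi t.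
Proof. by symmetry; apply/circle_piP; exists k. Qed.

Lemma circle_pi_repr (t0 : R) (c : circle R) :
  exists2 t, t0 <= t < t0 + 2 * pi & c = circle_pi t.
Proof.
have pi0 := twopi_gt0.
have [r ->] : exists r, c = circle_pi r.
  by exists (repr c); rewrite /circle_pi reprK.
exists (r + (- Num.floor ((r - t0) / (2 * pi)))%:~R * (2 * pi)); last first.
  by rewrite circle_pi_shift.
have := Num.Theory.ge_floor ((r - t0) / (2 * pi)).
have := Num.Theory.lt_succ_floor ((r - t0) / (2 * pi)).
rewrite ltr_pdivrMr// ler_pdivlMr// intrD mulrDl mul1r mulrNz mulNr.
move=> h1 h2; apply/andP; split; first by move: h2; lra.
by move: h1; lra.
Qed.

Lemma circle_pi_inj s t : `|s - t| < 2 * pi -> circle_pi s = circle_pi t -> s = t.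
Proof.
move=> st /circle_piP[k tE]; move: st; rewrite tE opprD addrA subrr add0r normrN normrM.
rewrite (gtr0_norm twopi_gt0) -[ltRHS]mul1r ltr_pM2r ?twopi_gt0// -intr_norm.
rewrite -[1]/(1%:~R) ltr_int => k0.
have -> : k = 0 by lia.
by rewrite mul0r addr0.
Qed.

Lemma open_circleE U : open U = open (@circle_pi R @^-1` U).
Proof. by []. Qed.

Lemma open_circle_pi (A : set R) : open A -> open (@circle_pi R @` A).
Proof.
move=> oA; rewrite open_circleE.
have -> : @circle_pi R @^-1` (@circle_pi R @` A) =
    \bigcup_(k in [set: int]) ((fun t => t + k%:~R * (2 * pi)) @^-1` A).
  apply/seteqP; split => t /=.
    by move=> [s As /esym/circle_piP[k sE]]; exists k; rewrite //= -sE.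
  by move=> [k _ /= Ak]; exists (t + k%:~R * (2 * pi)); rewrite // circle_pi_shift.
apply: bigcup_open => k _.
apply: open_comp => // t _.
by apply: cvgD; [exact: cvg_id|exact: cvg_cst].
Qed.

Lemma closed_arc (a b : R) : a <= b < a + 2 * pi -> closed (@circle_pi R @` `[a, b]).
Proof.
move=> /andP[ab ba].
rewrite -[X in closed X]setCK closedC.
rewrite (_ : ~` _ = @circle_pi R @` `]b, (a + 2 * pi)[); first exact/open_circle_pi/interval_open.
apply/seteqP; split => c /=.
  have [t /andP[t1 t2] ->] := circle_pi_repr a c.
  move=> nt; exists t => //; rewrite in_itv/= t2 andbT ltNge; apply/negP => tb.
  by apply: nt; exists t; rewrite // in_itv/= t1.
move=> [t + <-] [s]; rewrite !in_itv/= => /andP[t1 t2] /andP[s1 s2] st.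
have := circle_pi_inj _ st; rewrite ltr_norml => h.
have sE : s = t by apply: h; apply/andP; split; lra.
by move: t1; rewrite -sE ltNge s2.
Qed.

Lemma arc_length_open (a b : R) : 0 <= a -> a <= b -> b <= 2 * pi ->
  arc_length (@circle_pi R @` `]a, b[) = b - a.
Proof.
move=> a0 ab b2; rewrite /arc_length (_ : _ `&` _ = `]a, b[%classic).
  rewrite lebesgue_measure_itv/= lte_fin.
  by case: ltgtP ab => // ->; rewrite subrr.
apply/seteqP; split => t /=; rewrite !in_itv/=.
  move=> [[s + st] /andP[t0 t2]]; rewrite in_itv/= => /andP[s1 s2].
  have <- : s = t by apply: circle_pi_inj => //; rewrite ltr_norml; apply/andP; split; lra.
  by rewrite s1.
move=> /andP[t1 t2]; split; last by apply/andP; split; lra.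
by exists t => //; rewrite in_itv/= t1.
Qed.

Lemma arc_length0 : arc_length (set0 : set (circle R)) = 0.
Proof. by rewrite /arc_length preimage_set0 set0I measure0. Qed.

Section Component.
Variables (E I : set (circle R)) (t0 : R).
Hypotheses (t0_bnd : 0 <= t0 < 2 * pi) (t0E : E (circle_pi t0)).
Hypothesis (Icomp : I = set0 \/ exists2 c, (~` E) c & I = connected_component (~` E) c).

Let IE : I `<=` ~` E.
Proof. by case: Icomp => [->//|[c _ ->]]; exact: connected_component_sub. Qed.

Let connI : connected I.
Proof. by case: Icomp => [->|[c _ ->]]; [exact: connected0|exact: component_connected]. Qed.

Let J : set R := [set t | t0 < t < t0 + 2 * pi /\ I (circle_pi t)].

(** A point [z] missing from [J] between two of its points would split the connected set [I] by the
    open arcs on both sides of [z]; these cover [I] because the cut point lies in [E]. *)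
Let J_interval : is_interval J.
Proof.
move=> x y [/andP[x1 x2] Ix] [/andP[y1 y2] Iy] z /andP[xz zy].
have z1 : t0 < z < t0 + 2 * pi by apply/andP; split; lra.
split => //; apply: contrapT => nIz.
have xz' : x < z by rewrite lt_neqAle xz andbT; apply/eqP => xE; apply: nIz; rewrite -xE.
have zy' : z < y by rewrite lt_neqAle zy andbT; apply/eqP => zE; apply: nIz; rewrite zE.
pose O1 := @circle_pi R @` `]t0, z[; pose O2 := @circle_pi R @` `]z, t0 + 2 * pi[.
have oO1 : open O1 by exact/open_circle_pi/interval_open.
have oO2 : open O2 by exact/open_circle_pi/interval_open.
have O12 c : O1 c -> O2 c -> False.
  move=> [s + <-] [t + ]; rewrite /= !in_itv/= => /andP[s1 s2] /andP[t1 t2] ts.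
  have := circle_pi_inj _ ts; rewrite ltr_norml => h.
  have : t = s by apply: h; apply/andP; split; lra.
  by move=> tsE; move: t1; rewrite tsE => /(lt_trans s2); rewrite ltxx.
have cover c : I c -> O1 c \/ O2 c.
  move=> Ic; have [t /andP[t1 t2] cE] := circle_pi_repr t0 c; rewrite cE.
  have t1' : t0 < t.
    by rewrite lt_neqAle t1 andbT; apply/eqP => tE; apply: (IE Ic); rewrite cE -tE.
  have [tz|zt|tz] := ltgtP t z.
  - by left; exists t; rewrite //= in_itv/= t1'.
  - by right; exists t; rewrite //= in_itv/= zt.
  - by case: nIz; rewrite -tz -cE.
have IO1 : I `&` O1 = I.
  apply: connI.
  - by exists (circle_pi x); split => //; exists x; rewrite //= in_itv/= x1.
  - by exists O1.
  - exists (~` O2); first exact: open_closedC.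
    apply/seteqP; split => c [Ic hc]; split => //; first by move=> /(O12 c hc).
    by case: (cover c Ic).
have [_ O1y] : (I `&` O1) (circle_pi y) by rewrite IO1.
by apply: (O12 _ O1y); exists y; rewrite //= in_itv/= zy' y2.
Qed.

(** Once the circle is cut at a point of [E], a component lifts to a single interval of the line.
    The inequality on lengths is what later bounds the measure left outside the gaps by [r_n]. *)
Lemma component_arc : exists a b : R,
  [/\ t0 <= a, a <= b, b <= t0 + 2 * pi,
      forall t, a < t < b -> I (circle_pi t) & arc_length I <= b - a].
Proof.
have /andP[t00 t02] := t0_bnd.
have [J0|J0] := pselect (J !=set0); last first.
  (* A padding term [set0] becomes a degenerate interval. *)
  exists t0, t0; split => //.
  - by rewrite lerDl ltW// twopi_gt0.
  - by move=> t /andP[/lt_trans h /h]; rewrite ltxx.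
  rewrite subrr (_ : I = set0) ?arc_length0//.
  rewrite -subset0 => c Ic; apply: J0.
  have [t /andP[t1 t2] cE] := circle_pi_repr t0 c; exists t; split; last by rewrite -cE.
  rewrite t2 andbT lt_neqAle t1 andbT.
  by apply/eqP => tE; apply: (IE Ic); rewrite cE -tE.
have Jub : ubound J (t0 + 2 * pi) by move=> t [/andP[_ /ltW]].
have Jlb : lbound J t0 by move=> t [/andP[/ltW]].
have supJ : has_sup J by split => //; exists (t0 + 2 * pi).
have infJ : has_inf J by split => //; exists t0.
set a := inf J; set b := sup J.
have Jab t : J t -> a <= t <= b.
  move=> Jt; apply/andP; split; first exact: (ge_inf infJ.2 Jt).
  exact: (ub_le_sup supJ.2 Jt).
have [j Jj] := J0; have /andP[aj jb] := Jab j Jj.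
exists a, b; split.
- exact: lb_le_inf.
- exact: le_trans jb.
- exact: ge_sup.
- move=> t /andP[at_ tb].
  have [x Jx xt] := inf_lt infJ.1 at_; have [y Jy ty] := sup_gt supJ.1 tb.
  by case: (J_interval Jx Jy (z := t)) => //; rewrite (ltW xt) (ltW ty).
rewrite /arc_length; set S := _ `&` _.
(* [arc_length] is computed in [[0, 2 * pi[], where the lifted interval may appear in two pieces,
   the second one being its part beyond [2 * pi] shifted back. *)
pose A1 : set R := J `&` `[0, 2 * pi[; pose A2 : set R := [set t | J (t + 2 * pi)] `&` `[0, 2 * pi[.
have SE : S = A1 `|` A2.
  apply/seteqP; split => t.
    move=> [/= It]; rewrite in_itv/= => t2; have /andP[t3 t4] := t2.
    have [tt0|tt0|tt0] := ltgtP t t0.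
    - right; split => //=; rewrite ?in_itv//; split; first by apply/andP; split; lra.
      by rewrite -[2 * pi]mul1r (circle_pi_shift t 1).
    - left; split => //=; rewrite ?in_itv//; split => //; apply/andP; split; lra.
    - by exfalso; apply: (IE It); rewrite tt0.
  case=> -[/= [_ It] t2]; split => //=.
  by move: It; rewrite -[2 * pi]mul1r (circle_pi_shift t 1).
have mI (B : set R) : is_interval B -> measurable B.
  by move=> /is_intervalP ->; exact: measurable_itv.
have mA1 : measurable A1 by apply: measurableI; [exact: mI|exact: measurable_itv].
have mA2 : measurable A2.
  apply: measurableI; last exact: measurable_itv.
  apply: mI => x y Jx Jy z /andP[xz zy].
  by apply: (J_interval Jx Jy); rewrite !lerD2r xz.
pose i1 : interval R := `[a, Num.min b (2 * pi)]; pose i2 : interval R := `[Num.max a (2 * pi) - 2 * pi, b - 2 * pi].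
have A1i : A1 `<=` [set` i1].
  move=> t [/Jab/andP[t1 t2]]; rewrite /= !in_itv/= => /andP[t3 t4].
  by rewrite t1 le_min t2 ltW.
have A2i : A2 `<=` [set` i2].
  move=> t [/= /Jab/andP[t1 t2]]; rewrite /= !in_itv/= => /andP[t3 t4].
  by rewrite lerBrDr t2 andbT lerBlDr ge_max t1 lerDr.
have len (x y z : R) : y - x <= z -> 0 <= z ->
    (lebesgue_measure [set` `[x, y]%R] <= z%:E)%E.
  move=> xyz z0; rewrite lebesgue_measure_itv/= lte_fin.
  by case: ifP => _; rewrite lee_fin.
have S1 : (lebesgue_measure S <= (b - a)%:E)%E.
  rewrite SE; apply: (@le_trans _ _ (lebesgue_measure A1 + lebesgue_measure A2)%E).
    exact: measureU2.
  have -> : b - a = Num.max 0 (Num.min b (2 * pi) - a) + Num.max 0 (b - Num.max a (2 * pi)).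
    have := le_trans aj jb; have := twopi_gt0.
    by rewrite /Num.max /Num.min; repeat case: ifPn; rewrite -?leNgt; lra.
  rewrite EFinD leeD//.
    apply: (@le_trans _ _ (lebesgue_measure [set` i1])).
      by apply: le_measure; rewrite ?inE//; exact: measurable_itv.
    by apply: len; rewrite le_max lexx ?orbT.
  apply: (@le_trans _ _ (lebesgue_measure [set` i2])).
    by apply: le_measure; rewrite ?inE//; exact: measurable_itv.
  apply: len; rewrite le_max ?lexx//.
  by rewrite opprB addrA subrK lexx orbT.
rewrite -lee_fin fineK// ge0_fin_numE//.
by rewrite (le_lt_trans S1)// ltry.
Qed.

End Component.
End CircleTopology.

(** * Distance to a set and cutoff functions *)

Lemma max0_lip (R : realDomainType) (x y : R) : `|Num.max 0 x - Num.max 0 y| <= `|x - y|.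
Proof.
have h1 := ler_norm (x - y); have h2 := ler_norm (y - x); rewrite distrC in h2.
have h3 := normr_ge0 (x - y).
rewrite ler_norml /Num.max; case: ifPn; case: ifPn; rewrite -?leNgt => hx hy;
  apply/andP; split; lra.
Qed.

Section Distance.
Variables (R : realType) (Z : set R).
Hypothesis Z0 : Z !=set0.

Definition dist (t : R) : R := inf [set `|t - s| | s in Z].

Lemma dist_has_inf t : has_inf [set `|t - s| | s in Z].
Proof.
by split; [have [s Zs] := Z0; exists `|t - s|, s|exists 0 => _ [s _ <-]].
Qed.

Lemma dist_le t s : Z s -> dist t <= `|t - s|.
Proof. by move=> Zs; apply: (ge_inf (dist_has_inf t).2); exists s. Qed.

Lemma dist_ge t d : (forall s, Z s -> d <= `|t - s|) -> d <= dist t.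
Proof.
move=> h; apply: lb_le_inf; first exact: (dist_has_inf t).1.
by move=> _ [s Zs <-]; exact: h.
Qed.

Lemma dist_ge0 t : 0 <= dist t. Proof. exact: dist_ge. Qed.

Lemma dist_lip s t : dist s - dist t <= `|s - t|.
Proof.
rewrite lerBlDr -lerBlDl; apply: dist_ge => r Zr.
by rewrite lerBlDr (le_trans (dist_le s Zr))// [leRHS]addrC ler_distD.
Qed.

Lemma dist_periodic (T : R) : (forall s, Z (s + T) <-> Z s) -> forall t, dist (t + T) = dist t.
Proof.
move=> ZT t; apply/le_anti/andP; split; apply: dist_ge => s Zs.
  by have := dist_le (t + T) ((ZT s).2 Zs); rewrite opprD addrACA subrr addr0.
have Zs' : Z (s - T) by apply/ZT; rewrite subrK.
by rewrite (_ : t + T - s = t - (s - T)) ?dist_le//; ring.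
Qed.

(** A trapezoid: 1 up to distance [d], 0 from distance [2 * d] on. In this nested form the Lipschitz
    bound is [max0_lip] applied twice. *)
Definition cutoff (d t : R) : R := Num.max 0 (1 - Num.max 0 (dist t / d - 1)).

Lemma cutoff_ge0 d t : 0 <= cutoff d t.
Proof. by rewrite /cutoff le_max lexx. Qed.

Lemma cutoff_le1 d t : cutoff d t <= 1.
Proof. by rewrite /cutoff ge_max ler01 gerBl le_max lexx. Qed.

Lemma cutoff_lip d s t : 0 < d -> `|cutoff d s - cutoff d t| <= d^-1 * `|s - t|.
Proof.
move=> d0; have h : `|dist s / d - dist t / d| <= d^-1 * `|s - t|.
  rewrite -mulrBl normrM mulrC [`|d^-1|]gtr0_norm ?invr_gt0// ler_wpM2l ?invr_ge0 ?(ltW d0)//.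
  by rewrite ler_norml lerNl opprB dist_lip andbT distrC dist_lip.
apply: le_trans h; apply: (le_trans (max0_lip _ _)).
rewrite opprB addrA addrAC [1 + _ - 1]addrAC subrr add0r addrC distrC.
by rewrite (le_trans (max0_lip _ _))// opprB addrA subrK.
Qed.

Lemma cutoff_near d t : 0 < d -> dist t <= d -> cutoff d t = 1.
Proof.
move=> d0 h; rewrite /cutoff (_ : Num.max 0 (dist t / d - 1) = 0) ?subr0.
  by apply/max_idPr.
by apply/max_idPl; rewrite subr_le0 ler_pdivrMr// mul1r.
Qed.

Lemma cutoff_far d t : 0 < d -> 2 * d <= dist t -> cutoff d t = 0.
Proof.
move=> d0 h; rewrite /cutoff; apply/max_idPl; rewrite subr_le0 le_max.
by rewrite lerBrDr ler_pdivlMr// h orbT.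
Qed.

End Distance.

(** * Counting grid points in an interval *)

Section Grid.
Variables (R : realType) (t0 : R).

(** The clipped position [psi] goes from [c + step R M] to [d] along the grid, by at most one step
    at a time and only when leaving a grid point of [[c, d]]. Clipping below at [c + step R M]
    rather than [c] keeps the step that enters the interval from contributing. *)
Lemma grid_count (M : nat) (c d : R) : (0 < M)%N -> t0 <= c -> d <= t0 + 2 * pi ->
  d - c - step R M <= step R M * \sum_(x < M) (c <= grid t0 M x <= d)%R%:R.
Proof.
move=> M0 tc dt; have MR : 0 < M%:R :> R by rewrite ltr0n.
have s0 : 0 < step R M by rewrite divr_gt0 ?twopi_gt0.
have [cd|cd] := leP d (c + step R M).
  rewrite (@le_trans _ _ 0)//; first lra.
  by rewrite mulr_ge0 ?(ltW s0)// sumr_ge0.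
pose psi (t : R) := Num.max (c + step R M) (Num.min t d).
have gM : grid t0 M M = t0 + 2 * pi.
  by rewrite /grid /step mulrC divfK// gt_eqF.
have g0 : grid t0 M 0 = t0 by rewrite /grid mul0r addr0.
have gS x : grid t0 M x.+1 = grid t0 M x + step R M.
  by rewrite /grid -natr1 mulrDl mul1r addrA.
have -> : d - c - step R M = psi (grid t0 M M) - psi (grid t0 M 0).
  rewrite /psi gM g0 (min_idPr _)// (max_idPr (ltW cd)) (max_idPl _); first ring.
  by rewrite ge_min (_ : t0 <= _)//; lra.
rewrite -(telescope_sumr (fun x => psi (grid t0 M x)))// big_mkord mulr_sumr.
apply: ler_sum => x _; rewrite gS; move: (grid t0 M x) => g.
have [/andP[cg gd]|] := boolP (c <= g <= d).
  rewrite mulr1 /psi /Num.max /Num.min.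
  by repeat case: ifPn; rewrite -?leNgt; lra.
rewrite mulr0 negb_and -!ltNge => h.
by move: h; rewrite /psi /Num.max /Num.min => /orP[h|h]; repeat case: ifPn; rewrite -?leNgt; lra.
Qed.

End Grid.

(** * Mass and energy of the cutoff around a set with given gaps *)

Section Gaps.
Variables (R : realType) (t0 : R) (Z : set R) (a b : nat -> R) (n : nat) (d : R).
Hypotheses (Z0 : Z !=set0) (Zper : forall s, Z (s + 2 * pi) <-> Z s) (d0 : 0 < d).
Hypotheses (t0a : forall k, t0 <= a k) (bt0 : forall k, b k <= t0 + 2 * pi).
Hypothesis abZ : forall k t, a k < t < b k -> ~ Z t.
Hypothesis ab_disj : forall j k t, a j < t < b j -> a k < t < b k -> j = k.

(** Of the margin [3 * d], [2 * d] is the reach of the cutoff and [d] leaves room for one grid step.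
    Middles of distinct gaps are disjoint, so [bad] is the indicator of what they leave, and [T]
    bounds its normalised measure, losing [6 * d] per gap. *)
Let good k (t : R) := (a k + 3 * d <= t <= b k - 3 * d).
Let bad (t : R) : R := 1 - \sum_(k < n.+1) (good k t)%:R.
Let T : R := (2 * pi - \sum_(k < n.+1) (b k - a k) + 6 * n.+1%:R * d) / (2 * pi).
Let phi (t : R) : R[i] := (cutoff Z d t)%:C%C.

Let good_in k t : good k t -> a k < t < b k.
Proof. by move: d0 => d0' /andP[h1 h2]; apply/andP; split; lra. Qed.

Let dist_good k t : a k + 2 * d <= t <= b k - 2 * d -> 2 * d <= dist Z t.
Proof.
have dpos := d0; move=> /andP[h1 h2]; apply: (dist_ge Z0) => s Zs.
have [sa|sa] := leP s (a k); first by rewrite ger0_norm; lra.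
have [bs|bs] := leP (b k) s; first by rewrite ler0_norm; lra.
by case: (@abZ k s) => //; rewrite sa.
Qed.

Let bad_ge t (x : R) : 0 <= x <= 1 -> (forall k, good k t -> x = 0) -> x <= bad t.
Proof.
move=> /andP[x0 x1] h; have [[k gk]|ng] := pselect (exists k : 'I_n.+1, good k t).
  rewrite (h k gk) /bad (bigD1 k)//= gk big1 ?addr0 ?subrr// => j jk.
  have [gj|//] := boolP (good j t); case/eqP: jk; apply: val_inj.
  exact: (ab_disj (good_in gj) (good_in gk)).
rewrite /bad big1 ?subr0// => k _.
by have [gk|//] := boolP (good k t); case: ng; exists k.
Qed.

Let avgR_bad M : (0 < M)%N -> avgR t0 M bad <= T + n.+1%:R / M%:R.
Proof.
move=> M0; have MR : 0 < M%:R :> R by rewrite ltr0n.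
have p0 := twopi_gt0 R.
rewrite /avgR /bad sumrB sumr_const card_ord mulrBr mulVf ?gt_eqF//.
rewrite exchange_big /= mulr_sumr lerBlDr -lerBlDl.
have -> : 1 - (T + n.+1%:R / M%:R) =
    \sum_(k < n.+1) ((b k - 3 * d) - (a k + 3 * d) - step R M) / (2 * pi).
  rewrite -mulr_suml sumrB sumr_const card_ord.
  rewrite (eq_bigr (fun k : 'I_n.+1 => (b k - a k) - 6 * d)); last by move=> k _; ring.
  rewrite sumrB sumr_const card_ord -(mulr_natl (step R M)) -(mulr_natl (6 * d)) /T /step.
  by move: (2 * pi) p0 => P P0; field; rewrite !gt_eqF.
apply: ler_sum => k _; rewrite ler_pdivrMr//.
have := @grid_count R t0 M (a k + 3 * d) (b k - 3 * d) M0.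
have -> : t0 <= a k + 3 * d by rewrite (le_trans (t0a k))// lerDl mulr_ge0// ltW.
have -> : b k - 3 * d <= t0 + 2 * pi.
  by rewrite (le_trans _ (bt0 k))// gerBl mulr_ge0// ltW.
move=> /(_ isT isT) /le_trans; apply.
by rewrite le_eqVlt; apply/orP; left; apply/eqP; rewrite /step; ring.
Qed.

Let bphi : bounded phi.
Proof. by exists 1 => t; rewrite normc_real ger0_norm ?cutoff_ge0// cutoff_le1. Qed.

Lemma cutoff_per t : cutoff Z d (t + 2 * pi) = cutoff Z d t.
Proof. by rewrite /cutoff dist_periodic. Qed.

Let nearM (e : R) : 0 < e -> \forall M \near \oo, n.+1%:R / M%:R <= e.
Proof.
move=> e0; near=> M.
have M0 : (0 < M)%N by near: M; exists 1%N.
rewrite ler_pdivrMr ?ltr0n// -ler_pdivrMl//.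
by near: M; exact: nbhs_infty_ger.
Unshelve. all: by end_near. Qed.

Lemma gap_bessel X : uniq X -> \sum_(k <- X) normc (coef t0 phi k) ^+ 2 <= T.
Proof.
move=> uX; apply: bessel => // e e0; near=> M.
have M0 : (0 < M)%N by near: M; exists 1%N.
apply: (@le_trans _ _ (avgR t0 M bad)).
  apply: le_avgR => t; apply: bad_ge.
    rewrite normc_real ger0_norm ?cutoff_ge0// exprn_ge0 ?cutoff_ge0//.
    by rewrite exprn_ile1 ?cutoff_ge0 ?cutoff_le1.
  move=> k gk; rewrite normc_real cutoff_far ?normr0 ?expr0n//.
  by apply: (@dist_good k); move: d0 gk => ? /andP[? ?]; apply/andP; split; lra.
rewrite (le_trans (avgR_bad M0))// lerD2l; near: M; exact: nearM.
Unshelve. all: by end_near. Qed.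

(** A one-step difference of the cutoff is at most the step over [d], and it vanishes in the middle
    of a gap, where both ends of the step are at distance at least [2 * d] from [Z]. *)
Lemma gap_diff_bessel X : uniq X ->
  \sum_(k <- X) `|k|%:~R ^+ 2 * normc (coef t0 phi k) ^+ 2 <= 4 * (T / d ^+ 2).
Proof.
move=> uX; apply: diff_bessel => // [|e e0]; first by rewrite /phi cutoff_per.
have ed0 : 0 < e * d ^+ 2 by rewrite mulr_gt0// exprn_gt0.
near=> M.
have M0 : (0 < M)%N by near: M; exists 1%N.
have MR : 0 < M%:R :> R by rewrite ltr0n.
have s0 : 0 < step R M by rewrite divr_gt0 ?twopi_gt0.
have sd : step R M <= d.
  rewrite /step ler_pdivrMr// -ler_pdivrMl//.
  by near: M; exact: nbhs_infty_ger.
apply: (@le_trans _ _ ((step R M / d) ^+ 2 * avgR t0 M bad)).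
  rewrite /avgR mulrCA ler_wpM2l ?invr_ge0// mulr_sumr ler_sum// => x _.
  move: (grid t0 M x) => t.
  have sd1 : 0 < step R M / d by rewrite divr_gt0.
  have sd2 : 0 < (step R M / d) ^+ 2 by rewrite exprn_gt0.
  rewrite -(ler_pdivrMl _ _ sd2) -exprVn -exprMn.
  have hE : normc (avg_diff M phi t) = `|cutoff Z d (t + step R M) - cutoff Z d t|.
    by rewrite /avg_diff /phi -rmorphB normc_real.
  have h1 : (step R M / d)^-1 * normc (avg_diff M phi t) <= 1.
    rewrite (ler_pdivrMl _ _ sd1) mulr1 hE (le_trans (cutoff_lip Z0 _ _ d0))//.
    by rewrite addrAC subrr add0r gtr0_norm// mulrC.
  have h0 : 0 <= (step R M / d)^-1 * normc (avg_diff M phi t).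
    by rewrite mulr_ge0 ?normc_ge0// invr_ge0 ltW// divr_gt0.
  apply: bad_ge; first by rewrite exprn_ge0// exprn_ile1.
  move=> k gk; rewrite hE !cutoff_far ?subrr ?normr0 ?mulr0 ?expr0n//.
    by apply: (@dist_good k); move: d0 gk => ? /andP[? ?]; apply/andP; split; lra.
  by apply: (@dist_good k); move: d0 gk => ? /andP[? ?]; apply/andP; split; lra.
apply: (@le_trans _ _ ((step R M / d) ^+ 2 * (T + e * d ^+ 2))).
  rewrite ler_wpM2l ?sqr_ge0// (le_trans (avgR_bad M0))// lerD2l.
  by near: M; exact: nearM.
rewrite le_eqVlt; apply/orP; left; apply/eqP; rewrite exprMn exprVn.
by field; rewrite gt_eqF.
Unshelve. all: by end_near. Qed.

End Gaps.

(** * From mass and energy to the weighted l^p norm *)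

Section LpOfSobolev.
Variables (R : realType) (p beta : R).
Hypotheses (p_gt1 : 1 < p) (p_lt2 : p < 2) (beta_ge0 : 0 <= beta) (pbeta : p * beta < p - 1).

(** Hoelder's inequality with exponents [2 / p] and [r] separates [(|c n| (1 + |n| d))^p],
    controlled by mass and energy at frequency scale [1 / d], from the weight over [(1 + |n| d)^p].
    As [1 + |n| <= (1 + |n| d) / d], the second factor reduces to a power sum of exponent [- kap],
    and [kap > 1] follows from the bound on [p * beta]. *)
Lemma lp_le_sobolev : exists2 C : R, 0 < C & forall (c : int -> R[i]) (T d : R),
  0 < T -> 0 < d <= 1 ->
  sum_le (fun n => normc (c n) ^+ 2) T ->
  sum_le (fun n => `|n|%:~R ^+ 2 * normc (c n) ^+ 2) (4 * (T / d ^+ 2)) ->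
  lp_le p beta c (C * (T `^ (p / 2) * d `^ (p / 2 - 1 - p * beta))).
Proof.
have p0 : 0 < p by exact: lt_trans p_gt1.
have p2 : 0 < 2 - p by rewrite subr_gt0.
pose r := 2 / (2 - p).
have r0 : 0 < r by rewrite divr_gt0.
pose kap := p * r * (1 - beta).
have k1 : 1 < kap.
  rewrite /kap /r mulrA mulrAC ltr_pdivlMr// mul1r.
  by have := pbeta; have := p_gt1; lra.
pose K := 2 * (1 + (kap - 1)^-1).
have K0 : 0 < K by rewrite mulr_gt0// ltr_pwDl// invr_ge0 subr_ge0 ltW.
exists (10 `^ (p / 2) * K `^ r^-1); first by rewrite mulr_gt0// powR_gt0.
move=> c T d T0 /andP[d0 d1] cT dcT X uX.
have base (n : int) : 1 <= 1 + `|n|%:~R * d :> R by rewrite lerDl mulr_ge0 ?ler0z// ltW.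
have base0 (n : int) : 0 < 1 + `|n|%:~R * d :> R by rewrite (lt_le_trans _ (base n)).
pose F (n : int) := (normc (c n) * (1 + `|n|%:~R * d)) `^ p.
pose G (n : int) := weight (p * beta) n / (1 + `|n|%:~R * d) `^ p.
rewrite (eq_bigr (fun n => F n * G n)); last first.
  move=> n _; rewrite /F /G powRM ?normc_ge0 ?(ltW (base0 n))//.
  by field; rewrite gt_eqF// powR_gt0.
have T10 : 0 < 10 * T by rewrite mulr_gt0.
have B0 : 0 < d `^ (- (p * beta * r)) * (K / d) by rewrite mulr_gt0 ?powR_gt0// divr_gt0.
have -> : 10 `^ (p / 2) * K `^ r^-1 * (T `^ (p / 2) * d `^ (p / 2 - 1 - p * beta)) =
   (10 * T) `^ (2 / p)^-1 * (d `^ (- (p * beta * r)) * (K / d)) `^ r^-1.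
  have -> : (10 * T) `^ (2 / p)^-1 = 10 `^ (p / 2) * T `^ (p / 2).
    by rewrite invf_div powRM ?(ltW T0).
  have -> : (d `^ (- (p * beta * r)) * (K / d)) `^ r^-1 =
      d `^ (- (p * beta * r) / r) * (K `^ r^-1 * d `^ (-1 / r)).
    rewrite powRM ?powR_ge0 ?divr_ge0 ?(ltW d0) ?(ltW K0)// -powRrM.
    rewrite powRM ?invr_ge0 ?(ltW d0) ?(ltW K0)//.
    by rewrite -[d^-1]powR_inv1 ?(ltW d0)// -powRrM.
  have -> : d `^ (p / 2 - 1 - p * beta) = d `^ (- (p * beta * r) / r) * d `^ (-1 / r).
    rewrite -powRD ?(gt_eqF d0) ?implybT//; congr powR.
    by rewrite /r; field; rewrite gt_eqF.
  by ring.
apply: hoelder_sum => //.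
- by rewrite divr_gt0.
- by rewrite invf_div /r invf_div; field.
- by move=> n; rewrite powR_ge0.
- by move=> n; rewrite divr_ge0 ?weight_ge0 ?powR_ge0.
(* The 10 is [2 (1 + 4)]: the 2 comes from [(1 + x)^2 <= 2 (1 + x^2)], the 4 from the energy
   bound. *)
- have -> : 10 * T = 2 * (T + d ^+ 2 * (4 * (T / d ^+ 2))).
    by field; rewrite gt_eqF.
  rewrite (@le_trans _ _ (\sum_(n <- X) 2 * (normc (c n) ^+ 2 +
      d ^+ 2 * (`|n|%:~R ^+ 2 * normc (c n) ^+ 2))))//.
    apply: ler_sum => n _; rewrite /F -powRrM mulrCA divff ?gt_eqF// mulr1.
    rewrite powR_mulrn ?mulr_ge0 ?normc_ge0 ?(ltW (base0 n))// exprMn.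
    have := sqr_ge0 (1 - `|n|%:~R * d); have := sqr_ge0 (normc (c n)).
    by set y := normc _ ^+ 2; set z : R := `|n|%:~R; move=> y0 z0; nra.
  rewrite -mulr_sumr ler_wpM2l// big_split -mulr_sumr lerD ?cT//.
  by rewrite ler_wpM2l ?sqr_ge0// dcT.
- rewrite (@le_trans _ _ (\sum_(n <- X) d `^ (- (p * beta * r)) *
     (1 + `|n|%:~R * d) `^ (- kap)))//; last first.
    rewrite -mulr_sumr ler_wpM2l ?powR_ge0//.
    apply: le_trans (sum_le_powR k1 d0 uX) _.
    rewrite /K -mulrA ler_wpM2l// mulrDl mul1r invfM [d^-1 * _]mulrC lerD2r.
    by rewrite -[leLHS]invr1 lef_pV2 ?posrE.
  apply: ler_sum => n _; rewrite /G /weight.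
  have n1 := base_gt0 R n.
  rewrite powRM ?powR_ge0 ?invr_ge0 ?powR_ge0// -powRN -!powRrM.
  have -> : (1 + `|n|%:~R * d) `^ (- kap) =
      (1 + `|n|%:~R * d) `^ (p * beta * r) * (1 + `|n|%:~R * d) `^ (- p * r).
    rewrite -powRD ?(gt_eqF (base0 n)) ?implybT//; congr powR.
    by rewrite /kap; ring.
  rewrite mulrA ler_wpM2r ?powR_ge0// powRN -ler_pdivrMl ?invr_gt0 ?powR_gt0// invrK.
  have ns : 0 <= p * beta * r by apply: mulr_ge0 (ltW r0); apply: mulr_ge0 beta_ge0; exact: ltW.
  have nd : 0 <= d * (1 + `|n|%:~R) by exact: mulr_ge0 (ltW d0) (ltW n1).
  rewrite -powRM ?(ltW d0) ?(ltW n1)// ge0_ler_powR ?nnegrE ?(ltW (base0 n))//.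
  by rewrite mulrDr mulr1 mulrC lerD2r.
Qed.

End LpOfSobolev.

(** * Cyclicity from the strong measure hypothesis *)

Section PartOne.
Variable R : realType.

Lemma unif_continuous_continuous (h : R -> R) :
  (forall e : R, 0 < e -> exists2 d : R, 0 < d & forall s t, `|s - t| <= d -> `|h s - h t| <= e) ->
  continuous h.
Proof.
move=> hu t; apply/cvgrPdist_le => e e0; have [d d0 hd] := hu e e0.
apply: filterS (nbhsx_ballx t d d0) => s /= ts; apply: hd.
by move: ts; rewrite -ball_normE /= => /ltW.
Qed.

Lemma periodic_lower_bound (h : R -> R) : continuous h ->
  (forall t (k : int), h (t + k%:~R * (2 * pi)) = h t) -> (forall t, 0 < h t) ->
  exists2 c : R, 0 < c & forall t, c <= h t.
Proof.
move=> hc hper h0.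
have [|c _ hmin] := @EVT_min R h 0 (2 * pi) (ltW (twopi_gt0 R)).
  exact: continuous_subspaceT.
exists (h c) => // t.
have [s /andP[s0 s1] /circle_piP[k tE]] := circle_pi_repr 0 (circle_pi t).
have -> : h t = h s by rewrite tE hper.
by apply: hmin; rewrite in_itv/= s0/= ltW//; move: s1; rewrite add0r.
Qed.

Lemma coef1 (t0 : R) n : coef t0 (fun=> 1) n = delta0 R n.
Proof.
rewrite /delta0 -(eq_sym 0) -(coef_expn t0 0 n); congr coef.
by apply/funext => t; rewrite expn0.
Qed.

Section Cyclic.
Variables (p beta : R) (u : int -> R[i]) (U : R -> R[i]) (A : R).
Hypotheses (p_gt1 : 1 < p) (p_lt2 : p < 2) (beta_ge0 : 0 <= beta) (pbeta : p * beta < p - 1).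
Hypotheses (uA : l1_le beta u A) (uU : usum u U).

Let Z : set R := [set t | U t = 0].

(** From [p beta < p - 1 < p / 2]; this is the range in which Lipschitz functions have coefficients
    in l^1_beta. *)
Let beta_lt : 0 <= beta < 2^-1.
Proof.
rewrite beta_ge0 /=; have := pbeta; have := p_gt1; have := p_lt2; have := beta_ge0.
by move=> b0 p2 p1 pb; nra.
Qed.

Let p_ge1 : 1 <= p. Proof. exact: ltW. Qed.

Let U_cont : continuous (fun t => normc (U t)).
Proof.
apply: unif_continuous_continuous => e e0; have [d d0 hd] := usum_unif_continuous uU e0.
exists d => // s t st; apply: le_trans (hd s t st).
rewrite ler_norml normcB_ge andbT lerNl opprB.
by rewrite normcB normcB_ge.
Qed.

Let U_per t (k : int) : U (t + k%:~R * (2 * pi)) = U t.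
Proof. exact: (usum_periodic k t uU). Qed.

Lemma cyclic_no_zero : ~ (Z !=set0) -> translate_closure p beta u (delta0 R).
Proof.
move=> nZ; rewrite (_ : delta0 R = coef 0 (fun=> 1)); last first.
  by apply/funext => n; rewrite coef1.
have [||c c0 hc] := @periodic_lower_bound (fun t => normc (U t)) U_cont.
- by move=> t k; rewrite U_per.
- by move=> t; rewrite normc_gt0; apply/eqP => Ut; apply: nZ; exists t.
apply: (@translate_closure_wiener R 0 beta p u U A beta_lt p_ge1 uA uU _ 0 c) => //.
- by move=> t; rewrite normc1.
- by move=> s t; rewrite subrr normc0 mul0r.
Qed.

(** [|U|] plus a tent around its zeros is continuous, periodic and positive, hence at least some
    [c > 0]. Where [1 - cutoff] is nonzero the tent vanishes, so [c] bounds [|U|] itself, as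
    Newman's expansion requires. *)
Lemma cutoff_closure (t0 d : R) : Z t0 -> 0 < d ->
  translate_closure p beta u (coef t0 (fun t => (1 - cutoff Z d t)%:C%C)).
Proof.
move=> Zt0 d0.
have Z0 : Z !=set0 by exists t0.
have Zper (k : int) s : Z (s + k%:~R * (2 * pi)) <-> Z s by rewrite /Z /= U_per.
have cper t (k : int) : dist Z (t + k%:~R * (2 * pi)) = dist Z t.
  exact: dist_periodic.
pose h (t : R) : R := normc (U t) + Num.max 0 (1 - dist Z t / d).
have [|||c c0 hc] := @periodic_lower_bound h.
- apply: unif_continuous_continuous => e e0.
  have e2 : 0 < e / 2 by rewrite divr_gt0.
  have [d1 d10 hd] := usum_unif_continuous uU e2.
  exists (Num.min d1 (d * (e / 2))); first by rewrite lt_min d10 mulr_gt0.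
  move=> s t; rewrite le_min => /andP[st1 st2].
  rewrite /h opprD addrACA (le_trans (ler_normD _ _))// [e]splitr lerD//.
    apply: le_trans (hd s t st1).
    by rewrite ler_norml normcB_ge andbT lerNl opprB normcB normcB_ge.
  rewrite (le_trans (max0_lip _ _))//.
  rewrite (_ : _ - _ = (dist Z t - dist Z s) / d); last by ring.
  rewrite normrM [`|d^-1|]gtr0_norm ?invr_gt0// ler_pdivrMr// mulrC.
  rewrite (le_trans _ st2)// ler_norml lerNl opprB dist_lip//=.
  by rewrite distrC dist_lip.
- by move=> t k; rewrite /h U_per cper.
- move=> t; rewrite /h; have [Ut|Ut] := eqVneq (U t) 0.
    have -> : dist Z t = 0.
      by apply/le_anti; rewrite dist_ge0// andbT (le_trans (dist_le Z0 t Ut))// subrr normr0.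
    by rewrite mul0r subr0 ltr_wpDl ?normc_ge0// lt_max ltr01 orbT.
  by rewrite ltr_pwDl ?normc_gt0// le_max lexx.
apply: (@translate_closure_wiener R t0 beta p u U A beta_lt p_ge1 uA uU _ d^-1 c) => //.
- by rewrite invr_ge0 ltW.
- by move=> t; rewrite normc_real ger0_norm ?subr_ge0 ?cutoff_le1// gerBl cutoff_ge0.
- move=> s t; rewrite -rmorphB normc_real distrC.
  rewrite (_ : _ - _ = cutoff Z d s - cutoff Z d t); last by ring.
  exact: cutoff_lip.
- by congr (_%:C%C); rewrite /cutoff -[2 * pi]mul1r (cper t0 1).
move=> t ft; have := hc t; rewrite /h (_ : Num.max _ _ = 0) ?addr0//.
apply/max_idPl; rewrite subr_le0 ler_pdivlMr// mul1r ltW// ltNge; apply/negP => td.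
by move: ft; rewrite cutoff_near// subrr eqxx.
Qed.

End Cyclic.

Theorem strong_measure0_cyclic (p q beta alpha : R) (u : int -> R[i]) :
  1 < p -> p < 2 -> q = p / (p - 1) -> 0 <= beta -> beta * q < 1 ->
  alpha = 2 / q * (1 - beta * q) ->
  lpw 1 beta u -> strong_measure0 alpha (zero_set u) -> cyclic p beta u.
Proof.
move=> p1 p2 qE b0 bq alphaE lu [I [Icomp Icover Idisj _] Ilim].
have p0 : 0 < p by exact: lt_trans p1.
have pm0 : 0 < p - 1 by rewrite subr_gt0.
have pbeta : p * beta < p - 1.
  by move: bq; rewrite qE mulrA ltr_pdivrMr// mul1r mulrC.
have alphap : alpha * p = 2 * (p - 1 - p * beta).
  by rewrite alphaE qE; field; rewrite !gt_eqF.
have a0 : 0 < alpha by rewrite -(pmulr_lgt0 _ p0) alphap mulr_gt0// subr_gt0.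
have a1 : alpha < 1.
  by rewrite -(ltr_pM2r p0) alphap mul1r; have := mulr_ge0 (ltW p0) b0; lra.
have [A uA] := (lpw1P beta u).1 lu.
have [U uU] := abs_usum (l1_le_abs b0 uA).
apply: cyclic_of_delta0 => //; [exact: ltW|exact: lpw1_sub (ltW p1) _ lu|].
pose Z : set R := [set t | U t = 0].
have ZE t : zero_set u (circle_pi t) <-> Z t by rewrite /zero_set /= (usum_fourier t uU).
have [[s0 Zs0]|nZ] := pselect (Z !=set0); last exact: (cyclic_no_zero p1 p2 b0 pbeta uA uU).
have [t0 /andP[t00 t02] s0E] := circle_pi_repr 0 (circle_pi s0).
rewrite add0r in t02.
have Et0 : zero_set u (circle_pi t0) by rewrite -s0E; exact/ZE.
have Zt0 : Z t0 by exact/ZE.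
have t0b : 0 <= t0 < 2 * pi by rewrite t00.
have /choice[ab abP] : forall k, exists ab : R * R,
  [/\ t0 <= ab.1, ab.1 <= ab.2, ab.2 <= t0 + 2 * pi,
      forall t, ab.1 < t < ab.2 -> I k (circle_pi t) & arc_length (I k) <= ab.2 - ab.1].
  move=> k; have [a [b h]] := component_arc t0b Et0 (Icomp k).
  by exists (a, b).
have IE k c : I k c -> ~ zero_set u c.
  case: (Icomp k) => [->//|[x _ ->]]; exact: connected_component_sub.
have abZ k t : (ab k).1 < t < (ab k).2 -> ~ Z t.
  by case: (abP k) => _ _ _ h _ /h /IE h1 /ZE.
have abd j k t : (ab j).1 < t < (ab j).2 -> (ab k).1 < t < (ab k).2 -> j = k.
  case: (abP j) => _ _ _ hj _ /hj Ij; case: (abP k) => _ _ _ hk _ /hk Ik.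
  apply: Idisj; last by exists (circle_pi t).
  have comp l : I l (circle_pi t) -> I l = connected_component (~` zero_set u) (circle_pi t).
    case: (Icomp l) => [->//|[x _ ->]]; exact: same_connected_component.
  by rewrite (comp j Ij) (comp k Ik).
have [C C0 CP] := lp_le_sobolev p1 p2 b0 pbeta.
apply: translate_closure_lim => //; first exact: ltW.
move=> e e0.
(* [a'] is [alpha * p / 2], the power of [r_n n^(1 / alpha - 1)] in the p-th power of the norm. [D]
   gathers the constants of the final estimate, and [e1] makes [D e1^a'] at most [e]. *)
set a' := p - 1 - p * beta.
have a'0 : 0 < a' by rewrite subr_gt0.
pose D := C * 2 `^ (p / 2) * 2 `^ (p / 2 - a').
have D0 : 0 < D by rewrite !mulr_gt0 ?powR_gt0.
pose e1 := Num.min 1 ((e / D) `^ a'^-1).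
have e10 : 0 < e1 by rewrite lt_min ltr01 powR_gt0// divr_gt0.
have e1D : e1 `^ a' <= e / D.
  rewrite -[leRHS]powRr1 ?divr_ge0 ?(ltW e0) ?(ltW D0)// -(mulVf (lt0r_neq0 a'0)) powRrM.
  by rewrite ge0_ler_powR ?nnegrE ?powR_ge0 ?(ltW a'0) ?(ltW e10)// ge_min lexx orbT.
have [n [n0 nP]] : exists n : nat, (0 < n)%N /\ (2 * pi - \sum_(k < n.+1) arc_length (I k)) * n%:R `^ (alpha^-1 - 1) <= e1.
  have /cvgrPdist_le/(_ e1 e10) h := Ilim.
  near \oo => n; exists n; split; first by near: n; exists 1%N.
  rewrite (le_trans (ler_norm _))// -normrN -sub0r; near: n; exact: h.
have nR : 0 < n%:R :> R by rewrite ltr0n.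
have n1R : 1 <= n%:R :> R by rewrite ler1n.
have expo : 0 <= alpha^-1 - 1 by rewrite subr_ge0 -[leLHS]invr1 lef_pV2 ?posrE// ltW.
(* An upper bound for [r_n] that stays positive when [r_n] is 0, so that the width [d] can be
   derived from it. *)
pose rho := e1 * n%:R `^ (- (alpha^-1 - 1)).
have rho0 : 0 < rho by rewrite mulr_gt0// powR_gt0.
have rho1 : rho <= 1.
  rewrite -[leRHS]mul1r ler_pM ?powR_ge0 ?(ltW e10)//; first by rewrite ge_min lexx.
  by rewrite -[leRHS](powRr0 n%:R) ler_powR// oppr_le0.
(* With this width the margins of the [n + 1] gaps cost [6 * rho] in total, comparable with the
   bound [rho] for [r_n]. *)
pose d := rho / n.+1%:R.
have d0 : 0 < d by rewrite divr_gt0.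
have d1 : d <= 1 by rewrite ler_pdivrMr// mul1r (le_trans rho1)// ler1n.
have rP : 2 * pi - \sum_(k < n.+1) arc_length (I k) <= rho.
  by rewrite /rho powRN ler_pdivlMr ?powR_gt0.
exists (coef t0 (fun t => (1 - cutoff Z d t)%:C%C)).
  exact: (cutoff_closure p1 p2 b0 pbeta uA uU).
have Z0 : Z !=set0 by exists t0.
have Zper s : Z (s + 2 * pi) <-> Z s.
  by rewrite /Z /= -[2 * pi]mul1r (usum_periodic 1 s uU).
have t0a k : t0 <= (ab k).1 by case: (abP k).
have bt0 k : (ab k).2 <= t0 + 2 * pi by case: (abP k).
set T := (2 * pi - \sum_(k < n.+1) ((ab k).2 - (ab k).1) + 6 * n.+1%:R * d) / (2 * pi).
(* The gaps leave at most [rho] and the margins add [6 * rho]; dividing by [2 * pi >= 4] gives less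
   than [2 * rho]. *)
have Trho : T <= 2 * rho.
  rewrite ler_pdivrMr ?twopi_gt0//.
  have -> : 6 * n.+1%:R * d = 6 * rho by rewrite /d; field; rewrite gt_eqF.
  have : \sum_(k < n.+1) arc_length (I k) <= \sum_(k < n.+1) ((ab k).2 - (ab k).1).
    by apply: ler_sum => k _; case: (abP k).
  by have := rP; have := @pi_ge2 R; have := rho0; nra.
pose c := coef t0 (fun t => (cutoff Z d t)%:C%C).
have h0 : sum_le (fun k => normc (c k) ^+ 2) (2 * rho).
  move=> X uX; apply: le_trans Trho.
  exact: (@gap_bessel R t0 Z (fun k => (ab k).1) (fun k => (ab k).2) n d Z0 d0 t0a bt0 abZ abd).
have h1 : sum_le (fun k => `|k|%:~R ^+ 2 * normc (c k) ^+ 2) (4 * (2 * rho / d ^+ 2)).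
  move=> X uX.
  apply: (@le_trans _ _ (4 * (T / d ^+ 2))).
    exact: (@gap_diff_bessel R t0 Z (fun k => (ab k).1) (fun k => (ab k).2) n d Z0 Zper d0 t0a bt0 abZ abd).
  by rewrite ler_wpM2l// ler_wpM2r ?invr_ge0 ?exprn_ge0// ltW.
have rho2 : 0 < 2 * rho by rewrite mulr_gt0.
have d01 : 0 < d <= 1 by rewrite d0.
have := CP c (2 * rho) d rho2 d01 h0 h1.
have -> : c = fun k => delta0 R k - coef t0 (fun t => (1 - cutoff Z d t)%:C%C) k.
  apply/funext => k; rewrite -(coef1 t0).
  have bc : bounded (fun t => (cutoff Z d t)%:C%C).
    by exists 1 => t; rewrite normc_real ger0_norm ?cutoff_ge0// cutoff_le1.
  have -> : (fun t => (1 - cutoff Z d t)%:C%C) = fun t => 1 + (-1) * (cutoff Z d t)%:C%C.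
    by apply/funext => t; rewrite rmorphB mulN1r.
  rewrite coefD; [|exact: bounded_cst|exact: boundedM (bounded_cst _) bc].
  by rewrite coefZ// mulN1r opprD opprK addrA subrr add0r.
apply: sum_le_trans.
have n1p : 0 < n.+1%:R :> R by [].
have pa : (alpha^-1 - 1) * a' = p / 2 - a'.
  have -> : a' = alpha * p / 2 by rewrite alphap /a'; field.
  by field; rewrite gt_eqF.
have dE : d `^ (p / 2 - 1 - p * beta) = rho `^ (a' - p / 2) * n.+1%:R `^ (p / 2 - a').
  rewrite (_ : p / 2 - 1 - p * beta = a' - p / 2); last by rewrite /a'; field.
  rewrite /d powRM ?(ltW rho0) ?invr_ge0//; congr (_ * _).
  by rewrite -[_^-1]powR_inv1// -powRrM; congr powR; ring.
rewrite dE powRM ?(ltW rho0)//.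
have -> : C * (2 `^ (p / 2) * rho `^ (p / 2) * (rho `^ (a' - p / 2) * n.+1%:R `^ (p / 2 - a'))) =
    C * 2 `^ (p / 2) * (rho `^ a' * n.+1%:R `^ (p / 2 - a')).
  have -> : rho `^ a' = rho `^ (p / 2) * rho `^ (a' - p / 2).
    by rewrite -powRD ?(gt_eqF rho0) ?implybT//; congr powR; ring.
  by ring.
have rE : rho `^ a' = e1 `^ a' * n%:R `^ (- (p / 2 - a')).
  by rewrite /rho powRM ?powR_ge0 ?(ltW e10)// -powRrM mulNr pa.
(* By [pa] the powers of [n] in [rho] and [d] are opposite; only the ratio of [n + 1] to [n]
   survives, at most 2 since [n] is positive. *)
have nn : n%:R `^ (- (p / 2 - a')) * n.+1%:R `^ (p / 2 - a') <= 2 `^ (p / 2 - a').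
  rewrite powRN mulrC ler_pdivrMr ?powR_gt0// -powRM//.
  rewrite ge0_ler_powR ?nnegrE ?mulr_ge0// -?pa ?mulr_ge0 ?(ltW a'0)//.
  by rewrite -natrM ler_nat mul2n -addnn -addn1 leq_add2l.
rewrite rE -[e1 `^ a' * _ * _]mulrA.
apply: (@le_trans _ _ (C * 2 `^ (p / 2) * (e / D * 2 `^ (p / 2 - a')))).
  rewrite ler_wpM2l ?mulr_ge0 ?powR_ge0 ?(ltW C0)//.
  by apply: ler_pM; rewrite ?powR_ge0 ?mulr_ge0 ?powR_ge0.
rewrite le_eqVlt; apply/orP; left; apply/eqP.
by rewrite /D; field; rewrite !gt_eqF ?powR_gt0.
Unshelve. all: by end_near. Qed.

End PartOne.

(** * The Fourier transform of a segment *)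

Section Kernel.
Variable R : realType.
Implicit Types x y : R.

(* The Fourier transform of the uniform probability measure on [0, 1]. *)
Definition kap x : R[i] := if x == 0 then 1 else (expi x - 1) / (0 +i* x)%C.

Lemma normc_imag x : normc (0 +i* x)%C = `|x|.
Proof. by rewrite /normc expr0n/= add0r sqrtr_sqr. Qed.

Lemma imag_neq0 x : x != 0 -> (0 +i* x)%C != 0 :> R[i].
Proof. by move=> x0; rewrite -normc_eq0 normc_imag normr_eq0. Qed.

Lemma kap_le x : normc (kap x) <= 3 / (1 + `|x|).
Proof.
have d0 : 0 < 1 + `|x| by rewrite ltr_pwDl.
rewrite ler_pdivlMr// /kap; have [->|x0] := eqVneq x 0.
  by rewrite normr0 addr0 mulr1 normc1 ler1n.
have nx : 0 < `|x| by rewrite normr_gt0.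
rewrite normcM normcV normc_imag mulrAC ler_pdivrMr//.
have h1 := expi_sub1_le x.
have h2 : normc (expi x - 1) <= 2.
  by rewrite (le_trans (le_normcD _ _))// normcN normc_expi normc1 -(natrD R 1 1).
by nra.
Qed.

Lemma kap_sub1_le y : normc (kap y - 1) <= 2 * `|y|.
Proof.
rewrite /kap; have [->|y0] := eqVneq y 0; first by rewrite subrr normc0 mulr_ge0.
have ny : 0 < `|y| by rewrite normr_gt0.
rewrite (_ : _ - 1 = (expi y - 1 - (0 +i* y)%C) / (0 +i* y)%C); last first.
  by field; exact: imag_neq0.
rewrite normcM normcV normc_imag ler_pdivrMr// -mulrA -expr2.
exact: expi_taylor.
Qed.

(** The uniform measure on [[0, 1]] is the average of its [m] translated copies on segments of
    length [1 / m]; on the transforms this is a geometric sum. *)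
Lemma kap_subdivision x (m : nat) : (0 < m)%N ->
  m%:R^-1 * (\sum_(i < m) expi (i%:R * (x / m%:R))) * kap (x / m%:R) = kap x.
Proof.
move=> m0; have mR : m%:R != 0 :> R by rewrite pnatr_eq0 -lt0n.
have mC : m%:R != 0 :> R[i] by rewrite pnatr_eq0 -lt0n.
rewrite /kap mulf_eq0 invr_eq0 (negbTE mR) orbF.
have [->|x0] := eqVneq x 0.
  rewrite mulr1 (eq_bigr (fun=> 1)); last by move=> i _; rewrite mul0r mulr0 expi0.
  by rewrite sumr_const card_ord mulVf.
rewrite (eq_bigr (fun i : 'I_m => expi (x / m%:R) ^+ i)); last first.
  by move=> i _; rewrite expiMn.
have -> : (0 +i* (x / m%:R))%C = (0 +i* x)%C / m%:R :> R[i].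
  rewrite -(rmorph_nat (real_complex R)) -fmorphV.
  by apply/eqP; rewrite eq_complex /=; apply/andP; split; apply/eqP; ring.
have := subrX1 (expi (x / m%:R)) m.
rewrite -expiMn mulrC divfK// => ->.
by field; rewrite mC imag_neq0.
Qed.

End Kernel.

(** * Moments of sums of independent samples *)

Section Hoeffding.
Variable R : realType.

Lemma expR_le_quad (x : R) : x <= 2^-1 -> expR x <= 1 + x + 2 * x ^+ 2.
Proof.
move=> x2; have h : 1 - x <= expR (- x) by have := expR_ge1Dx (- x).
have e0 := expR_gt0 x.
have : expR x * (1 - x) <= 1.
  by apply: (le_trans (ler_wpM2l (ltW e0) h)); rewrite -expRD subrr expR0.
have : 1 <= (1 + x + 2 * x ^+ 2) * (1 - x).
  rewrite (_ : _ * _ = 1 + x ^+ 2 * (1 - 2 * x)); last by ring.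
  by rewrite lerDl mulr_ge0 ?sqr_ge0//; lra.
move=> h1 h2; have x1 : 0 < 1 - x by lra.
by rewrite -(ler_pM2r x1) (le_trans h2).
Qed.

Variables (I : finType) (N : nat).
Hypothesis N_gt0 : (0 < N)%N.

(** The probability space is the finite set of maps ['I_N -> I] with counting, and independence is
    the expansion of a product of sums. As the linear terms cancel, each factor is at most [#|I|]
    times [expR (1 / N)]. *)
Lemma hoeffding_exp (X : I -> R) : (forall i, `|X i| <= 2^-1) -> \sum_i X i = 0 ->
  \sum_(f : {ffun 'I_N -> I}) expR (\sum_j X (f j) / Num.sqrt N%:R) <=
  #|{ffun 'I_N -> I}|%:R * expR 1.
Proof.
move=> X1 X0; set s := (Num.sqrt N%:R : R)^-1.
have NR : 0 < N%:R :> R by rewrite ltr0n.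
have s0 : 0 < s by rewrite invr_gt0 sqrtr_gt0.
have s2 : s ^+ 2 = N%:R^-1 by rewrite exprVn sqr_sqrtr// ltW.
have s1 : s <= 1.
  by rewrite -(@expr_le1 _ 2)// ?(ltW s0)// s2 invf_le1// ler1n.
have one : \sum_i expR (X i * s) <= #|I|%:R * expR N%:R^-1.
  rewrite (@le_trans _ _ (\sum_i (X i * s + (1 + N%:R^-1))))//.
    apply: ler_sum => i _.
    have := X1 i; rewrite ler_norml => /andP[h1 h2].
    apply: le_trans (expR_le_quad _) _; first by nra.
    rewrite exprMn s2 addrA [X i * s + 1]addrC lerD2l.
    have : X i ^+ 2 <= 4^-1 by nra.
    have Ni : 0 <= N%:R^-1 :> R by rewrite invr_ge0.
    by nra.
  rewrite big_split /= -mulr_suml X0 mul0r add0r sumr_const -[leLHS]mulr_natl.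
  by rewrite ler_wpM2l// expR_ge1Dx.
rewrite (eq_bigr (fun f : {ffun 'I_N -> I} => \prod_j expR (X (f j) * s))); last first.
  by move=> f _; rewrite expR_sum.
rewrite -(bigA_distr_bigA (fun j i => expR (X i * s))) /= card_ffun card_ord natrX.
rewrite prodr_const card_ord.
have -> : expR 1 = expR N%:R^-1 ^+ N :> R.
  by rewrite -expRM_natl mulfV// gt_eqF.
by rewrite -exprMn lerXn2r ?nnegrE ?mulr_ge0 ?expR_ge0// sumr_ge0// => i _; exact: expR_ge0.
Qed.

Lemma powR_le_expR (q x : R) : 0 < q -> 0 <= x -> x `^ q <= q `^ q * expR x.
Proof.
move=> q0 x0.
have -> : expR x = expR (x / q) `^ q by rewrite /powR gt_eqF ?expR_gt0// expRK mulrC divfK ?gt_eqF.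
rewrite -powRM ?expR_ge0 ?(ltW q0)//.
rewrite ge0_ler_powR ?nnegrE ?mulr_ge0 ?expR_ge0 ?(ltW q0)//.
rewrite -ler_pdivrMl// mulrC; apply: le_trans (expR_ge1Dx _).
by rewrite lerDr.
Qed.

(** [|x|^q <= q^q expR |x|] and [expR |x| <= expR x + expR (- x)] reduce the moment to the
    exponential bound for [X] and [- X]. *)
Lemma hoeffding_moment (q : R) (X : I -> R) : 0 < q ->
  (forall i, `|X i| <= 2^-1) -> \sum_i X i = 0 ->
  \sum_(f : {ffun 'I_N -> I}) `|\sum_j X (f j) / Num.sqrt N%:R| `^ q <=
  #|{ffun 'I_N -> I}|%:R * (q `^ q * (2 * expR 1)).
Proof.
move=> q0 X1 X0.
apply: (@le_trans _ _ (\sum_(f : {ffun 'I_N -> I}) q `^ q *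
   (expR (\sum_j X (f j) / Num.sqrt N%:R) + expR (\sum_j (- X (f j)) / Num.sqrt N%:R)))).
  apply: ler_sum => f _; rewrite (le_trans (powR_le_expR q0 (normr_ge0 _)))//.
  rewrite ler_wpM2l ?powR_ge0//.
  have -> : \sum_j - X (f j) / Num.sqrt N%:R = - \sum_j X (f j) / Num.sqrt N%:R.
    by rewrite -sumrN; apply: eq_bigr => j _; rewrite mulNr.
  by case: (ger0P (\sum_j _)) => _; [rewrite lerDl|rewrite lerDr]; exact: expR_ge0.
rewrite -mulr_sumr big_split /= mulrCA ler_wpM2l ?powR_ge0//.
rewrite (_ : _ * (2 * _) = #|{ffun 'I_N -> I}|%:R * expR 1 + #|{ffun 'I_N -> I}|%:R * expR 1); last by ring.
apply: lerD; first exact: hoeffding_exp.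
apply: (hoeffding_exp (X := fun i => - X i)); first by move=> i; rewrite normrN.
by rewrite sumrN X0 oppr0.
Qed.

Lemma hoeffding_complex (q : R) (X : I -> R[i]) : 0 < q ->
  (forall i, normc (X i) <= 2^-1) -> \sum_i X i = 0 ->
  \sum_(f : {ffun 'I_N -> I}) (normc (\sum_j X (f j)) / Num.sqrt N%:R) `^ q <=
  #|{ffun 'I_N -> I}|%:R * (2 `^ q * (2 * (q `^ q * (2 * expR 1)))).
Proof.
move=> q0 X1 X0.
have ReX : \sum_i Re (X i) = 0 by rewrite -Re_sum X0.
have ImX : \sum_i Im (X i) = 0 by rewrite -Im_sum X0.
have hR := hoeffding_moment q0 (fun i => le_trans (Re_le _) (X1 i)) ReX.
have hI := hoeffding_moment q0 (fun i => le_trans (Im_le _) (X1 i)) ImX.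
rewrite (_ : _ * (2 `^ q * _) = 2 `^ q *
  (#|{ffun 'I_N -> I}|%:R * (q `^ q * (2 * expR 1)) +
   #|{ffun 'I_N -> I}|%:R * (q `^ q * (2 * expR 1)))); last by ring.
apply: le_trans (ler_wpM2l (powR_ge0 _ _) (lerD hR hI)).
rewrite -big_split mulr_sumr; apply: ler_sum => f _ /=.
have s0 : 0 < (Num.sqrt N%:R : R)^-1 by rewrite invr_gt0 sqrtr_gt0 ltr0n.
set a := `|_|; set b := `|_|.
have nab : normc (\sum_j X (f j)) / Num.sqrt N%:R <= a + b.
  rewrite (le_trans (ler_wpM2r (ltW s0) (normc_le _)))// mulrDl lerD//.
    by rewrite /a -mulr_suml normrM [`|_^-1|]gtr0_norm// Re_sum.
  by rewrite /b -mulr_suml normrM [`|_^-1|]gtr0_norm// Im_sum.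
have n0 : 0 <= normc (\sum_j X (f j)) / Num.sqrt N%:R by rewrite mulr_ge0 ?normc_ge0 ?(ltW s0).
apply: (@le_trans _ _ ((2 * Num.max a b) `^ q)).
  have mab : 0 <= 2 * Num.max a b by rewrite mulr_ge0// le_max normr_ge0.
  apply: (ge0_ler_powR (ltW q0)); rewrite ?nnegrE//.
  by rewrite (le_trans nab)// mulr_natl mulr2n lerD// le_max lexx ?orbT.
rewrite powRM ?le_max ?normr_ge0// ler_wpM2l ?powR_ge0//.
by rewrite /Num.max; case: ifPn => _; rewrite ?lerDl ?lerDr powR_ge0.
Qed.

End Hoeffding.

(** * Random selection of subsegments *)

Section Sampling.
Variable R : realType.
Implicit Types (Y : seq R) (n : int).

Definition avgs Y (F : R -> R[i]) : R[i] := (size Y)%:R^-1 * \sum_(y <- Y) F y.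

Lemma normc_avgs Y F (B : R) : 0 <= B -> {in Y, forall y, normc (F y) <= B} ->
  normc (avgs Y F) <= B.
Proof.
move=> B0 FB; rewrite normcM normcV normc_nat.
have [->|Y0] := posnP (size Y); first by rewrite invr0 mul0r.
rewrite ler_pdivrMl ?ltr0n// (le_trans (normc_sum _ _ _))// big_seq.
rewrite (le_trans (ler_sum _ (fun y h => FB y h)))// -big_seq.
by rewrite big_const_seq count_predT iter_addr addr0 mulr_natl.
Qed.

(** Averaged over all selections with repetition, the moment bound at each frequency is the same, so
    summing it against [w] gives at most the bound; some selection must do as well as the
    average. *)
Lemma random_selection (q : R) : 0 < q -> exists2 C : R, 0 < C &
  forall (Y : seq R) (N : nat) (w : int -> R) (W : R),
  (0 < size Y)%N -> (0 < N)%N -> (forall n, 0 <= w n) -> sum_le w W ->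
  exists Z : seq R, [/\ size Z = N, {subset Z <= Y} &
    sum_le (fun n => w n * normc (avgs Z (expn n) - avgs Y (expn n)) `^ q)
      (C * (Num.sqrt N%:R)^-1 `^ q * W)].
Proof.
move=> q0; set C0 : R := 2 `^ q * (2 * (q `^ q * (2 * expR 1))).
have C00 : 0 < C0 by rewrite !mulr_gt0 ?powR_gt0 ?expR_gt0.
exists (4 `^ q * C0); first by rewrite mulr_gt0 ?powR_gt0.
move=> Y N w W Y0 N0 w0 wW.
have s0 : 0 < (Num.sqrt N%:R : R)^-1 by rewrite invr_gt0 sqrtr_gt0 ltr0n.
have ss : (Num.sqrt N%:R : R) ^+ 2 = N%:R by rewrite sqr_sqrtr.
set s : R := (Num.sqrt N%:R)^-1 in s0 *.
pose I := 'I_(size Y).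
pose y (i : I) : R := Y`_i.
pose Zf (f : {ffun 'I_N -> I}) := [seq y (f j) | j <- enum 'I_N].
have YC : (size Y)%:R != 0 :> R[i] by rewrite pnatr_eq0 -lt0n.
(* Deviations have modulus at most 2; dividing by 4 meets the bound [2^-1] of
   [hoeffding_complex]. *)
pose zeta n (i : I) : R[i] := (expn n (y i) - avgs Y (expn n)) / 4.
have z1 n i : normc (zeta n i) <= 2^-1.
  rewrite normcM normcV (normc_nat R 4) ler_pdivrMr//.
  rewrite (_ : 2^-1 * 4 = 1 + 1); last by field.
  rewrite (le_trans (le_normcD _ _))// normcN normc_expn lerD2l.
  by apply: normc_avgs => // z _; rewrite normc_expn.
have zS n : \sum_i zeta n i = 0.
  rewrite -mulr_suml sumrB sumr_const card_ord -[avgs _ _ *+ _]mulr_natl /avgs.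
  by rewrite mulrA mulfV// mul1r (big_nth 0) big_mkord subrr mul0r.
have devE f n : normc (avgs (Zf f) (expn n) - avgs Y (expn n)) `^ q =
    4 `^ q * s `^ q * (normc (\sum_j zeta n (f j)) / Num.sqrt N%:R) `^ q.
  rewrite -!powRM ?normc_ge0 ?(ltW s0) ?mulr_ge0 ?normc_ge0 ?(ltW s0)//; congr powR.
  have NC : N%:R != 0 :> R[i] by rewrite pnatr_eq0 -lt0n.
  have -> : avgs (Zf f) (expn n) - avgs Y (expn n) = 4 / N%:R * \sum_j zeta n (f j).
    rewrite -mulr_suml sumrB sumr_const card_ord /avgs size_map size_enum_ord.
    rewrite big_map big_enum /= -[_ *+ N]mulr_natl.
    by field; rewrite NC YC.
  have NE : N%:R^-1 = s * s by rewrite -expr2 /s exprVn ss.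
  by rewrite !normcM normcV !normc_nat NE -/s; ring.
apply: contrapT => H.
have /choice[Xf XfP] : forall f, exists X, uniq X /\
    4 `^ q * C0 * s `^ q * W <
      \sum_(n <- X) w n * normc (avgs (Zf f) (expn n) - avgs Y (expn n)) `^ q.
  move=> f; apply: contrapT => nX; apply: H; exists (Zf f); split.
  - by rewrite size_map size_enum_ord.
  - by move=> z /mapP[j _ ->]; rewrite mem_nth.
  - move=> X uX; rewrite leNgt; apply/negP => lX; apply: nX; by exists X.
(* One finite set of frequencies on which every selection fails, so that the sums over selections
   and frequencies can be exchanged. *)
pose X := undup (flatten [seq Xf f | f <- enum {ffun 'I_N -> I}]).
have uX : uniq X by exact: undup_uniq.
have XfX f : {subset Xf f <= X}.
  move=> n nf; rewrite mem_undup; apply/flattenP; exists (Xf f) => //.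
  by apply: map_f; rewrite mem_enum.
have big f : 4 `^ q * C0 * s `^ q * W <
    \sum_(n <- X) w n * normc (avgs (Zf f) (expn n) - avgs Y (expn n)) `^ q.
  have [uf lf] := XfP f; apply: (lt_le_trans lf); apply: ler_sum_sub => // n.
  by rewrite mulr_ge0// powR_ge0.
have card0 : (0 < #|{ffun 'I_N -> I}|)%N.
  by rewrite card_ffun !card_ord expn_gt0 Y0.
have : #|{ffun 'I_N -> I}|%:R * (4 `^ q * C0 * s `^ q * W) <
   \sum_(f : {ffun 'I_N -> I}) \sum_(n <- X) w n * normc (avgs (Zf f) (expn n) - avgs Y (expn n)) `^ q.
  rewrite mulr_natl -sumr_const; apply: ltr_sum => //.
  by apply/hasP; have [f _] := card_gt0P card0; exists f; rewrite ?mem_index_enum.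
apply/negP; rewrite -leNgt exchange_big /=.
apply: (@le_trans _ _ (\sum_(n <- X) w n * (4 `^ q * s `^ q * (#|{ffun 'I_N -> I}|%:R * C0)))).
  apply: ler_sum => n _; rewrite -mulr_sumr ler_wpM2l//.
  under eq_bigr do rewrite devE.
  rewrite -mulr_sumr ler_wpM2l ?mulr_ge0 ?powR_ge0//.
  exact: (hoeffding_complex N0 q0 (z1 n) (zS n)).
rewrite -mulr_suml mulrC.
rewrite [leRHS](_ : _ = 4 `^ q * s `^ q * (#|{ffun 'I_N -> I}|%:R * C0) * W); last by ring.
rewrite ler_wpM2l ?wW// !mulr_ge0 ?powR_ge0// ltW.
Qed.

End Sampling.

(** * One refinement step of the thin set *)

Section Stages.
Variable R : realType.
Implicit Types (Y : seq R) (n : int) (l : R).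

(** Since [q >= 2], the decay of [kap] gives [3^q / (1 + |n| l)^2], the summand treated by
    [sum_powR_sqr_le]. *)
Lemma kap_weight_sum (q s : R) : 2 <= q -> 0 <= s < 1 ->
  exists2 C : R, 0 < C & forall l, 0 < l <= 1 ->
    sum_le (fun n => (1 + `|n|%:~R) `^ (- s) * normc (kap (n%:~R * l)) `^ q)
      (C * l `^ (s - 1)).
Proof.
move=> q2 s01; have /andP[s0 s1] := s01; have s1' : 0 < 1 - s by rewrite subr_gt0.
have q0 : 0 <= q by rewrite (le_trans _ q2).
exists (3 `^ q * (2 * (1 + (1 - s)^-1))).
  by rewrite !mulr_gt0 ?powR_gt0// ltr_pwDl// invr_ge0 ltW.
move=> l /andP[l0 l1].
pose c (i : nat) : R := (1 + i%:R) `^ (- s) / (1 + i%:R * l) ^+ 2.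
have c0 i : 0 <= c i by rewrite divr_ge0 ?powR_ge0 ?sqr_ge0.
have := sum_leZ (powR_ge0 3 q) (sum_absz_le c0 (fun M => sum_powR_sqr_le M s01 l0)).
move=> h; have {h} := le_sum_le _ h => h; apply: sum_le_trans (h _ _) => [|n].
  rewrite -mulrA ler_wpM2l ?powR_ge0// -[leRHS]mulrA ler_wpM2l//.
  have lp : 1 <= l `^ (s - 1).
    rewrite -[leLHS](powRr0 l) ger_powR ?l0//.
    by rewrite subr_le0 ltW.
  by rewrite mulrDl mul1r [_ / _]mulrC lerD2r.
rewrite /c -normz_absz mulrCA ler_wpM2l ?powR_ge0//.
have d1 : 1 <= 1 + `|n|%:~R * l by rewrite lerDl mulr_ge0 ?ler0z// ltW.
have d0 : 0 < 1 + `|n|%:~R * l by rewrite (lt_le_trans _ d1).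
apply: (@le_trans _ _ ((3 / (1 + `|n|%:~R * l)) `^ q)).
  apply: ge0_ler_powR; rewrite ?nnegrE ?normc_ge0 ?divr_ge0 ?(ltW d0)//.
  by rewrite (le_trans (kap_le _))// normrM intr_norm (gtr0_norm l0).
rewrite powRM ?invr_ge0 ?(ltW d0)// ler_wpM2l ?powR_ge0//.
rewrite -powR_inv1 ?(ltW d0)// -powRrM mulN1r powRN lef_pV2 ?posrE ?powR_gt0 ?exprn_gt0//.
by rewrite -powR_mulrn ?(ltW d0)// ler_powR.
Qed.

(* Fourier coefficients of the average of the uniform probability measures on
   the segments [y, y + l]. *)
Definition vcoef Y l n : R[i] := avgs Y (expn n) * kap (n%:~R * l).

Definition subdiv Y l (m : nat) : seq R := [seq y + i%:R * (l / m%:R) | y <- Y, i <- iota 0 m].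

Lemma size_subdiv Y l m : size (subdiv Y l m) = (size Y * m)%N.
Proof. by rewrite size_allpairs size_iota. Qed.

Lemma vcoef_subdiv Y l m n : (0 < m)%N ->
  vcoef (subdiv Y l m) (l / m%:R) n = vcoef Y l n.
Proof.
move=> m0; rewrite /vcoef -(kap_subdivision (n%:~R * l) m0) !mulrA; congr (_ * kap _).
rewrite /avgs size_subdiv natrM invfM /subdiv big_flatten /= big_map -!mulrA; congr (_ * _).
rewrite mulrCA; congr (_ * _); rewrite mulr_suml; apply: eq_bigr => y _.
have -> : iota 0 m = index_iota 0 m by rewrite /index_iota subn0.
rewrite big_map big_mkord mulr_sumr.
apply: eq_bigr => i _; rewrite /expn mulrDr expiD; congr (_ * expi _).
by rewrite mulrCA mulrA.
Qed.

(** The sampling bound [C1 C2 N^(- q / 2) l'^(beta q - 1)] equals [C1 C2 (N l'^alpha)^(- q / 2)],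
    because [alpha q / 2 = 1 - beta q]. So [N] just above [A l'^(- alpha)] works at every scale with
    the same [A], and [l'] stays free to make the logarithm large. *)
Lemma stage_step (q beta alpha gamma : R) : 2 <= q -> 0 <= beta -> beta * q < 1 ->
  alpha = 2 / q * (1 - beta * q) -> 0 < gamma ->
  forall Y l e, (0 < size Y)%N -> 0 < l <= 1 -> 0 < e ->
  exists Y' l', [/\ (0 < size Y')%N, 0 < l' <= 1 /\ l' <= e,
    forall y', y' \in Y' -> exists2 y, y \in Y & y <= y' /\ y' + l' <= y + l,
    (size Y')%:R * log_gauge alpha gamma (3 * l') <= e &
    sum_le (fun n => (1 + `|n|%:~R) `^ (- (beta * q)) *
      normc (vcoef Y' l' n - vcoef Y l n) `^ q) e].
Proof.
move=> q2 b0 bq alphaE g0 Y l e Y0 /andP[l0 l1] e0.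
have q0 : 0 < q by rewrite (lt_le_trans _ q2).
have s01 : 0 <= beta * q < 1 by rewrite bq mulr_ge0// ltW.
have a0 : 0 < alpha by rewrite alphaE mulr_gt0 ?divr_gt0// subr_gt0.
have [C1 C10 sel] := random_selection q0.
have [C2 C20 ker] := kap_weight_sum q2 s01.
have C0 : 0 < C1 * C2 by rewrite mulr_gt0.
(* Chosen so that the sampling bound [C1 C2 A^(- q / 2)] is [e]. *)
pose A := (C1 * C2 / e) `^ (2 / q).
have A0 : 0 < A by rewrite powR_gt0// divr_gt0.
have AE : C1 * C2 * A `^ (- (q / 2)) = e.
  rewrite /A -powRrM (_ : 2 / q * - (q / 2) = -1); last by field; rewrite gt_eqF.
  by rewrite powR_inv1 ?divr_ge0 ?(ltW C0) ?(ltW e0)//; field; rewrite !gt_eqF.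
(* [N l'^alpha] is at most [A + 1], so the covering sum is at most [e] once the logarithm in the
   gauge reaches [L0]; the second bound in [e2] ensures this. *)
pose L0 := ((A + 1) * 3 `^ alpha / e) `^ gamma^-1.
have A10 : 0 < (A + 1) * 3 `^ alpha / e.
  by rewrite divr_gt0// mulr_gt0 ?powR_gt0// addr_gt0.
have L00 : 0 < L0 by rewrite powR_gt0.
pose e2 := Num.min e (expR (1 - L0) / 3).
have e20 : 0 < e2 by rewrite lt_min e0 divr_gt0 ?expR_gt0.
pose m := (Num.bound (l / e2)).+1.
have mR : 0 < m%:R :> R by rewrite ltr0n.
pose l' := l / m%:R.
have l'0 : 0 < l' by rewrite divr_gt0.
have l'1 : l' <= 1 by rewrite ler_pdivrMr// mul1r (le_trans l1)// ler1n.
have l'e : l' <= e2.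
  rewrite ler_pdivrMr// -ler_pdivrMl// mulrC.
  rewrite (le_trans (ltW (archi_boundP (divr_ge0 (ltW l0) (ltW e20)))))//.
  by rewrite ler_nat leqnSn.
have sub0 : (0 < size (subdiv Y l m))%N by rewrite size_subdiv muln_gt0 Y0.
pose x := A * l' `^ (- alpha).
have x0 : 0 < x by rewrite mulr_gt0// powR_gt0.
pose N := (Num.truncn x).+1.
have /andP[xN1 xN2] : (Num.truncn x)%:R <= x < N%:R by rewrite truncn_itv// ltW.
have NR : 0 < N%:R :> R by rewrite ltr0n.
pose w n := (1 + `|n|%:~R) `^ (- (beta * q)) * normc (kap (n%:~R * l')) `^ q.
have w0 n : 0 <= w n by rewrite mulr_ge0 ?powR_ge0.
have wW : sum_le w (C2 * l' `^ (beta * q - 1)) by apply: ker; rewrite l'0.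
have [Z [ZN ZY Zdev]] := sel (subdiv Y l m) N w _ sub0 isT w0 wW.
exists Z, l'; split.
- by rewrite ZN.
- by rewrite l'0 l'1; split => //; rewrite (le_trans l'e)// ge_min lexx.
- move=> y' /ZY/allpairsP[[y i] [yY im ->]]; move: im.
  rewrite mem_iota add0n => /andP[_ im].
  exists y => //=; split; first by rewrite lerDl mulr_ge0// ltW.
  rewrite -addrA lerD2l -/l' -[X in _ + X]mul1r -mulrDl natr1.
  have -> : l = m%:R * l' by rewrite /l' mulrC divfK// gt_eqF.
  by rewrite ler_wpM2r ?(ltW l'0)// ler_nat.
- have l30 : 0 < 3 * l' by rewrite mulr_gt0.
  rewrite ZN /log_gauge gt_eqF// powRM ?(ltW l'0)//.
  have XL : L0 <= ln (expR 1 / (3 * l')).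
    have l3 : 3 * l' <= expR (1 - L0).
      have : l' <= expR (1 - L0) / 3 by rewrite (le_trans l'e)// ge_min lexx orbT.
      by rewrite ler_pdivlMr// mulrC.
    rewrite -[leLHS]expRK ler_ln ?posrE ?expR_gt0 ?divr_gt0 ?expR_gt0//.
    rewrite ler_pdivlMr//; apply: le_trans (ler_wpM2l (expR_ge0 _) l3) _.
    by rewrite -expRD addrC subrK.
  have Xg : ln (expR 1 / (3 * l')) `^ (- gamma) <= e / ((A + 1) * 3 `^ alpha).
    have -> : e / ((A + 1) * 3 `^ alpha) = L0 `^ (- gamma).
      rewrite /L0 -powRrM mulrN mulVf ?gt_eqF// powR_inv1 ?(ltW A10)//.
      by rewrite invf_div.
    have X0 : 0 < ln (expR 1 / (3 * l')) by exact: lt_le_trans XL.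
    rewrite !powRN lef_pV2 ?posrE ?powR_gt0//.
    by rewrite ge0_ler_powR ?nnegrE ?(ltW g0) ?(ltW L00) ?(ltW X0).
  have NA : N%:R * l' `^ alpha <= A + 1.
    have -> : A + 1 = (x + l' `^ (- alpha)) * l' `^ alpha.
      rewrite /x powRN mulrDl mulVf ?gt_eqF ?powR_gt0//.
      by rewrite -mulrA mulVf ?gt_eqF ?powR_gt0// mulr1.
    rewrite ler_wpM2r ?powR_ge0// /N -natr1 lerD//.
    by rewrite -[leLHS](powRr0 l') ger_powR ?l'0// oppr_le0 ltW.
  rewrite [leLHS](_ : _ = N%:R * l' `^ alpha * (3 `^ alpha * ln (expR 1 / (3 * l')) `^ (- gamma))); last by ring.
  apply: (@le_trans _ _ ((A + 1) * (3 `^ alpha * (e / ((A + 1) * 3 `^ alpha))))).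
    by apply: ler_pM; rewrite ?mulr_ge0 ?powR_ge0// ler_wpM2l ?powR_ge0.
  rewrite le_eqVlt; apply/orP; left; apply/eqP; field.
  by rewrite !gt_eqF ?powR_gt0// addr_gt0.
- apply: (sum_le_trans _ (le_sum_le _ Zdev)) => [|n].
    rewrite -AE -mulrA -[leRHS]mulrA ler_wpM2l ?(ltW C10)// mulrCA ler_wpM2l ?(ltW C20)//.
    have -> : (Num.sqrt N%:R)^-1 `^ q = N%:R `^ (- (q / 2)) :> R.
      rewrite -powR12_sqrt// -powRN -powRrM; congr powR.
      by field.
    rewrite -ler_pdivlMr ?powR_gt0// -powRN opprB.
    have -> : A `^ (- (q / 2)) * l' `^ (1 - beta * q) = x `^ (- (q / 2)).
      rewrite /x powRM ?powR_ge0 ?(ltW A0)// -powRrM; congr (_ * powR _ _).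
      by rewrite alphaE; field; rewrite gt_eqF.
    rewrite !powRN lef_pV2 ?posrE ?powR_gt0// ge0_ler_powR ?nnegrE ?divr_ge0 ?(ltW q0) ?(ltW x0) ?(ltW xN2)//.
  rewrite /w -(vcoef_subdiv Y l n (isT : (0 < m)%N)) /vcoef -mulrBl normcM.
  by rewrite powRM ?normc_ge0// -mulrA [_ `^ q * _]mulrC.
Qed.

End Stages.

(** * Series of elements of the span, and duality *)

Section SpanSums.
Variable R : realType.
Implicit Types (u x y : int -> R[i]) (F G U : R -> R[i]) (X : seq int) (n : int).

Lemma usumZ (c : R[i]) x F : usum x F -> usum (fun n => c * x n) (fun t => c * F t).
Proof.
move=> xF e e0; have nc : 0 < normc c + 1 by rewrite ltr_wpDl ?normc_ge0.
have [X0 uX0 X0P] := xF _ (divr_gt0 e0 nc).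
exists X0 => // X uX sX t.
rewrite (_ : _ - _ = c * (F t - tsum X x t)); last first.
  by rewrite mulrBr /tsum mulr_sumr; congr (_ - _); apply: eq_bigr => n _; rewrite mulrA.
rewrite normcM (le_trans (ler_wpM2l (normc_ge0 _) (X0P X uX sX t)))//.
by rewrite mulrCA ler_piMr ?(ltW e0)// ler_pdivrMr// mul1r lerDl.
Qed.

Lemma usum0 : usum (fun=> 0 : R[i]) (fun=> 0).
Proof.
move=> e e0; exists [::] => // X _ _ t; rewrite /tsum big1 ?subrr ?normc0 ?ltW//.
by move=> n _; rewrite mul0r.
Qed.

Lemma usumD x y F G : usum x F -> usum y G ->
  usum (fun n => x n + y n) (fun t => F t + G t).
Proof.
move=> xF yG; have := usumB xF (usumZ (-1) yG).
rewrite (_ : (fun n => _) = fun n => x n + y n); last by apply/funext => n; rewrite mulN1r opprK.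
by rewrite (_ : (fun t => _) = fun t => F t + G t)//; apply/funext => n; rewrite mulN1r opprK.
Qed.

Lemma usum_translate x F (k : int) : usum x F ->
  usum (translate k x) (fun t => expn (- k) t * F t).
Proof.
move=> xF e e0; have [X0 uX0 X0P] := xF e e0.
exists [seq n - k | n <- X0]; first by rewrite map_inj_uniq//; exact: addIr.
move=> X uX sX t.
have uX' : uniq [seq n + k | n <- X] by rewrite map_inj_uniq//; exact: addIr.
have sX' : {subset X0 <= [seq n + k | n <- X]}.
  move=> n nX; apply/mapP; exists (n - k); last by rewrite subrK.
  by apply: sX; apply/mapP; exists n.
have := X0P _ uX' sX' t.
rewrite (_ : tsum X (translate k x) t = expn (- k) t * tsum [seq n + k | n <- X] x t).
  by rewrite -mulrBr normcM normc_expn mul1r.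
rewrite /tsum big_map mulr_sumr; apply: eq_bigr => n _.
by rewrite /translate mulrCA -expnD addrCA addNr addr0.
Qed.

(** A translate multiplies the series by an exponential, so combinations of translates keep the
    zeros of [U]. *)
Lemma usum_span u U w : usum u U -> translate_span u w ->
  exists2 W, usum w W & forall t, U t = 0 -> W t = 0.
Proof.
move=> uU [s ->]; elim: s => [|c s [W sW W0]].
  exists (fun=> 0) => //; rewrite (_ : (fun n => _) = fun=> 0); first exact: usum0.
  by apply/funext => n; rewrite big_nil.
exists (fun t => c.1 * (expn (- c.2) t * U t) + W t).
  rewrite (_ : (fun n => _) = fun n => c.1 * translate c.2 u n +
     \sum_(c <- s) c.1 * translate c.2 u n).
    by apply: usumD => //; apply: usumZ; exact: usum_translate.
  by apply/funext => n; rewrite big_cons.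
by move=> t Ut; rewrite Ut W0// !mulr0 addr0.
Qed.

Lemma usum_delta0 : usum (delta0 R) (fun=> 1).
Proof.
have := usum_finite (delta0 R) (isT : uniq [:: 0 : int]).
rewrite (_ : (fun n => _) = delta0 R).
  rewrite (_ : tsum _ _ = fun=> 1)//.
  by apply/funext => t; rewrite /tsum big_seq1 /delta0 eqxx mul1r expn0.
by apply/funext => n; rewrite inE /delta0; case: eqP.
Qed.

Lemma lpw_delta0 (p beta : R) : 0 < p -> lpw p beta (delta0 R).
Proof.
move=> p0; apply/lpwP; exists 1 => X uX.
rewrite (@le_trans _ _ (\sum_(n <- undup (0 :: X)) normc (delta0 R n) `^ p * weight (p * beta) n))//.
  apply: ler_sum_sub => //; first by move=> n; exact: lp_term_ge0.
    exact: undup_uniq.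
  by move=> n nX; rewrite mem_undup inE nX orbT.
rewrite (bigD1_seq 0) ?undup_uniq ?mem_undup ?inE//= big1 ?addr0; last first.
  by move=> n n0; rewrite /delta0 (negbTE n0) normc0 powR0 ?gt_eqF// mul0r.
by rewrite /delta0 eqxx normc1 powR1 weight0 mulr1.
Qed.

(** Hoelder's inequality for the duality of l^p_beta and l^q_(- beta): the weight is moved from one
    factor to the other. *)
Lemma pairing_le (p q beta e D : R) x (z : int -> R[i]) :
  0 < p -> 0 < q -> p^-1 + q^-1 = 1 -> 0 < e -> 0 < D ->
  lp_le p beta x (e `^ p) ->
  sum_le (fun n => (1 + `|n|%:~R) `^ (- (beta * q)) * normc (z n) `^ q) D ->
  sum_le (fun n => normc (x n) * normc (z n)) (e * D `^ q^-1).
Proof.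
move=> p0 q0 pq e0 D0 xe zD X uX.
rewrite (eq_bigr (fun n => (normc (x n) * weight beta n) * (normc (z n) / weight beta n))); last first.
  by move=> n _; field; rewrite gt_eqF// weight_gt0.
have -> : e = (e `^ p) `^ p^-1 by rewrite -powRrM mulfV ?gt_eqF// powRr1// ltW.
apply: hoelder_sum => //.
- by rewrite powR_gt0.
- by move=> n; rewrite mulr_ge0 ?normc_ge0 ?weight_ge0.
- by move=> n; rewrite divr_ge0 ?normc_ge0 ?weight_ge0.
- apply: le_trans (xe X uX); apply: ler_sum => n _; by rewrite lp_termE.
- apply: le_trans (zD X uX); apply: ler_sum => n _.
  rewrite powRM ?normc_ge0 ?invr_ge0 ?weight_ge0// mulrC /weight -powRN -powRrM.
  by rewrite mulNr.
Qed.

End SpanSums.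

(** * The thin set and its two properties *)

Section Construction.
Variables (R : realType) (p q beta alpha gamma : R).
Hypotheses (p_gt0 : 0 < p) (q_ge2 : 2 <= q) (pq : p^-1 + q^-1 = 1).
Hypotheses (beta_ge0 : 0 <= beta) (betaq : beta * q < 1).
Hypotheses (alphaE : alpha = 2 / q * (1 - beta * q)) (gamma_gt0 : 0 < gamma).

Let stage := (seq R * R)%type.

Let valid (s : stage) := (0 < size s.1)%N /\ 0 < s.2 <= 1.

(** The q-th roots of these tolerances add up to 1, which bounds the total change of a pairing over
    all stages. *)
Let eps (j : nat) : R := (2^-1 ^+ j.+1) `^ q.

Let q_gt0 : 0 < q. Proof. exact: lt_le_trans q_ge2. Qed.

Let half_gt0 j : 0 < 2^-1 ^+ j :> R. Proof. by rewrite exprn_gt0. Qed.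

Let eps_gt0 j : 0 < eps j. Proof. by rewrite powR_gt0. Qed.

Let eps_le j : eps j <= 2^-1 ^+ j.+1.
Proof.
apply: ge1r_powR; last by rewrite (le_trans _ q_ge2)// ler1n.
by rewrite half_gt0 exprn_ile1// invf_le1// ler1n.
Qed.

Let refines (j : nat) (s s' : stage) := [/\ s'.2 <= eps j,
    forall y', y' \in s'.1 -> exists2 y, y \in s.1 & y <= y' /\ y' + s'.2 <= y + s.2,
    (size s'.1)%:R * log_gauge alpha gamma (3 * s'.2) <= eps j &
    sum_le (fun n => (1 + `|n|%:~R) `^ (- (beta * q)) *
      normc (vcoef s'.1 s'.2 n - vcoef s.1 s.2 n) `^ q) (eps j)].

(** Starting from [[1, 2]] keeps all segments, and their enlargements by at most 1 on each side,
    inside [[0, 2 * pi]], so nothing wraps around the circle. *)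
Lemma stages : exists st : nat -> stage, [/\ st 0 = ([:: 1], 1),
  forall j, valid (st j) & forall j, refines j (st j) (st j.+1)].
Proof.
have /choice[f fP] : forall js : nat * stage, exists s', valid js.2 ->
    valid s' /\ refines js.1 js.2 s'.
  move=> [j s]; have [[v1 v2]|nv] := pselect (valid s); last by exists s.
  have [Y' [l' [h1 [h2 h3] h4 h5 h6]]] :=
    stage_step q_ge2 beta_ge0 betaq alphaE gamma_gt0 v1 v2 (eps_gt0 j).
  by exists (Y', l').
pose st := fix st j := if j is i.+1 then f (i, st i) else ([:: 1], 1).
have vst j : valid (st j).
  elim: j => [|j ih]; first by split; rewrite //= ltr01 lexx.
  exact: (fP (j, st j) ih).1.
exists st; split => // j; exact: (fP (j, st j) (vst j)).2.
Qed.

Variable st : nat -> stage.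
Hypotheses (st0 : st 0 = ([:: 1], 1)) (st_valid : forall j, valid (st j)).
Hypothesis (st_refines : forall j, refines j (st j) (st j.+1)).

Let Y j := (st j).1.
Let l j := (st j).2.

Let slab j : set R := [set t | exists2 y, y \in Y j & y <= t <= y + l j].

Let l_gt0 j : 0 < l j. Proof. by case: (st_valid j) => _ /andP[]. Qed.
Let l_le1 j : l j <= 1. Proof. by case: (st_valid j) => _ /andP[]. Qed.

Let slab_sub j : slab j.+1 `<=` slab j.
Proof.
move=> t [y' y'Y /andP[t1 t2]]; case: (st_refines j) => _ h _ _.
have [y yY [h1 h2]] := h y' y'Y; exists y => //.
by apply/andP; split; [exact: le_trans t1|exact: le_trans t2 h2].
Qed.

Let slab_mono i j : (i <= j)%N -> slab j `<=` slab i.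
Proof.
move=> /subnK <-; elim: (j - i)%N => [//|k ih]; rewrite addSn.
by apply: subset_trans ih; exact: slab_sub.
Qed.

Let slab_itv j t : slab j t -> 1 <= t <= 2.
Proof.
move=> /(slab_mono (leq0n j)) [y]; rewrite /Y /l st0 /= inE => /eqP ->.
by rewrite -(natrD R 1 1).
Qed.

Let Y_bounds j y : y \in Y j -> 1 <= y /\ y + l j <= 2.
Proof.
move=> yY; have l0 := l_gt0 j.
have /slab_itv/andP[h1 _] : slab j y by exists y; rewrite // lexx lerDl ltW.
have /slab_itv/andP[_ h2] : slab j (y + l j) by exists y; rewrite // lexx lerDl ltW.
by [].
Qed.

Let closed_slab j : closed (slab j).
Proof.
rewrite /slab; elim: (Y j) => [|y s ih].
  suff -> : [set t | exists2 y, y \in [::] & y <= t <= y + l j] = set0 by exact: closed0.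
  by rewrite -subset0 => t [].
rewrite (_ : [set _ | _] = `[y, y + l j] `|` [set t | exists2 z, z \in s & z <= t <= z + l j]).
  by apply: closedU => //; exact: interval_closed.
apply/seteqP; split => t.
  move=> [z]; rewrite inE => /predU1P[->|zs] h; first by left; rewrite /= in_itv/=.
  by right; exists z.
case; first by rewrite /= in_itv/= => h; exists y; rewrite // mem_head.
by move=> [z zs h]; exists z; rewrite // inE zs orbT.
Qed.

Definition thin_set : set (circle R) := \bigcap_j (@circle_pi R @` slab j).

Let closed_thin : closed thin_set.
Proof.
apply: closed_bigI => j _; rewrite /slab.
have : forall y, y \in Y j -> 1 <= y /\ y + l j <= 2 by exact: Y_bounds.
elim: (Y j) => [|y s ih] hY.
  suff -> : @circle_pi R @` [set t | exists2 y, y \in [::] & y <= t <= y + l j] = set0.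
    exact: closed0.
  by rewrite -subset0 => c [t []].
rewrite (_ : _ @` _ = @circle_pi R @` `[y, y + l j] `|`
   @circle_pi R @` [set t | exists2 z, z \in s & z <= t <= z + l j]).
  apply: closedU; last by apply: ih => z zs; apply: hY; rewrite inE zs orbT.
  apply: closed_arc; rewrite lerDl ltW//= ltrD2l.
  by have := l_le1 j; have := @pi_ge2 R; lra.
apply/seteqP; split => c.
  move=> [t [z]]; rewrite inE => /predU1P[->|zs] h <-; first by left; exists t; rewrite //= in_itv/=.
  by right; exists t => //; exists z.
case; first by move=> [t]; rewrite /= in_itv/= => h <-; exists t => //; exists y; rewrite // mem_head.
by move=> [t [z zs h] <-]; exists t => //; exists z; rewrite // inE zs orbT.
Qed.

Let slab_thin t : (forall j, slab j t) -> thin_set (circle_pi t).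
Proof. by move=> h j _; exists t. Qed.

Let v j n := vcoef (Y j) (l j) n.

Let B0 : exists2 D : R, 0 < D &
  sum_le (fun n => (1 + `|n|%:~R) `^ (- (beta * q)) * normc (v 0 n) `^ q) D.
Proof.
have s01 : 0 <= beta * q < 1 by rewrite betaq mulr_ge0// ltW.
have [C C0 CP] := kap_weight_sum q_ge2 s01.
exists (C * 1 `^ (beta * q - 1)); first by rewrite mulr_gt0// powR_gt0.
apply: le_sum_le (CP 1 _); last by rewrite ltr01 lexx.
move=> n; rewrite /v /vcoef /l /Y st0 /= ler_wpM2l ?powR_ge0//.
apply: ge0_ler_powR; rewrite ?nnegrE ?normc_ge0 ?(ltW q_gt0)//.
rewrite normcM ler_piMl ?normc_ge0//.
by apply: normc_avgs => // y _; rewrite normc_expn.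
Qed.

(** Stage 0 contributes the q-th root of [D] and the change at step [j] at most [2^-(j + 1)], each
    times [e]. The resulting bound does not depend on the stage. *)
Let pairing_stage : exists2 B : R, 0 < B & forall (x : int -> R[i]) (e : R), 0 < e ->
  lp_le p beta x (e `^ p) -> forall j X, uniq X ->
  normc (\sum_(n <- X) x n * v j n) <= e * B.
Proof.
have [D D0 DP] := B0.
exists (D `^ q^-1 + 1); first by rewrite addr_gt0// powR_gt0.
move=> x e e0 xe j X uX.
have h0 := pairing_le p_gt0 q_gt0 pq e0 D0 xe DP.
suff h : \sum_(n <- X) normc (x n) * normc (v j n) <= e * (D `^ q^-1 + (1 - 2^-1 ^+ j)).
  rewrite (le_trans (normc_sum _ _ _))//; under eq_bigr do rewrite normcM.
  rewrite (le_trans h)// ler_wpM2l ?(ltW e0)// lerD2l gerBl ltW//.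
elim: j => [|j ih]; first by rewrite expr0 subrr addr0; exact: h0.
have [_ _ _ dv] := st_refines j.
have h1 := pairing_le p_gt0 q_gt0 pq e0 (eps_gt0 j) xe dv.
have := lerD ih (h1 X uX); rewrite -big_split /= => h2.
apply: (@le_trans _ _ (e * (D `^ q^-1 + (1 - 2^-1 ^+ j)) + e * eps j `^ q^-1)); last first.
  rewrite /eps -powRrM mulfV ?gt_eqF// powRr1 ?(ltW (half_gt0 _))// exprS.
  by rewrite le_eqVlt; apply/orP; left; apply/eqP; field.
apply: le_trans h2; apply: ler_sum => n _; rewrite -mulrDr ler_wpM2l ?normc_ge0//.
rewrite (le_trans _ (le_normcD _ _))// addrC subrK//.
Qed.

(** Compactness: points [t j] of [slab j] with [F (t j) > e] have an ultralimit lying in all the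
    closed nested slabs, where [F] vanishes, against uniform continuity. *)
Let slab_small (F : R -> R) :
  (forall e : R, 0 < e -> exists2 d : R, 0 < d & forall s t, `|s - t| <= d -> F s - F t <= e) ->
  (forall t, (forall j, slab j t) -> F t = 0) ->
  forall e : R, 0 < e -> exists j, forall t, slab j t -> F t <= e.
Proof.
move=> Fc F0 e e0; apply: contrapT => nj.
have /choice[t tP] : forall j, exists t, slab j t /\ e < F t.
  move=> j; apply: contrapT => nt; apply: nj; exists j => t tj.
  by rewrite leNgt; apply/negP => et; apply: nt; exists t.
have tcvg : t @ ultra --> ulim t.
  apply: (@ulim_cvg _ _ 2) => j; have /andP[t1 t2] := slab_itv (tP j).1.
  by rewrite ger0_norm// (le_trans _ t1).
have tau j : slab j (ulim t).
  apply: (closed_cvg (slab j)) tcvg => //; apply: ultra_near.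
  by exists j => // i /= ji; exact: (slab_mono ji (tP i).1).
have e2 : 0 < e / 2 by rewrite divr_gt0.
have [d d0 dP] := Fc _ e2.
have : \forall j \near ultra, `|t j - ulim t| <= d.
  by move/cvgrPdistC_le : tcvg => /(_ d d0).
move=> /filter_ex[j jd].
have := dP _ _ jd; rewrite (F0 _ tau) subr0; have := (tP j).2; lra.
Qed.

Let not_cyclic (u : int -> R[i]) : lpw 1 beta u -> zero_set u = thin_set ->
  ~ cyclic p beta u.
Proof.
move=> lu uE [_ cyc].
have [A uA] := (lpw1P beta u).1 lu.
have [U uU] := abs_usum (l1_le_abs beta_ge0 uA).
have UE t : (forall j, slab j t) -> U t = 0.
  move=> /slab_thin; rewrite -uE => h.
  by rewrite -(usum_fourier t uU).
have [B BB BP] := pairing_stage.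
(* The pairing is then at most 1/4; with two further errors of 1/6 this stays below 1. *)
pose e := (4 * B)^-1.
have e0 : 0 < e by rewrite invr_gt0 mulr_gt0.
have [w uw we] := cyc _ (lpw_delta0 beta p_gt0) e e0.
have xe := lpw_norm_lp_le p_gt0 (ltW e0) we.
have [W wW W0] := usum_span uU uw.
pose x n := delta0 R n - w n.
pose F t := 1 - W t.
have xF : usum x F by exact: usumB (@usum_delta0 R) wW.
have e12 : 0 < 12^-1 :> R by rewrite invr_gt0.
have [|t tP|j jP] := @slab_small (fun t => normc (W t)) _ _ _ e12.
- move=> d d0; have [d' d'0 hd] := usum_unif_continuous wW d0.
  by exists d' => // s t st'; apply: le_trans (hd s t st'); exact: normcB_ge.
- by rewrite W0 ?normc0// UE.
have [X uX /(_ X uX (fun n h => h)) XP] := xF _ e12.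
have near1 t : slab j t -> normc (tsum X x t - 1) <= 6^-1.
  move=> tj; have h1 := jP t tj; have h2 := XP t.
  have -> : tsum X x t - 1 = - (F t - tsum X x t) + - W t by rewrite /F; ring.
  rewrite (le_trans (le_normcD _ _))// !normcN.
  have -> : 6^-1 = 12^-1 + 12^-1 :> R by field.
  exact: lerD.
pose K : R := \sum_(n <- X) normc (x n) * `|n|%:~R.
have K0 : 0 <= K by rewrite sumr_ge0// => n _; rewrite mulr_ge0 ?normc_ge0// ler0z.
(* Cutting each segment into [m] pieces replaces its uniform measure by an average over finitely
   many points: the kernel of a piece is within [2 |n| / m] of 1, a total error of at most 1/6 over
   [X]. *)
pose m := (Num.bound (K * 12)).+1.
have mR : 0 < m%:R :> R by rewrite ltr0n.
have mK : 2 * K / m%:R <= 6^-1.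
  rewrite ler_pdivrMr// -ler_pdivrMl ?invr_gt0// invrK.
  have : K * 12 <= m%:R.
    rewrite (le_trans (ltW (archi_boundP _)))// ?mulr_ge0//.
    by rewrite ler_nat leqnSn.
  by lra.
pose S := subdiv (Y j) (l j) m.
have S0 : (0 < size S)%N.
  by rewrite size_subdiv muln_gt0 andbT; case: (st_valid j).
have SS s : s \in S -> slab j s.
  move=> /allpairsP[[y i] [yY im ->]]; move: im; rewrite mem_iota add0n => /andP[_ im].
  exists y => //=; apply/andP; split; first by rewrite lerDl mulr_ge0// divr_ge0// ltW.
  rewrite lerD2l mulrCA ler_piMr ?(ltW (l_gt0 j))// ler_pdivrMr// mul1r ler_nat ltnW//.
have avg1 : normc (avgs S (tsum X x) - 1) <= 6^-1.
  have -> : avgs S (tsum X x) - 1 = avgs S (fun t => tsum X x t - 1).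
    rewrite /avgs sumrB big_const_seq count_predT iter_addr addr0 mulrBr; congr (_ - _).
    by rewrite mulVf// pnatr_eq0 -lt0n.
  by apply: normc_avgs => // s /SS; exact: near1.
have avgX : avgs S (tsum X x) = \sum_(n <- X) x n * avgs S (expn n).
  rewrite /avgs /tsum exchange_big /= mulr_sumr; apply: eq_bigr => n _.
  by rewrite -mulr_sumr mulrCA.
have vX : normc (\sum_(n <- X) x n * v j n - avgs S (tsum X x)) <= 6^-1.
  apply: le_trans mK; rewrite avgX -sumrB (le_trans (normc_sum _ _ _))//.
  rewrite /K mulr_sumr mulr_suml; apply: ler_sum => n _.
  rewrite -mulrBr normcM [2 * _]mulrCA -mulrA ler_wpM2l ?normc_ge0//.
  rewrite /v -(vcoef_subdiv _ _ n (isT : (0 < m)%N)) /vcoef -/S.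
  rewrite -{2}[avgs S _]mulr1 -mulrBr normcM.
  apply: (@le_trans _ _ (1 * (2 * `|n%:~R * (l j / m%:R)|))).
    rewrite ler_pM ?normc_ge0 ?kap_sub1_le//.
    by apply: normc_avgs => // s _; rewrite normc_expn.
  rewrite mul1r -mulrA ler_wpM2l// normrM -intr_norm ler_wpM2l ?ler0z//.
  rewrite gtr0_norm ?divr_gt0//.
  by rewrite ler_pdivrMr// mulVf ?gt_eqF.
have := BP x e e0 xe j X uX.
have eB : e * B = 4^-1 by rewrite /e; field; rewrite gt_eqF.
rewrite eB => h4.
have : normc (1 : R[i]) <= 6^-1 + 6^-1 + 4^-1.
  apply: le_trans (lerD (lerD avg1 vX) h4).
  set a := avgs _ _; set b := \sum_(n <- X) _.
  have := le_normcD (1 - b) b; have := normc_triangle 1 a b.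
  by rewrite subrK (normcB 1 a) (normcB a b); lra.
by rewrite normc1; lra.
Qed.

Let gauge0 (t : R) : 0 <= log_gauge alpha gamma t.
Proof. by rewrite /log_gauge; case: ifP => // _; rewrite mulr_ge0 ?powR_ge0. Qed.

Let hmeasure_delta_thin (d : R) : 0 < d -> hmeasure_delta (log_gauge alpha gamma) thin_set d = 0%E.
Proof.
move=> d0; apply/le_anti/andP; split; last first.
  apply: le_ereal_inf_tmp => _ [V [_ _ ->]]; apply: nneseries_ge0 => i _ _.
  by rewrite lee_fin.
apply/lee_addgt0Pr => e e0; rewrite add0e.
have [i iP] : exists i, eps i <= Num.min e (d / 3).
  have min0 : 0 < Num.min e (d / 3) by rewrite lt_min e0 divr_gt0.
  exists (Num.bound (Num.min e (d / 3))^-1).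
  apply: (le_trans (eps_le _)).
  set N := Num.bound _.
  have hN : (Num.min e (d / 3))^-1 < N%:R by rewrite archi_boundP// invr_ge0 ltW.
  have N0 : 0 < N%:R :> R by rewrite (lt_trans _ hN)// invr_gt0.
  rewrite exprVn -[leRHS]invrK lef_pV2 ?posrE ?invr_gt0 ?exprn_gt0//.
  by rewrite (le_trans (ltW hN))// -natrX ler_nat (leq_trans (ltnW (ltn_expl N (ltnSn 1))))// leq_pexp2l.
have [h1 h2 h3 _] := st_refines i.
rewrite -/(Y i.+1) -/(l i.+1) in h1 h2 h3; set j := i.+1 in h1 h2 h3.
have lj := l_gt0 j.
(* Enlarging a segment by its length on both sides makes the arc open, whence the factor 3 in the
   gauge; the padding arcs are empty and cost nothing, as the gauge is 0 at 0. *)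
pose V k := if (k < size (Y j))%N then @circle_pi R @` `]((Y j)`_k - l j), ((Y j)`_k + 2 * l j)[
  else @circle_pi R @` `]0, 0[.
have Vlen k : arc_length (V k) = if (k < size (Y j))%N then 3 * l j else 0.
  rewrite /V; case: ifP => kY; last by rewrite arc_length_open ?subr0// mulr_ge0 ?pi_ge0.
  have [y1 y2] := Y_bounds (mem_nth 0 kY).
  have lj1 := l_le1 j; have p2 := @pi_ge2 R.
  by rewrite arc_length_open; lra.
apply: (@le_trans _ _ (\sum_(0 <= k <oo) (log_gauge alpha gamma (arc_length (V k)))%:E)%E).
  apply: ereal_inf_lbound; exists V; split => //.
    move=> k; split; first by rewrite /V; case: ifP => _; eexists; eexists.
    rewrite Vlen; case: ifP => _; last exact: ltW.
    move: iP; rewrite le_min => /andP[_ iP].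
    by rewrite mulrC -ler_pdivlMr// (le_trans h1).
  move=> c /(_ j I) [t [y yY /andP[t1 t2]] <-].
  exists (index y (Y j)) => //; rewrite /V index_mem yY nth_index//.
  by exists t => //; rewrite /= in_itv/=; apply/andP; split; lra.
apply: lime_le; first by apply: is_cvg_nneseries => k _ _; rewrite lee_fin.
apply: nearW => M; rewrite sumEFin lee_fin big_mkord.
apply: (@le_trans _ _ ((size (Y j))%:R * log_gauge alpha gamma (3 * l j))); last first.
  by rewrite (le_trans h3)//; move: iP; rewrite le_min => /andP[].
rewrite -(big_mkord predT (fun k => log_gauge alpha gamma (arc_length (V k)))) /=.
apply: (@le_trans _ _ (\sum_(0 <= k < maxn M (size (Y j))) log_gauge alpha gamma (arc_length (V k)))).
  by apply: ler_sum_sub; rewrite ?iota_uniq// => k; rewrite !mem_index_iota /= leq_max => ->.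
rewrite (@big_cat_nat _ _ _ (size (Y j))) ?leq_maxr//=.
rewrite (@eq_big_nat _ _ _ 0 (size (Y j)) _ (fun=> log_gauge alpha gamma (3 * l j))); last first.
  by move=> k /andP[_ kY]; rewrite Vlen kY.
rewrite (@eq_big_nat _ _ _ (size (Y j)) _ _ (fun=> 0)); last first.
  by move=> k /andP[kY _]; rewrite Vlen ltnNge kY /= /log_gauge eqxx.
by rewrite big1_eq addr0 sumr_const_nat subn0 [leRHS]mulr_natl.
Qed.

Lemma thin_setP : [/\ closed thin_set,
  forall u : int -> R[i], lpw 1 beta u -> zero_set u = thin_set -> ~ cyclic p beta u &
  hmeasure (log_gauge alpha gamma) thin_set = 0%E].
Proof.
split; [exact: closed_thin|exact: not_cyclic|].
apply: cvg_lim => //; apply: cvg_near_cst.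
by near=> d; apply: hmeasure_delta_thin; near: d; exact: nbhs_right_gt.
Unshelve. all: by end_near. Qed.

End Construction.

Theorem thin_set_exists (R : realType) (p q beta alpha gamma : R) :
  1 < p -> p < 2 -> q = p / (p - 1) -> 0 <= beta -> beta * q < 1 ->
  alpha = 2 / q * (1 - beta * q) -> 0 < gamma ->
  exists E : set (circle R),
    [/\ closed E,
      forall u : int -> R[i], lpw 1 beta u -> zero_set u = E -> ~ cyclic p beta u &
      hmeasure (log_gauge alpha gamma) E = 0%E].
Proof.
move=> p1 p2 qE b0 bq alphaE g0.
have p0 : 0 < p by exact: lt_trans p1.
have pm0 : 0 < p - 1 by rewrite subr_gt0.
have q2 : 2 <= q by rewrite qE ler_pdivlMr//; lra.
have pq : p^-1 + q^-1 = 1 by rewrite qE invf_div; field; rewrite gt_eqF.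
have [st [st0 stv str]] := stages q2 b0 bq alphaE g0.
exists (thin_set st).
exact: (thin_setP p0 q2 pq b0 bq st0 stv str).
Qed.

Theorem theoremB (R : realType) (p q beta alpha : R)
    (p_gt1 : 1 < p) (p_lt2 : p < 2) (qE : q = p / (p - 1))
    (beta_ge0 : 0 <= beta) (betaq_lt1 : beta * q < 1)
    (alphaE : alpha = 2 / q * (1 - beta * q)) :
  (forall u : int -> R[i], lpw 1 beta u ->
     strong_measure0 alpha (zero_set u) -> cyclic p beta u) /\
  (forall gamma : R, 2 / q < gamma ->
     exists E : set (circle R),
       [/\ closed E,
           forall u : int -> R[i], lpw 1 beta u ->
             zero_set u = E -> ~ cyclic p beta u &
           hmeasure (log_gauge alpha gamma) E = 0%E]).
Proof.
have q_gt0 : 0 < q by rewrite qE divr_gt0 ?subr_gt0// (lt_trans _ p_gt1).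
split=> [u|gamma gamma_gt].
  exact: (strong_measure0_cyclic p_gt1 p_lt2 qE beta_ge0 betaq_lt1 alphaE).
apply: (thin_set_exists p_gt1 p_lt2 qE beta_ge0 betaq_lt1 alphaE).
by rewrite (lt_trans _ gamma_gt)// divr_gt0.
Qed.
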